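(* Let $0<\beta\le n$ and let $1<p_0<\infty$ be fixed. Let $T$ be an operator acting on functions on $\mathbb{R}^n$ that is bounded on $L^{p_0}(\mathbb{R}^n, w\,\mathrm{d}H^\beta_\infty)$ for every $w\in A_{p_0,\beta}$, with the operator norm depending only on the $A_{p_0,\beta}$-constant of $w$. Then the following hold. (A) For any $1<p<p_0$ and any $w\in A_{1,\beta}$, the operator $T$ is bounded on $L^p(\mathbb{R}^n, w\,\mathrm{d}H^\beta_\infty)$. (B) For any $1<p<\infty$ and every quasi-continuous $w\in A_{p,\beta}$, the operator $T$ is bounded on $L^p(\mathbb{R}^n, w\,\mathrm{d}H^\beta_\infty)$.
   Context: Cubes in $\mathbb{R}^n$ have sides parallel to the coordinate axes; $\ell(Q)$ is the side length of $Q$. For $0<\beta\le n$, the $\beta$-dimensional Hausdorff content of $E\subseteq\mathbb{R}^n$ is $H^\beta_\infty(E)=\inf\{\sum_{j}\omega_\beta r_j^\beta: E\subseteq\bigcup_{j=1}^\infty B_j\}$, with $B_j$ open balls of radius $r_j$ and $\omega_\beta=\pi^{\beta/2}/\Gamma(\beta/2+1)$; equivalently, up to multiplicative constants (which are immaterial here), $\inf\{\sum_j \ell(Q_j)^\beta: E\subseteq\bigcup_{j=1}^\infty Q_j\}$ with $Q_j$ cubes. For $f:\mathbb{R}^n\to[0,\infty]$ the Choquet integral is $\int_{\mathbb{R}^n} f\,\mathrm{d}H^\beta_\infty=\int_0^\infty H^\beta_\infty(\{x: f(x)>t\})\,\mathrm{d}t$, and $\int_E f\,\mathrm{d}H^\beta_\infty=\int_{\mathbb{R}^n}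 f\chi_E\,\mathrm{d}H^\beta_\infty$ for $E\subseteq\mathbb{R}^n$. A property holds quasi-everywhere (q.e.) if it holds outside a set $E$ with $H^\beta_\infty(E)=0$. A function $f$ is quasi-continuous if for every $\varepsilon>0$ there is an open set $U$ with $H^\beta_\infty(U)<\varepsilon$ such that $f|_{\mathbb{R}^n\setminus U}$ is finite and continuous. A weight is a non-negative function $w$ on $\mathbb{R}^n$ (values in $[0,\infty]$; $0\cdot\infty=0$ inside integrals, $0^{-a}=\infty$ and $\infty^{-a}=0$ for $a>0$). For $1\le p<\infty$, $L^p(\mathbb{R}^n,w\,\mathrm{d}H^\beta_\infty)$ is the set of quasi-continuous $f:\mathbb{R}^n\to[-\infty,\infty]$ (identified when equal q.e.) with $\|f\|_{L^p(\mathbb{R}^n,w\,\mathrm{d}H^\beta_\infty)}:=\left(\int_{\mathbb{R}^n}|f|^p w\,\mathrm{d}H^\beta_\infty\right)^{1/p}<\infty$ (this need not be a norm). $T$ is bounded on $L^p(\mathbb{R}^n,w\,\mathrm{d}H^\beta_\infty)$ if there is a constant $K$ with $\|Tf\|_{L^p(\mathbb{R}^n,w\,\mathrm{d}H^\beta_\infty)}\le K\|f\|_{L^p(\mathbb{R}^n,w\,\mathrm{d}H^\beta_\infty)}$ for all $f\in L^p(\mathbb{R}^n,w\,\mathrm{d}H^\beta_\infty)$; the operator norm is the least such $K$. The maximal operator is $M_\beta f(x)=\sup_{Q\ni x}\frac{1}{H^\beta_\infty(Q)}\int_Q|f|\,\mathrm{d}H^\beta_\infty$, the supremum being over all cubes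 $Q$ containing $x$. For $1<p<\infty$, $A_{p,\beta}$ is the class of weights $w$ for which there is $A>0$ such that for every cube $Q$, $$\left(\frac{1}{H^\beta_\infty(Q)}\int_Q w\,\mathrm{d}H^\beta_\infty\right)\left(\frac{1}{H^\beta_\infty(Q)}\int_Q w^{-\frac{1}{p-1}}\,\mathrm{d}H^\beta_\infty\right)^{p-1}\le A$$ (in particular both integrals are finite); the least such $A$ is the $A_{p,\beta}$-constant of $w$. $A_{1,\beta}$ is the class of weights $w$ for which there is $K>0$ with $M_\beta w(x)\le K w(x)$ for q.e. $x\in\mathbb{R}^n$. *)

(* Defs.v *)
From HB Require Import structures.
From mathcomp Require Import all_boot all_order all_algebra.
From mathcomp Require Import all_classical all_reals all_analysis.
Set Implicit Arguments.
Unset Strict Implicit.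
Unset Printing Implicit Defensive.
Import Order.TTheory GRing.Theory Num.Theory.
Import numFieldNormedType.Exports.
Local Open Scope classical_set_scope.
Local Open Scope ring_scope.

Definition Gamma (R : realType) (s : R) : R :=
  \int[@lebesgue_measure R]_(x in `]0, +oo[) (x `^ (s - 1) * expR (- x)).

(* For integer [b] this is the volume of the Euclidean unit ball of R^b. *)
Definition omega (R : realType) (b : R) : R := pi `^ (b / 2) / Gamma (b / 2 + 1).

(* The library norm on ['rV[R]_n] is the sup norm, so the Euclidean balls of
   the Hausdorff content are spelled out. *)
Definition eball (R : realType) (n : nat) (c : 'rV[R]_n) (r : R) : set 'rV[R]_n :=
  [set y | Num.sqrt (\sum_(i < n) (y ord0 i - c ord0 i) ^+ 2) < r].

(* A ball of radius 0 is empty and contributes 0, so finite covers count too;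
   this does not affect the infimum. *)
Definition hcontent (R : realType) (n : nat) (b : R) (E : set 'rV[R]_n) : \bar R :=
  ereal_inf [set S | exists (c : nat -> 'rV[R]_n) (r : nat -> R),
    [/\ forall j, 0 <= r j,
        E `<=` \bigcup_j eball (c j) (r j) &
        S = (\sum_(0 <= j <oo) (omega b * r j `^ b)%:E)%E]].

Definition choquet (R : realType) (n : nat) (b : R) (f : 'rV[R]_n -> \bar R) :
    \bar R :=
  (\int[@lebesgue_measure R]_(t in `]0%R, +oo[)
     hcontent b [set x | t%:E < f x])%E.

Definition choquet_on (R : realType) (n : nat) (b : R) (E : set 'rV[R]_n)
    (f : 'rV[R]_n -> \bar R) : \bar R :=
  choquet b (fun x => f x * (\1_E x)%:E)%E.

Definition quasi_everywhere (R : realType) (n : nat) (b : R)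
    (P : 'rV[R]_n -> Prop) : Prop :=
  exists2 E : set 'rV[R]_n, hcontent b E = 0%E & forall x, ~ E x -> P x.

Definition quasi_continuous (R : realType) (n : nat) (b : R)
    (f : 'rV[R]_n -> \bar R) : Prop :=
  forall e : R, 0 < e -> exists U : set 'rV[R]_n,
    [/\ open U, (hcontent b U < e%:E)%E,
        forall x, ~ U x -> f x \is a fin_num &
        {within ~` U, continuous f}].

(* Cubes are taken closed.  Since [hcontent] scales as l^b, a closed cube, its
   interior, and any cube in between have the same content, and each closed cube
   lies in open cubes of nearly the same content; hence [maximal] and [Ap_const]
   below are the same for open, half-open or closed cubes. *)
Definition is_cube (R : realType) (n : nat) (Q : set 'rV[R]_n) : Prop :=
  exists (a : 'rV[R]_n) (l : R),
    0 < l /\ Q = [set y | forall i, a ord0 i <= y ord0 i <= a ord0 i + l].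

Definition average (R : realType) (n : nat) (b : R) (Q : set 'rV[R]_n)
    (f : 'rV[R]_n -> \bar R) : \bar R :=
  ((hcontent b Q)^-1 * choquet_on b Q f)%E.

Definition maximal (R : realType) (n : nat) (b : R) (f : 'rV[R]_n -> \bar R)
    (x : 'rV[R]_n) : \bar R :=
  ereal_sup [set average b Q (fun y => `|f y|%E) | Q in
    [set Q : set 'rV[R]_n | is_cube Q /\ Q x]].

Definition weight (R : realType) (n : nat) (w : 'rV[R]_n -> \bar R) : Prop :=
  forall x, (0 <= w x)%E.

(* The library's [poweR] sends 0 to 0 and +oo to +oo for every nonzero exponent,
   including negative ones, so [w^(-1/(p-1))] is written as the extended inverse
   (0^-1 = +oo and +oo^-1 = 0) of a positive power. *)
Definition dual_weight (R : realType) (n : nat) (p : R)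
    (w : 'rV[R]_n -> \bar R) (x : 'rV[R]_n) : \bar R :=
  ((w x `^ (p - 1)^-1)^-1)%E.

Definition Ap_bound (R : realType) (n : nat) (b p : R)
    (w : 'rV[R]_n -> \bar R) (A : R) : Prop :=
  0 < A /\ forall Q : set 'rV[R]_n, is_cube Q ->
    (average b Q w * average b Q (dual_weight p w) `^ (p - 1) <= A%:E)%E.

(* Finiteness of the integrals is not implied by [Ap_bound], because
   0 * +oo = 0 in [\bar R]. *)
Definition Ap (R : realType) (n : nat) (b p : R) (w : 'rV[R]_n -> \bar R) : Prop :=
  [/\ weight w,
      forall Q : set 'rV[R]_n, is_cube Q ->
        (choquet_on b Q w < +oo)%E /\ (choquet_on b Q (dual_weight p w) < +oo)%E &
      exists A : R, Ap_bound b p w A].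

Definition Ap_const (R : realType) (n : nat) (b p : R)
    (w : 'rV[R]_n -> \bar R) : R :=
  inf [set A : R | Ap_bound b p w A].

Definition A1 (R : realType) (n : nat) (b : R) (w : 'rV[R]_n -> \bar R) : Prop :=
  weight w /\ exists2 K : R, 0 < K &
    quasi_everywhere b (fun x => (maximal b w x <= K%:E * w x)%E).

Definition Lp_norm (R : realType) (n : nat) (b p : R) (w f : 'rV[R]_n -> \bar R) :
    \bar R :=
  (choquet b (fun x => `|f x| `^ p * w x) `^ p^-1)%E.

Definition Lp (R : realType) (n : nat) (b p : R) (w f : 'rV[R]_n -> \bar R) : Prop :=
  quasi_continuous b f /\ (Lp_norm b p w f < +oo)%E.

Definition norm_bound (R : realType) (n : nat) (b p : R) (w : 'rV[R]_n -> \bar R)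
    (T : ('rV[R]_n -> \bar R) -> ('rV[R]_n -> \bar R)) (K : R) : Prop :=
  0 <= K /\ forall f : 'rV[R]_n -> \bar R, Lp b p w f ->
    (Lp_norm b p w (T f) <= K%:E * Lp_norm b p w f)%E.

Definition bounded_on_Lp (R : realType) (n : nat) (b p : R)
    (w : 'rV[R]_n -> \bar R)
    (T : ('rV[R]_n -> \bar R) -> ('rV[R]_n -> \bar R)) : Prop :=
  exists K : R, norm_bound b p w T K.

Definition operator_norm (R : realType) (n : nat) (b p : R)
    (w : 'rV[R]_n -> \bar R)
    (T : ('rV[R]_n -> \bar R) -> ('rV[R]_n -> \bar R)) : R :=
  inf [set K : R | norm_bound b p w T K].

(* Main.v *)
From HB Require Import structures.
From mathcomp Require Import all_boot all_order all_algebra.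
From mathcomp Require Import all_classical all_reals all_analysis.
From mathcomp Require Import ring lra zify.
Require Import Defs.
Set Implicit Arguments.
Unset Strict Implicit.
Unset Printing Implicit Defensive.
Import Order.TTheory GRing.Theory Num.Theory.
Import numFieldNormedType.Exports.
Local Open Scope classical_set_scope.
Local Open Scope ring_scope.

(* The Choquet integral is comparable to the functional [dint f], the infimum of
   [sum_P c_P l(P)^b] over families [c_P >= 0] of dyadic cubes [P] with
   [f <= sum_P c_P 1_P], which is countably subadditive, unlike the Choquet
   integral itself.  Superadditivity is replaced by two facts: the sum of
   [e^m dint 1_{f >= e^m}] over the integers [m] is at most [C dint f], and the
   integrals of [f] over disjoint cubes that satisfy a packing condition sum up
   to at most [C dint f].  They suffice
   for weak and strong type inequalities for dyadic maximal operators with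
   respect to [A_p] weights, hence, by Lerner's argument, for the boundedness of
   the maximal operator on [L^p(w)], and Rubio de Francia's iteration then
   gives [A_1] majorants.

   Extrapolation is by contradiction, which avoids any dependence of constants
   on the weight.  If [T] is unbounded on [L^p(w)], choose [f_k] with
   [|T f_k|] too large compared with [f_k].  One majorant of a series formed
   from all the [|f_k|^p w] (if [p < p0]) or from truncations of the
   [|T f_k|^p w] (if [p > p0]) gives one weight [W] of class [A_p0] for which
   the bound of [T] on [L^p0(W)] contradicts the choice of [f_k] for large [k].
   A weight of class [A_1] equals 0 q.e., or [+oo] q.e., or, after modification on
   a null set, belongs to [A_p]. *)

(** Disjoint cubes may have a total content far larger than that of their union, so the usual weak
    type argument, which sums over disjoint maximal cubes, fails. A maximal packed subfamily of them
    can be summed, and a cube left out of it lies in a cube that the kept ones already fill up to a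
    constant; the A-infinity property of the weight carries the estimate from the kept cubes to this
    larger cube and its neighbours. Positive finite functions are given by their logarithms:
    products, powers and duality become linear in the exponents, Hölder's inequality becomes
    convexity, and the values 0 and [+oo] are confined to null sets or to separate cases. Dyadic
    cubes replace arbitrary ones at the price of layers of neighbours. The classes on closed cubes
    control two layers, the maximal functions run over two layers, and the majorants they produce
    control one, which is enough because a closed cube lies in one layer around a dyadic cube of
    comparable side. An infinite integral of [|T f_k|^p w] cannot be normalised; a truncation with
    finite and still large integral is found from the geometry of covers. *)

Section esum_extra.
Variable R : realType.
Local Open Scope ereal_scope.

Lemma esum_le_term (T : choiceType) (A : set T) (a : T -> \bar R) i :
  (forall i, 0 <= a i) -> A i -> a i <= \esum_(j in A) a j.
Proof.
move=> a0 Ai; rewrite -(esum_set1 (a := a) (t := i))//.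
rewrite [leRHS](esumID [set i])//.
rewrite (_ : A `&` [set i] = [set i]); last first.
  by apply/seteqP; split=> [x []//|x ->].
by rewrite leeDl// esum_ge0.
Qed.

Lemma esum_sub (T : choiceType) (A B : set T) (a : T -> \bar R) :
  (forall i, 0 <= a i) -> A `<=` B -> \esum_(j in A) a j <= \esum_(j in B) a j.
Proof.
move=> a0 AB; rewrite [leRHS](esumID A)//.
rewrite (_ : B `&` A = A); last by apply/setIidPr.
by rewrite leeDl// esum_ge0.
Qed.

Lemma esumZ (T : choiceType) (A : set T) (a : T -> \bar R) (r : R) :
  (forall i, 0 <= a i) -> (0 < r)%R ->
  \esum_(j in A) (r%:E * a j) = r%:E * \esum_(j in A) a j.
Proof.
move=> a0 r0.
have H (s : R) (c : T -> \bar R) : (forall i, 0 <= c i) -> (0 < s)%R ->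
    \esum_(j in A) (s%:E * c j) <= s%:E * \esum_(j in A) c j.
  move=> c0 s0; apply: ge_ereal_sup => _ [X XA <-].
  rewrite -ge0_mule_fsumr//; apply: lee_wpmul2l; first by rewrite lee_fin ltW.
  by apply: ereal_sup_ubound; exists X.
apply/eqP; rewrite eq_le H//=.
rewrite -[X in _ * X](_ : \esum_(j in A) (r^-1%:E * (r%:E * a j)) = _); last first.
  by apply: eq_esum => i _; rewrite muleA -EFinM mulVf ?mul1e// gt_eqF.
apply: (@le_trans _ _ (r%:E * (r^-1%:E * \esum_(j in A) (r%:E * a j)))).
  apply: lee_wpmul2l; first by rewrite lee_fin ltW.
  apply: H; last by rewrite invr_gt0.
  by move=> i; rewrite mule_ge0// lee_fin ltW.
by rewrite muleA -EFinM divff ?mul1e// gt_eqF.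
Qed.

Lemma esumZ0 (T : choiceType) (A : set T) (a : T -> \bar R) (r : R) :
  (forall i, 0 <= a i) -> (0 <= r)%R ->
  \esum_(j in A) (r%:E * a j) = r%:E * \esum_(j in A) a j.
Proof.
move=> a0; rewrite le_eqVlt => /predU1P[<-|]; last exact: esumZ.
by rewrite mul0e esum1// => i _; rewrite mul0e.
Qed.

Lemma esum_exchange (T U : choiceType) (A : set T) (B : set U)
  (a : T -> U -> \bar R) : (forall i j, 0 <= a i j) ->
  \esum_(i in A) \esum_(j in B) a i j = \esum_(j in B) \esum_(i in A) a i j.
Proof.
move=> a0; rewrite !esum_esum//.
rewrite (@reindex_esum _ _ _ (B `*`` (fun=> A)) _ (fun x => (x.2, x.1)))//.
split.
- by move=> [x y] [/=].
- by move=> [x y] [x' y'] _ _ /= [-> ->].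
- by move=> [x y] [/= Ax By]; exists (y, x).
Qed.

Lemma esum_countable_eps (T : countType) (e : R) : (0 < e)%R ->
  \esum_(i in [set: T]) (e / (2 ^ (pickle i).+1)%:R)%:E <= e%:E.
Proof.
move=> e0.
rewrite -(@esum_image R _ _ _ (@pickle T) (fun k => (e / (2 ^ k.+1)%:R)%:E)); last first.
  by move=> i j _ _; exact: (pcan_inj pickleK).
apply: (@le_trans _ _ (\esum_(k in [set: nat]) (e / (2 ^ k.+1)%:R)%:E)).
  by apply: esum_sub => // k; rewrite lee_fin divr_ge0// ltW.
rewrite -nneseries_esumT; last by move=> k; rewrite lee_fin divr_ge0// ltW.
exact/epsilon_trick0/ltW.
Qed.

Lemma esum_cst_fin (T : finType) (a : T -> \bar R) (B : \bar R) :
  (forall i, 0 <= a i) -> (forall i, a i <= B) ->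
  \esum_(i in [set: T]) a i <= (#|T|)%:R%:E * B.
Proof.
move=> a0 aB.
apply: (@le_trans _ _ (\esum_(i in [set: T]) B)); first exact: le_esum.
rewrite esum_fset; [|exact: finite_finset|by move=> i _; exact: le_trans (aB i)].
rewrite (_ : [set: T] = [set` enum T]); last first.
  by apply/seteqP; split => // x _ /=; rewrite mem_enum.
rewrite -fsbig_seq ?enum_uniq// big_const_seq count_predT -cardE.
move: #|T| => n.
elim: n => [|n IH]; first by rewrite mul0e.
rewrite iterS -[X in _ <= X * _]/((1 + n)%:R)%:E natrD EFinD ge0_muleDl ?mul1e//.
exact: (leeD (lexx B) IH).
Qed.

Lemma ereal_ltyP (x : \bar R) : 0 <= x -> x < +oo -> exists2 r : R, (0 <= r)%R & x = r%:E.
Proof.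
move=> x0 xy; exists (fine x); first exact: fine_ge0.
by rewrite fineK// ge0_fin_numE.
Qed.

Lemma esum_nat1 : \esum_(i in [set: nat]) (1 : \bar R) = +oo.
Proof.
apply: eq_infty => r; rewrite -nneseries_esumT//.
apply: le_trans (nneseries_lim_ge (Num.truncn r).+1 _) => //.
rewrite sumEFin big_mkord sumr_const card_ord lee_fin ltW//.
exact: truncnS_gt.
Qed.

End esum_extra.

(** * Dyadic content *)

Section dyadic.
Variables (R : realType) (n : nat) (b : R).
Local Notation V := 'rV[R]_n.

(** A scale [k] and an index [m] stand for the half-open dyadic cube of side [2 ^ k] with corner
    [m * 2 ^ k]. Each point lies in exactly one cube of each scale, so sums over the cubes
    containing it are sums over scales. *)
Definition cubeT : Type := (int * 'rV[int]_n)%type.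
HB.instance Definition _ := Countable.on cubeT.

Definition dy (k : int) (x : V) : 'rV[int]_n :=
  \row_i Num.floor (x ord0 i / 2 ^ k).

(** The side [2 ^ k] to the power [b], kept as an exponential so that its logarithm is linear in
    [k]. *)
Definition rho (k : int) : R := expR (k%:~R * (b * ln 2)).

Definition cube (P : cubeT) : set V := [set x | dy P.1 x = P.2].

(** The cube together with [d] layers of cubes of its scale. *)
Definition ncube (d : int) (P : cubeT) : set V :=
  [set x | forall i, `|dy P.1 x ord0 i - P.2 ord0 i| <= d].

Definition corner (P : cubeT) : V := \row_i ((P.2 ord0 i)%:~R * 2 ^ P.1).

Definition subcube (S P : cubeT) : Prop := S.1 <= P.1 /\ dy P.1 (corner S) = P.2.

Lemma dyE k x i : dy k x ord0 i = Num.floor (x ord0 i / 2 ^ k).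
Proof. by rewrite mxE. Qed.

Lemma side_gt0 (k : int) : 0 < (2 : R) ^ k.
Proof. exact: exprz_gt0. Qed.

Lemma cube_corner P : cube P (corner P).
Proof.
rewrite /cube/=; apply/rowP => i; rewrite dyE mxE.
by rewrite mulfK ?gt_eqF ?side_gt0// intrKfloor.
Qed.

(** The ratio of the two scales is an integer and integers pass through floors; all nesting of the
    dyadic grids comes from here. *)
Lemma floor_scale (k k' : int) (x : R) (m : int) : k <= k' ->
  (m <= Num.floor (x / 2 ^ k')) =
  (m * (2 ^+ `|k' - k|%N) <= Num.floor (x / 2 ^ k)).
Proof.
move=> kk'; rewrite !floor_ge_int !ler_pdivlMr ?side_gt0//.
have -> : (2 : R) ^ k' = 2 ^+ `|k' - k|%N * 2 ^ k.
  rewrite -{1}(subrK k k') expfzDr//; congr (_ * _).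
  by rewrite -{1}(gez0_abs (m := k' - k)) ?subr_ge0.
by rewrite intrM mulrA; congr (_ * _ * _ <= _); rewrite rmorphXn.
Qed.

(** In terms of fine indices a coarse gap [d] is [d] times the ratio of the scales, hence at least
    [d]. The case [d = 0] is the nesting of the cubes. *)
Lemma dy_near (d k k' : int) x y : 0 <= d -> k <= k' ->
  (forall i, `|dy k x ord0 i - dy k y ord0 i| <= d) ->
  forall i, `|dy k' x ord0 i - dy k' y ord0 i| <= d.
Proof.
move=> d0 kk' H i; have {H} := H i; rewrite !dyE.
have e1 : (1 : int) <= 2 ^+ `|k' - k|%N by rewrite exprn_ege1.
have X (u v : R) : Num.floor (u / 2 ^ k) <= Num.floor (v / 2 ^ k) + d ->
    Num.floor (u / 2 ^ k') <= Num.floor (v / 2 ^ k') + d.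
  move=> uv; rewrite -lerBlDr (@floor_scale k)//.
  have := lexx (Num.floor (u / 2 ^ k')); rewrite (@floor_scale k)// => uu.
  move: uv uu e1; move: (Num.floor _) (Num.floor _) (Num.floor _) (2 ^+ _) => *.
  nia.
move=> /[!ler_norml] /andP[A B]; apply/andP; split.
  by rewrite lerBrDr addrC -lerBrDr opprK; apply: X; lia.
by rewrite lerBlDr addrC; apply: X; lia.
Qed.

Lemma dy_up (k k' : int) x y : k <= k' -> dy k x = dy k y -> dy k' x = dy k' y.
Proof.
move=> kk' xy; apply/rowP => i; apply/eqP; rewrite -subr_eq0 -normr_le0.
by apply: (dy_near (k := k)) => // j; rewrite xy subrr normr0.
Qed.

Lemma subcubeP S P x : cube S x -> subcube S P <-> S.1 <= P.1 /\ cube P x.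
Proof.
rewrite /cube/= => Sx; split=> -[SP e]; split=> //.
  by rewrite -e; apply: dy_up SP _; rewrite Sx cube_corner.
by rewrite -e; apply: dy_up SP _; rewrite Sx cube_corner.
Qed.

Lemma subcube_refl P : subcube P P.
Proof. by split => //; exact: cube_corner. Qed.

Lemma subcube_sub S P : subcube S P -> cube S `<=` cube P.
Proof. by move=> SP x Sx; move/(subcubeP P Sx) : SP => []. Qed.

Lemma subcube_nsub (d : int) S P : 0 <= d ->
  subcube S P -> ncube d S `<=` ncube d P.
Proof.
move=> d0 [SP e] x Sx i; rewrite -e; apply: (dy_near d0 SP) => j.
by rewrite (_ : dy S.1 (corner S) = S.2) ?Sx//; exact: cube_corner.
Qed.

Lemma subcube_trans S P Q : subcube S P -> subcube P Q -> subcube S Q.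
Proof.
move=> SP [PQ e]; split; first exact: le_trans SP.1 PQ.
have : cube P (corner S) by apply: subcube_sub SP _ _; exact: cube_corner.
by rewrite /cube/= -e => h; apply: dy_up PQ _; rewrite h; apply/esym/cube_corner.
Qed.

Lemma subcube_anti S P : subcube S P -> P.1 <= S.1 -> S = P.
Proof.
case: S P => [k m] [l p] [/= kl e] lk.
have {}lk : k = l by apply/eqP; rewrite eq_le kl lk.
by subst l; rewrite -e; congr (_, _); apply/esym/(cube_corner (k, m)).
Qed.

Lemma cube_nested S P x : cube S x -> cube P x -> subcube S P \/ subcube P S.
Proof.
move=> Sx Px; have [SP|/ltW PS] := leP S.1 P.1.
  by left; apply/(subcubeP _ Sx).
by right; apply/(subcubeP _ Px).
Qed.

Lemma cube_sub_ncube (d : int) P : 0 <= d -> cube P `<=` ncube d P.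
Proof. by move=> d0 x Px i; rewrite Px subrr normr0. Qed.

Lemma rho_gt0 k : 0 < rho k. Proof. exact: expR_gt0. Qed.

Lemma rho_le k l : 0 < b -> k <= l -> rho k <= rho l.
Proof.
move=> b0 kl; rewrite ler_expR ler_wpM2r ?ler_int// mulr_ge0 ?ltW// ln_gt0//.
by rewrite ltr1n.
Qed.

End dyadic.

(** * Fractional dyadic content as a countably subadditive functional *)

Section dint.
Variables (R : realType) (n : nat) (b : R).
Local Notation V := 'rV[R]_n.
Local Notation cubeT := (cubeT n).
Local Notation rho := (rho b).
Local Open Scope ereal_scope.

Definition cov (c : cubeT -> \bar R) (x : V) : \bar R :=
  \esum_(k in [set: int]) c (k, dy k x).

Definition cost (c : cubeT -> \bar R) : \bar R :=
  \esum_(P in [set: cubeT]) ((rho P.1)%:E * c P).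

(* Fractional version of the dyadic Hausdorff content, as a functional. *)
Definition dint (f : V -> \bar R) : \bar R :=
  ereal_inf [set cost c | c in
    [set c : cubeT -> \bar R | (forall P, 0 <= c P) /\ forall x, f x <= cov c x]].

Lemma cov_ge0 c x : (forall P, 0 <= c P) -> 0 <= cov c x.
Proof. by move=> c0; apply: esum_ge0. Qed.

Lemma cost_ge0 c : (forall P, 0 <= c P) -> 0 <= cost c.
Proof. by move=> c0; apply: esum_ge0 => P _; rewrite mule_ge0// lee_fin ltW// rho_gt0. Qed.

Lemma dint_ge0 f : 0 <= dint f.
Proof. by apply: le_ereal_inf_tmp => _ [c [c0 _] <-]; exact: cost_ge0. Qed.

Lemma dint_le_cost c f : (forall P, 0 <= c P) -> (forall x, f x <= cov c x) ->
  dint f <= cost c.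
Proof. by move=> c0 fc; apply: ereal_inf_lbound; exists c. Qed.

Lemma dint_cover f y : dint f < y -> exists c : cubeT -> \bar R,
  [/\ forall P, 0 <= c P, forall x, f x <= cov c x & cost c < y].
Proof. by move=> /ereal_inf_lt [_ [c [c0 fc] <-]] cy; exists c. Qed.

Lemma dint_le f g : (forall x, f x <= g x) -> dint f <= dint g.
Proof.
move=> fg; apply: ereal_inf_le_tmp => _ [c [c0 gc] <-]; exists c => //.
by split=> // x; exact: le_trans (gc x).
Qed.

(** Families that are optimal for the single terms up to summable errors add up to one family for
    the sum; real coefficients make this possible for functions. *)
Lemma dint_esum (T : countType) (f : T -> V -> \bar R) :
  (forall i x, 0 <= f i x) ->
  dint (fun x => \esum_(i in [set: T]) f i x) <= \esum_(i in [set: T]) dint (f i).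
Proof.
move=> f0.
have s0 : 0 <= \esum_(i in [set: T]) dint (f i) by apply: esum_ge0 => i _; exact: dint_ge0.
have [sfin|] := ltP (\esum_(i in [set: T]) dint (f i)) +oo; last first.
  by rewrite leye_eq => /eqP ->; rewrite leey.
apply/lee_addgt0Pr => e e0.
pose eps (i : T) : R := (e / (2 ^ (pickle i).+1)%:R)%R.
have eps0 i : (0 < eps i)%R by rewrite divr_gt0// ltr0n expn_gt0.
have /choice[c Hc] i : exists c : cubeT -> \bar R,
    [/\ forall P, 0 <= c P, forall x, f i x <= cov c x &
        cost c <= dint (f i) + (eps i)%:E].
  have [c [c0 fc cc]] : exists c : cubeT -> \bar R,
    [/\ forall P, 0 <= c P, forall x, f i x <= cov c x &
        cost c < dint (f i) + (eps i)%:E].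
    apply: dint_cover; rewrite lteDl ?lte_fin//.
    rewrite ge0_fin_numE ?dint_ge0//; apply: le_lt_trans sfin.
    by apply: (@esum_le_term _ _ _ (fun i => dint (f i))) => // j; exact: dint_ge0.
  by exists c; split => //; exact: ltW.
have c0 i P : 0 <= c i P by case: (Hc i).
have fc i x : f i x <= cov (c i) x by case: (Hc i).
pose C P := \esum_(i in [set: T]) c i P.
apply: (@le_trans _ _ (cost C)).
  apply: dint_le_cost => [P|x]; first by apply: esum_ge0.
  rewrite /cov /C esum_exchange//; apply: le_esum => i _; exact: fc.
apply: (@le_trans _ _ (\esum_(i in [set: T]) cost (c i))).
  rewrite /cost esum_exchange; last first.
    by move=> i P; rewrite mule_ge0// lee_fin ltW// rho_gt0.
  by apply: le_esum => P _; rewrite esumZ// rho_gt0.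
apply: (@le_trans _ _ (\esum_(i in [set: T]) (dint (f i) + (eps i)%:E))).
  by apply: le_esum => i _; case: (Hc i).
rewrite esumD; first by apply: leeD2l; exact: esum_countable_eps.
- by move=> i _; exact: dint_ge0.
- by move=> i _; rewrite lee_fin ltW.
Qed.

Lemma esum_bool (a : bool -> \bar R) : (forall i, 0 <= a i) ->
  \esum_(i in [set: bool]) a i = a true + a false.
Proof.
move=> a0; rewrite (esumID [set true])//.
rewrite (_ : setT `&` [set true] = [set true]); last by rewrite setTI.
rewrite (_ : setT `&` ~` [set true] = [set false]) ?esum_set1//.
by apply/seteqP; split => -[] //= -[].
Qed.

Lemma dintD f g : (forall x, 0 <= f x) -> (forall x, 0 <= g x) ->
  dint (fun x => f x + g x) <= dint f + dint g.
Proof.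
move=> f0 g0; pose h (i : bool) := if i then f else g.
have h0 i x : 0 <= h i x by case: i.
have := dint_esum h0; rewrite esum_bool; last by move=> i; exact: dint_ge0.
by apply: le_trans; apply: dint_le => x; rewrite esum_bool.
Qed.

Lemma dintZ_le (r : R) f : (0 < r)%R -> dint (fun x => r%:E * f x) <= r%:E * dint f.
Proof.
move=> r0; rewrite -[_ * dint f]/(r%:E * ereal_inf _) -ereal_inf_pZl//.
apply: le_ereal_inf_tmp => _ [_ [c [c0 fc] <-] <-].
apply: (@le_trans _ _ (cost (fun P => r%:E * c P))).
  apply: dint_le_cost => [P|x]; first by rewrite mule_ge0// lee_fin ltW.
  by rewrite /cov esumZ//; apply: lee_wpmul2l => //; rewrite lee_fin ltW.
rewrite /cost -esumZ//; last first.
  by move=> P; rewrite mule_ge0// lee_fin ltW// rho_gt0.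
by apply: le_esum => P _; rewrite muleCA.
Qed.

Lemma dintZ (r : R) f : (0 < r)%R -> dint (fun x => r%:E * f x) = r%:E * dint f.
Proof.
move=> r0; apply/eqP; rewrite eq_le dintZ_le//=.
have r10 : (0 < r^-1)%R by rewrite invr_gt0.
apply: (@le_trans _ _ (r%:E * (r^-1%:E * dint (fun x => r%:E * f x)))).
  apply: lee_wpmul2l; first by rewrite lee_fin ltW.
  apply: le_trans (dintZ_le _ r10); apply: dint_le => x.
  by rewrite muleA -EFinM mulVf ?mul1e// gt_eqF.
by rewrite muleA -EFinM divff ?mul1e// gt_eqF.
Qed.

Lemma dint0 : dint (fun=> 0) = 0.
Proof.
apply/eqP; rewrite eq_le dint_ge0 andbT.
rewrite -[leRHS](_ : cost (fun=> 0) = 0).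
  by apply: dint_le_cost => // x; apply: cov_ge0.
by rewrite /cost esum1// => P _; rewrite mule0.
Qed.

Lemma dint_cube P : dint (cst 1 \_ (cube P)) <= (rho P.1)%:E.
Proof.
pose c := (cst 1 \_ [set P]) : cubeT -> \bar R.
have c0 Q : 0 <= c Q by rewrite /c patchE; case: ifP.
rewrite -[leRHS](_ : cost c = _).
  apply: dint_le_cost => // x; rewrite patchE; case: ifPn => [|_]; last exact: cov_ge0.
  rewrite inE => Px; rewrite /cov.
  apply: le_trans (@esum_le_term _ _ _ (fun k => c (k, dy k x)) P.1 _ _) => //.
  by rewrite Px -surjective_pairing /c patchE mem_set.
rewrite /cost (eq_esum (b := fun Q => if Q \in [set P] then (rho Q.1)%:E else 0)).
  by rewrite -esum_mkcond esum_set1// lee_fin ltW// rho_gt0.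
by move=> Q _; rewrite /c patchE; case: ifP; rewrite ?mule1 ?mule0.
Qed.

Definition null (N : set V) : Prop := dint (cst 1 \_ N) = 0.

(** Even the value [+oo] on [N] costs nothing: it is a sum of countably many copies of the
    indicator. *)
Lemma nullP N (f : V -> \bar R) : null N -> dint (f \_ N) = 0.
Proof.
move=> N0; apply/eqP; rewrite eq_le dint_ge0 andbT.
apply: (@le_trans _ _ (dint (fun x => \esum_(i in [set: nat]) (cst 1 \_ N) x))).
  apply: dint_le => x; rewrite patchE patchE; case: ifPn => _; last exact: esum_ge0.
  by rewrite esum_nat1 leey.
apply: le_trans (dint_esum _) _ => [_ x|]; first by rewrite patchE; case: ifP.
by rewrite esum1.
Qed.

Lemma null_sub N M : N `<=` M -> null M -> null N.
Proof.
move=> NM M0; apply/eqP; rewrite eq_le dint_ge0 andbT -M0; apply: dint_le => x.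
rewrite !patchE; case: ifPn => [|_]; last by case: ifP.
by rewrite inE => /NM xM; rewrite mem_set.
Qed.

Lemma null_bigcup (T : countType) (N : T -> set V) :
  (forall i, null (N i)) -> null (\bigcup_i N i).
Proof.
move=> N0; apply/eqP; rewrite eq_le dint_ge0 andbT.
apply: (@le_trans _ _ (dint (fun x => \esum_(i in [set: T]) (cst 1 \_ (N i)) x))).
  have h0 i x : 0 <= (cst 1 \_ (N i)) x :> \bar R by rewrite patchE; case: ifP.
  apply: dint_le => x; rewrite patchE; case: ifPn => [|_]; last exact: esum_ge0.
  rewrite inE => -[i _ Nix].
  apply: le_trans (@esum_le_term _ _ _ (fun i => (cst 1 \_ (N i)) x) i _ _) => //.
  by rewrite patchE mem_set.
apply: le_trans (dint_esum _) _ => [i x|]; first by rewrite patchE; case: ifP.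
by rewrite esum1// => i _; exact: N0.
Qed.

Lemma null_setU N M : null N -> null M -> null (N `|` M).
Proof.
move=> N0 M0; pose K i := if i then N else M.
apply: (@null_sub _ (\bigcup_i K i)); last by apply: null_bigcup => -[].
by move=> x [Nx|Mx]; [exists true|exists false].
Qed.

Lemma dint_ae N f g : null N -> (forall x, 0 <= f x) -> (forall x, 0 <= g x) ->
  (forall x, ~ N x -> f x <= g x) -> dint f <= dint g.
Proof.
move=> N0 f0 g0 fg.
apply: (@le_trans _ _ (dint (fun x => g x + (f \_ N) x))).
  apply: dint_le => x; rewrite patchE; case: ifPn => [_|].
    by rewrite leeDr.
  by rewrite notin_setE adde0; exact: fg.
apply: le_trans (dintD _ _) _ => //; first by move=> x; rewrite patchE; case: ifP.
by rewrite (nullP _ N0) adde0.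
Qed.

Lemma dint0P f : (forall x, 0 <= f x) -> dint f = 0 <-> null [set x | f x != 0].
Proof.
move=> f0; split=> [If|N0]; last first.
  apply/eqP; rewrite eq_le dint_ge0 andbT -(nullP f N0).
  apply: dint_le => x; rewrite patchE; case: ifPn => //.
  by rewrite notin_setE /= => /negP; rewrite negbK => /eqP ->.
apply: (@null_sub _ (\bigcup_k [set x | (k.+1%:R^-1)%:E <= f x])).
  move=> x /= fx0; have fx : 0 < f x by rewrite lt_def fx0 f0.
  have [E|fxy] := eqVneq (f x) +oo; first by exists 0%N => //=; rewrite E leey.
  have [r r0 fr] := ereal_ltyP (f0 x) (etrans (ltey _) fxy).
  have {}fx : (0 < r)%R by rewrite fr lte_fin in fx.
  exists (Num.truncn (r^-1)) => //=.
  by rewrite fr lee_fin invf_ple ?posrE// ltW// truncnS_gt.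
apply: null_bigcup => k; apply/eqP; rewrite eq_le dint_ge0 andbT.
have k0 : (0 < k.+1%:R :> R)%R by rewrite ltr0n.
have <- : dint (fun x => k.+1%:R%:E * f x) = 0 by rewrite dintZ// If mule0.
apply: dint_le => x; rewrite patchE; case: ifPn => [|_].
  rewrite inE /= => h; rewrite -[leLHS](_ : k.+1%:R%:E * (k.+1%:R^-1)%:E = 1).
    by apply: lee_wpmul2l h; rewrite lee_fin ltW.
  by rewrite -EFinM divff// gt_eqF.
by rewrite mule_ge0// lee_fin ltW.
Qed.

End dint.

(** * Comparison with the Choquet integral *)

Section integral_extra.
Variable R : realType.
Local Open Scope ereal_scope.

Lemma esum_countable (T : countType) (a : T -> \bar R) : (forall i, 0 <= a i) ->
  \esum_(i in [set: T]) a i =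
  \sum_(0 <= k <oo) (if pickle_inv k is Some i then a i else 0).
Proof.
move=> a0; set u := fun k : nat => if @pickle_inv T k is Some i then a i else 0.
have u0 k : 0 <= u k by rewrite /u; case: pickle_inv.
rewrite nneseries_esumT//.
rewrite (eq_esum (b := fun k => if k \in [set pickle i | i in [set: T]] then u k else 0)).
  rewrite -esum_mkcond esum_image; last by move=> i j _ _; exact: (pcan_inj pickleK).
  by apply: eq_esum => i _; rewrite /u pickleK_inv.
move=> k _; case: ifPn => //; rewrite notin_setE /= => h.
rewrite /u; case E: pickle_inv => [i|//]; exfalso; apply: h; exists i => //.
by have := @pickle_invK T k; rewrite E.
Qed.

(* No measurability is needed because the integral is a supremum over simple
   functions. *)
Lemma le_nnintegral d (T : measurableType d) (mu : measure T R) (D : set T)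
    (f g : T -> \bar R) :
  (forall x, D x -> 0 <= f x) -> (forall x, D x -> f x <= g x) ->
  \int[mu]_(x in D) f x <= \int[mu]_(x in D) g x.
Proof.
move=> f0 fg; rewrite !ge0_integralE//; last first.
  by move=> x Dx; apply: le_trans (fg x Dx); exact: f0.
apply: ereal_sup_le => _ [h hf <-]; exists h => // x.
apply: le_trans (hf x) _; rewrite !patchE; case: ifPn => //.
by rewrite inE => /fg.
Qed.

Lemma integral_esum_indic d (T : measurableType d) (mu : measure T R) (D : set T)
    (I : countType) (h : I -> \bar R) (A : I -> set T) :
  measurable D -> (forall i, measurable (A i)) -> (forall i, 0 <= h i) ->
  \int[mu]_(x in D) (\esum_(i in [set: I]) (cst (h i) \_ (A i)) x) =
  \esum_(i in [set: I]) (h i * mu (D `&` A i)).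
Proof.
move=> mD mA h0.
have hA0 i x : 0 <= (cst (h i) \_ (A i)) x by rewrite patchE; case: ifP => _ /=.
under eq_integral do rewrite esum_countable//.
rewrite integral_nneseries//; last 2 first.
- move=> k; case: pickle_inv => [i|]; last exact: measurable_cst.
  apply: (@measurable_funS _ _ _ _ setT) => //.
  apply/(@measurable_restrictT d default_measure_display T (measurable_realfun.constructive_ereal_extended__canonical__measurable_structure_Measurable R) (A i) (cst (h i))); [exact: mA|exact: measurable_cst].
- move=> k x _; case: pickle_inv => [i|]; [exact: hA0|exact: lexx].
rewrite esum_countable => [|i]; last by rewrite mule_ge0.
apply: eq_eseriesr => k _; case: pickle_inv => [i|]; last exact: integral0.
by rewrite -integral_mkcondr integral_cst//; exact: measurableI.
Qed.

End integral_extra.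

Section choquet_dint.
Variables (R : realType) (n : nat) (b : R).
Hypotheses (b0 : 0 < b) (omega0 : 0 <= omega b).
Local Notation V := 'rV[R]_n.
Local Notation cubeT := (cubeT n).
Local Notation rho := (rho b).
Local Notation hcontent := (hcontent b).

Lemma hcontent_ge0 (E : set V) : (0 <= hcontent E)%E.
Proof.
apply: le_ereal_inf_tmp => _ [c [r [r0 _ ->]]].
by apply: nneseries_ge0 => k _ _; rewrite lee_fin mulr_ge0// powR_ge0.
Qed.

Lemma le_hcontent (E F : set V) : E `<=` F -> (hcontent E <= hcontent F)%E.
Proof.
move=> EF; apply: ereal_inf_le_tmp => _ [c [r [r0 Fc ->]]]; exists c, r; split=> //.
exact: subset_trans Fc.
Qed.

Lemma side_expR (k : int) : (2 : R) ^ k = expR (k%:~R * ln 2).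
Proof.
case: k => k.
  by rewrite -[_ ^ _]/(2 ^+ k) expRM_natl lnK// posrE.
rewrite NegzE -[_ ^ _]/((2 ^+ k.+1)^-1) mulrNz mulNr expRN; congr (_^-1).
by rewrite expRM_natl lnK// posrE.
Qed.

Lemma side_powR (k : int) : ((2 : R) ^ k) `^ b = rho k.
Proof. by rewrite side_expR -expRM /rho; congr expR; ring. Qed.

Lemma cube_itv (P : cubeT) (x : V) i : cube P x ->
  corner R P ord0 i <= x ord0 i < corner R P ord0 i + 2 ^ P.1.
Proof.
move=> Px; have := floor_itv (x ord0 i / 2 ^ P.1).
rewrite -dyE Px ler_pdivlMr ?side_gt0// ltr_pdivrMr ?side_gt0//.
by rewrite mxE intrD mulrDl mul1r.
Qed.

Lemma cube_eball (P : cubeT) : cube P `<=` eball (corner R P) (n.+1%:R * 2 ^ P.1).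
Proof.
move=> x Px; rewrite /eball/=.
have s0 := side_gt0 R P.1.
have r0 : 0 < n.+1%:R * 2 ^ P.1 :> R by rewrite mulr_gt0.
rewrite -[ltRHS](@ger0_norm _ (n.+1%:R * 2 ^ P.1)) ?(ltW r0)//.
rewrite -sqrtr_sqr ltr_sqrt ?exprn_gt0//.
apply: (@le_lt_trans _ _ (\sum_(i < n) (2 ^ P.1) ^+ 2)).
  apply: ler_sum => i _; have /andP[A B] := cube_itv i Px.
  by rewrite ler_sqr ?nnegrE; lra.
rewrite sumr_const card_ord exprMn -[ltLHS]mulr_natl ltr_pM2r ?exprn_gt0//.
by rewrite -natrX ltr_nat; nia.
Qed.

(** Cost, relative to [rho], of an open ball around the corner that contains the whole cube. *)
Definition ballC : R := omega b * n.+1%:R `^ b.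

Lemma ballC_ge0 : (0 <= ballC)%R.
Proof. by rewrite mulr_ge0// powR_ge0. Qed.

Lemma hcontent_cubes (A : set cubeT) (E : set V) : E `<=` \bigcup_(P in A) cube P ->
  (hcontent E <= \esum_(P in A) (ballC * rho P.1)%:E)%E.
Proof.
move=> EA; rewrite esum_mkcond esum_countable; last first.
  move=> P; case: ifP => // _; rewrite lee_fin mulr_ge0 ?ballC_ge0//.
  by rewrite ltW// rho_gt0.
pose c k : V := if @pickle_inv cubeT k is Some P then corner R P else 0.
pose r k : R := if @pickle_inv cubeT k is Some P then
  if P \in A then n.+1%:R * 2 ^ P.1 else 0 else 0.
apply: ereal_inf_lbound; exists c, r; split.
- move=> k; rewrite /r; case: pickle_inv => // P; case: ifP => // _.
  by rewrite mulr_ge0// ltW// side_gt0.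
- move=> x /EA [P AP Px]; exists (pickle P) => //.
  by rewrite /c /r pickleK_inv mem_set//; exact: cube_eball.
- apply: eq_eseriesr => k _; rewrite /r; case: pickle_inv => [P|]; last first.
    by rewrite powR0 ?mulr0// gt_eqF.
  case: ifP => _; last by rewrite powR0 ?mulr0// gt_eqF.
  by rewrite powRM ?ler0n ?ltW ?side_gt0// side_powR mulrA.
Qed.

Local Open Scope ereal_scope.

(** The part of the cover [cov c] contributed by [P] and its ancestors. *)
Definition upsum (c : cubeT -> \bar R) (P : cubeT) : \bar R :=
  \esum_(k in [set k : int | (P.1 <= k)%R]) c (k, dy k (corner R P)).

Section upsum.
Variable c : cubeT -> \bar R.
Implicit Type x : V.
Hypotheses (c0 : forall P, 0 <= c P) (cfin : cost b c < +oo).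

Lemma upsumE k x : upsum c (k, dy k x) = \esum_(j in [set j : int | (k <= j)%R]) c (j, dy j x).
Proof.
apply: eq_esum => j /= kj; congr (c (_, _)); apply: dy_up kj _.
exact: cube_corner (k, dy k x).
Qed.

Lemma upsum_ge0 P : 0 <= upsum c P. Proof. exact: esum_ge0. Qed.

Lemma upsum_step k x :
  upsum c (k, dy k x) = c (k, dy k x) + upsum c ((k + 1)%R, dy (k + 1) x).
Proof.
rewrite !upsumE (esumID [set k])//.
rewrite (_ : _ `&` [set k] = [set k]); last first.
  by apply/seteqP; split=> j /= => [[]//|->].
rewrite esum_set1//; congr (_ + esum _ _).
apply/seteqP; split=> j /=.
  by move=> [kj /eqP jk]; rewrite lezD1 lt_neqAle eq_sym jk.
rewrite lezD1 lt_neqAle => /andP[kj ->]; split => //.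
by move/eqP : kj; apply: contra_not => ->.
Qed.

Lemma upsum_le_cost k x : (rho k)%:E * upsum c (k, dy k x) <= cost b c.
Proof.
rewrite upsumE -esumZ ?rho_gt0//.
apply: (@le_trans _ _ (\esum_(j in [set j : int | (k <= j)%R]) ((rho j)%:E * c (j, dy j x)))).
  by apply: le_esum => j /= kj; apply: lee_wpmul2r => //; rewrite lee_fin rho_le.
rewrite -(@esum_image R _ _ _ (fun j => (j, dy j x) : cubeT)
  (fun P => (rho P.1)%:E * c P)); last by move=> i j _ _ [].
by apply: esum_sub => // P; rewrite mule_ge0// lee_fin ltW// rho_gt0.
Qed.

Lemma upsum_fin P : upsum c P \is a fin_num.
Proof.
rewrite ge0_fin_numE ?upsum_ge0//.
have Pe : (P.1, dy P.1 (corner R P)) = P by rewrite [LHS]surjective_pairing/= (cube_corner R P) -surjective_pairing.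
have := upsum_le_cost P.1 (corner R P); rewrite Pe => /le_lt_trans/(_ cfin).
have [->|] := eqVneq (upsum c P) +oo; last by rewrite ltey.
by rewrite gt0_muley ?lte_fin ?rho_gt0.
Qed.

(** At fine scales the sum exceeds [t] because a finite part of [cov c x] does; at coarse scales
    [upsum_le_cost] bounds it by a multiple of [1 / rho k]. So it passes [t] between two consecutive
    scales. *)
Lemma crossing (t : R) x : (0 < t)%R -> t%:E < cov c x ->
  exists k, t%:E < upsum c (k, dy k x) /\ ~ (t%:E < upsum c ((k + 1)%R, dy (k + 1) x)).
Proof.
move=> t0 tc.
have [k tk] : exists k, t%:E < upsum c (k, dy k x).
  have [_ [X [Xfin _] <-] tX] := ereal_sup_gt tc.
  have [k Xk] : exists k : int, forall j, X j -> (k <= j)%R.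
    move: Xfin => /finite_seqP[s ->].
    exists (- \sum_(j <- s) `|j|)%R => j /= js; rewrite lerNl.
    rewrite (big_rem _ js)/= (@le_trans _ _ `|j|%R)//; first by rewrite -normrN ler_norm.
    by rewrite lerDl sumr_ge0.
  exists k; apply: lt_le_trans tX _; rewrite upsumE.
  by apply: ereal_sup_ubound; exists X => //; split.
apply: contrapT => /forallNP H.
have {}H j : t%:E < upsum c (j, dy j x) -> t%:E < upsum c ((j + 1)%R, dy (j + 1) x).
  by move=> tj; apply: contrapT => tj1; apply: (H j).
have {}H (m : nat) : t%:E < upsum c ((k + m%:Z)%R, dy (k + m%:Z) x).
  elim: m => [|m IH]; first by rewrite addr0.
  by rewrite (_ : (k + m.+1%:Z = k + m%:Z + 1)%R); [exact: H|lia].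
have [C C0 CE] := ereal_ltyP (cost_ge0 b c0) cfin.
have {}H (m : nat) : (rho (k + m%:Z) * t <= C)%R.
  rewrite -lee_fin -CE; apply: le_trans (upsum_le_cost (k + m%:Z) x).
  rewrite EFinM; apply: lee_wpmul2l; last exact: ltW (H m).
  by rewrite lee_fin ltW// rho_gt0.
have L0 : (0 < b * ln 2 :> R)%R by rewrite mulr_gt0// ln_gt0// ltr1n.
have D0 : (0 < rho k * t * (b * ln 2))%R.
  by apply: mulr_gt0 => //; apply: mulr_gt0 => //; exact: rho_gt0.
have := H (Num.truncn (C / (rho k * t * (b * ln 2)))).+1.
set m := (_.+1); apply/negP; rewrite -ltNge.
have : (C < m%:R * (rho k * t * (b * ln 2)))%R by rewrite -ltr_pdivrMr// truncnS_gt.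
move/lt_le_trans; apply.
have -> : (rho (k + m%:Z) = rho k * expR (m%:R * (b * ln 2)))%R.
  by rewrite /rho -expRD intrD -mulrDl; congr expR; rewrite mulrDl.
have := expR_ge1Dx (m%:R * (b * ln 2)); set E := expR _ => hE.
have {}hE : (m%:R * (b * ln 2) <= E)%R by apply: le_trans hE; rewrite lerDr.
rewrite [leRHS]mulrAC mulrCA; apply: ler_wpM2l => //.
by rewrite mulr_ge0 ?ltW// rho_gt0.
Qed.

End upsum.

End choquet_dint.

Section choquet_dint2.
Variables (R : realType) (n : nat) (b : R).
Hypotheses (b0 : 0 < b) (omega0 : 0 <= omega b).
Local Notation V := 'rV[R]_n.
Local Notation cubeT := (cubeT n).
Local Notation rho := (rho b).
Local Notation hcontent := (hcontent b).
Local Notation dint := (dint b).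
Local Open Scope ereal_scope.

Lemma choquet_ge0 (f : V -> \bar R) : 0 <= choquet b f.
Proof. by apply: integral_ge0 => t _; exact: hcontent_ge0. Qed.

(** The cube at which the sum passes [t] does so by its own coefficient. For a fixed [P] the
    admissible [t] form an interval of length [c P], so integration over [t] charges each cube
    exactly its share of the cost. *)
Lemma cover_crossing (c : cubeT -> \bar R) (t : R) :
  (forall P, 0 <= c P) -> cost b c < +oo -> (0 < t)%R ->
  [set x : V | t%:E < cov c x] `<=`
    \bigcup_(P in [set P | t%:E < upsum c P /\ upsum c P <= t%:E + c P]) cube P.
Proof.
move=> c0 cfin t0 x /= tx.
have [k [tk tk1]] := crossing b0 omega0 c0 cfin t0 tx.
exists (k, dy k x) => //=; split=> //.
by rewrite (upsum_step c0) addeC leeD2r//; move/negP : tk1; rewrite -leNgt.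
Qed.

Lemma choquet_cov (c : cubeT -> \bar R) : (forall P, 0 <= c P) ->
  choquet b (cov c) <= (ballC n b)%:E * cost b c.
Proof.
move=> c0.
have [C0|C0] := eqVneq (ballC n b) 0%R.
  rewrite C0 mul0e /choquet.
  rewrite (eq_integral (cst 0)) ?integral0// => t; rewrite inE /= in_itv /= andbT => t0.
  apply/le_anti/andP; split; last exact: hcontent_ge0.
  have : [set x : V | t%:E < cov c x] `<=` \bigcup_(P in [set: cubeT]) cube P.
    by move=> x _; exists (0%R : int, dy 0 x).
  by move/(hcontent_cubes b0 omega0)/le_trans; apply; rewrite esum1// => P _; rewrite C0 mul0r.
have {}C0 : (0 < ballC n b)%R by rewrite lt_def C0 ballC_ge0.
have [cfin|] := ltP (cost b c) +oo; last first.
  by rewrite leye_eq => /eqP ->; rewrite gt0_muley ?leey// lte_fin.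
(* The heights [t] at which [P] is used to cover the level set. *)
pose A (P : cubeT) : set R := `[fine (upsum c P - c P), fine (upsum c P)[%classic.
have ufin P : upsum c P \is a fin_num by exact: upsum_fin cfin P.
have cP P : c P <= upsum c P.
  rewrite /upsum; apply: le_trans (@esum_le_term _ _ _ (fun k => c (k, dy k (corner R P))) P.1 _ _) => //=.
  by rewrite (cube_corner R P) -surjective_pairing.
have cPfin P : c P \is a fin_num.
  by rewrite ge0_fin_numE//; apply: le_lt_trans (cP P) _; rewrite -ge0_fin_numE// upsum_ge0.
pose h (P : cubeT) : \bar R := (ballC n b * rho P.1)%:E.
have h0 P : 0 <= h P by rewrite lee_fin mulr_ge0 ?ltW// rho_gt0.
apply: (@le_trans _ _ (\int[@lebesgue_measure R]_(t in `]0%R, +oo[)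
    (\esum_(P in [set: cubeT]) (cst (h P) \_ (A P)) t))).
  apply: le_nnintegral => t; first by move=> _; exact: hcontent_ge0.
  rewrite /= in_itv /= andbT => t0.
  apply: le_trans (hcontent_cubes b0 omega0 (cover_crossing c0 cfin t0)) _.
  rewrite esum_mkcond; apply: le_esum => P _; rewrite patchE.
  have -> : (t \in A P) = (P \in [set P | t%:E < upsum c P /\ upsum c P <= t%:E + c P]).
    apply/idP/idP; rewrite !inE /A /= in_itv /=.
      rewrite -(lte_fin t) -(lee_fin _ t) !fineK ?fin_numB ?ufin ?cPfin// => /andP[u1 u2].
      by split => //; rewrite -leeBlDr.
    rewrite -(lte_fin t) -(lee_fin _ t) !fineK ?fin_numB ?ufin ?cPfin// => -[u1 u2].
    by rewrite u1 andbT leeBlDr.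
  by case: ifP.
rewrite integral_esum_indic//; last by move=> P; exact: measurable_itv.
rewrite /cost -esumZ//; last by move=> P; rewrite mule_ge0// lee_fin ltW// rho_gt0.
apply: le_esum => P _; rewrite muleA -EFinM; apply: lee_wpmul2l; first exact: h0.
apply: (@le_trans _ _ (@lebesgue_measure R (A P))).
  apply: le_measure; rewrite ?inE; last exact: subIsetr.
    by apply: measurableI; exact: measurable_itv.
  exact: measurable_itv.
rewrite /A lebesgue_measure_itv /= !fineK ?fin_numB ?ufin ?cPfin//.
case: ifP => // _.
by rewrite -(fineK (ufin P)) -(fineK (cPfin P)) -!EFinB lee_fin /=; lra.
Qed.

Lemma choquet_le_dint (f : V -> \bar R) : choquet b f <= (ballC n b)%:E * dint f.
Proof.
have [C0|C0] := eqVneq (ballC n b) 0%R.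
  (* An infimum is scaled only by positive constants. If [ballC] is 0, infinite coefficients cover
     every function at cost [0 * +oo = 0]. *)
  pose c (P : cubeT) : \bar R := +oo.
  have : choquet b (cov c) <= (ballC n b)%:E * cost b c by apply: choquet_cov => P; rewrite /c leey.
  rewrite C0 !mul0e; apply: le_trans; apply: le_nnintegral => t _.
    exact: hcontent_ge0.
  apply: le_hcontent => x /= tf; apply: (@lt_le_trans _ _ +oo); rewrite ?ltry//.
  by apply: (@esum_le_term R int setT (fun k => c (k, dy k x)) 0%R) => // k; rewrite /c leey.
have {}C0 : (0 < ballC n b)%R by rewrite lt_def C0 ballC_ge0.
rewrite -[dint f]/(ereal_inf _) -ereal_inf_pZl//.
apply: le_ereal_inf_tmp => _ [_ [c [c0 fc] <-] <-].
apply: le_trans (choquet_cov c0); apply: le_nnintegral => t _.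
  exact: hcontent_ge0.
by apply: le_hcontent => x /= tf; exact: lt_le_trans (fc x).
Qed.

(** For [t] in the interval from [e^(m-1)] to [e^m] the set where [f > t] contains the one where
    [f >= e^m], and the length of this interval is at least half of [e^m]. *)
Lemma level_sum_le_choquet (f : V -> \bar R) :
  \esum_(m in [set: int]) ((expR m%:~R)%:E * hcontent [set x | (expR m%:~R)%:E <= f x])
  <= (2%:R)%:E * choquet b f.
Proof.
pose A (m : int) : set R := `[expR (m%:~R - 1), expR (m%:~R)[%classic.
pose h (m : int) := hcontent [set x : V | (expR m%:~R)%:E <= f x].
have h0 m : 0 <= h m by exact: hcontent_ge0.
have -> : \esum_(m in [set: int]) ((expR m%:~R)%:E * h m) =
    (2%:R)%:E * \esum_(m in [set: int]) ((2^-1 * expR m%:~R)%:E * h m).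
  rewrite -esumZ//; last by move=> m; rewrite mule_ge0// lee_fin mulr_ge0// ltW// expR_gt0.
  by apply: eq_esum => m _; rewrite muleA -EFinM mulrA divff ?mul1r// pnatr_eq0.
apply: lee_wpmul2l => //.
have lnA m t : (0 < t)%R -> (t \in A m) = (m == Num.floor (ln t) + 1)%R.
  move=> t0; rewrite /A; set l := ln t.
  have tE : t = expR l by rewrite lnK.
  apply/idP/idP; rewrite inE /= in_itv /= tE.
    rewrite ler_expR ltr_expR => /andP[l1 l2].
    have /eqP -> : Num.floor l == (m - 1)%R.
      by rewrite floor_eq subrK l2 andbT intrB.
    by rewrite subrK.
  move=> /eqP ->; rewrite ler_expR ltr_expR intrD addrK floor_le /=.
  by have := floorD1_gt l; rewrite intrD.
apply: (@le_trans _ _ (\int[@lebesgue_measure R]_(t in `]0%R, +oo[)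
    (\esum_(m in [set: int]) (cst (h m) \_ (A m)) t))).
  rewrite integral_esum_indic//; last by move=> m; exact: measurable_itv.
  apply: le_esum => m _; rewrite muleC; apply: lee_wpmul2l => //.
  rewrite (_ : _ `&` A m = A m); last first.
    apply/seteqP; split => t [] //= ; rewrite /A /= !in_itv /= => /andP[t1 t2].
    by rewrite !andbT t1 t2 (lt_le_trans _ t1)// expR_gt0.
  rewrite -[leRHS]/(@lebesgue_measure R (A m)) /A lebesgue_measure_itv /= lte_fin ltr_expR ltrBlDr ltrDl ltr01.
  rewrite -EFinB lee_fin expRD -[X in (_ <= X - _)%R]mulr1 mulrC -mulrBr.
  rewrite ler_pM2l ?expR_gt0//.
  have := expR_ge1Dx (1 : R); rewrite expRN => e1.
  rewrite lerBrDr -lerBrDl; apply: (@le_trans _ _ (2^-1)%R); last by lra.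
  by rewrite lef_pV2 ?posrE ?expR_gt0//; lra.
apply: le_nnintegral => t.
  by move=> _; apply: esum_ge0 => m _; rewrite patchE; case: ifP => //=.
rewrite /= in_itv /= andbT => t0.
rewrite (eq_esum (b := fun m => if m \in [set (Num.floor (ln t) + 1)%R] then h m else 0)).
  rewrite -esum_mkcond esum_set1//; apply: le_hcontent => x /=; apply: lt_le_trans.
  rewrite lte_fin -{1}(lnK (x := t)) ?posrE// ltr_expR.
  by have := floorD1_gt (ln t).
move=> m _; rewrite patchE lnA//.
have -> // : (m \in [set (Num.floor (ln t) + 1)%R]) = (m == Num.floor (ln t) + 1)%R.
by apply/idP/eqP; rewrite inE.
Qed.

End choquet_dint2.

(** * Dyadic cubes against balls and closed cubes *)

Section geometry.
Variables (R : realType) (n : nat) (b : R).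
Local Notation V := 'rV[R]_n.
Local Notation cubeT := (cubeT n).
Local Notation rho := (rho b).
Local Notation dint := (dint b).

(** The elements of ['I_3] code the offsets -1, 0, 1, so [e] enumerates the [3 ^ n] cubes that form
    [ncube 1 P]. *)
Definition shift (P : cubeT) (e : {ffun 'I_n -> 'I_3}) : cubeT :=
  (P.1, \row_i (P.2 ord0 i + (e i : nat)%:Z - 1)).

Definition nbrC : R := #|{ffun 'I_n -> 'I_3}|%:R.

Lemma nbrC_gt0 : 0 < nbrC.
Proof. by rewrite ltr0n card_ffun card_ord expn_gt0. Qed.

Lemma ncube1_shift P : ncube 1 P `<=` \bigcup_e (cube (shift P e) : set V).
Proof.
move=> x Px.
exists [ffun i => inord (absz (dy P.1 x ord0 i - P.2 ord0 i + 1))] => //.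
rewrite /cube /=; apply/rowP => i; rewrite [RHS]mxE ffunE inordK.
  have := Px i; move: (dy _ _ _ _) (P.2 _ _) => u v.
  by lia.
by have := Px i; move: (dy _ _ _ _) (P.2 _ _) => u v; lia.
Qed.

(** This is why the maximal functions use two layers: a point of [ncube 1 P] is then admissible for
    all neighbours of [P] at once. *)
Lemma ncube1_ncube2 P e : ncube 1 P `<=` (ncube 2 (shift P e) : set V).
Proof.
move=> x Px i; have := Px i; rewrite /= mxE; have := ltn_ord (e i).
by move: (dy _ _ _ _) (P.2 _ _) (e i : nat) => u v w; lia.
Qed.

Lemma dint_ncube1 (f : V -> \bar R) (P : cubeT) (B : \bar R) : (forall x, 0 <= f x)%E ->
  (forall e, dint (f \_ (cube (shift P e))) <= B)%E ->
  (dint (f \_ (ncube 1 P)) <= nbrC%:E * B)%E.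
Proof.
move=> f0 fB.
have F0 e x : (0 <= (f \_ (cube (shift P e))) x)%E by rewrite patchE; case: ifP.
apply: (@le_trans _ _ (dint (fun x => \esum_(e in [set: {ffun 'I_n -> 'I_3}])
  (f \_ (cube (shift P e))) x)%E)).
  apply: dint_le => x; rewrite patchE; case: ifPn => [|_]; last exact: esum_ge0.
  rewrite inE => /ncube1_shift [e _ ex].
  apply: le_trans (@esum_le_term _ _ setT (fun e => (f \_ (cube (shift P e))) x) e _ _) => //.
  by rewrite patchE mem_set.
apply: le_trans (dint_esum b F0) _.
by apply: esum_cst_fin => // e; exact: dint_ge0.
Qed.

Lemma dint1_ncube1 (P : cubeT) : (dint (cst 1 \_ (ncube 1 P)) <= (nbrC * rho P.1)%:E)%E.
Proof. by rewrite EFinM; apply: dint_ncube1 => // e; exact: dint_cube. Qed.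

Lemma scale_exists (r : R) : 0 < r -> exists k : int, r <= 2 ^ k < 2 * r.
Proof.
move=> r0; have l2 : 0 < ln 2 :> R by rewrite ln_gt0// ltr1n.
exists (Num.ceil (ln r / ln 2)); rewrite side_expR.
have := ceil_itv (ln r / ln 2); rewrite intrB => /andP[A B].
have -> : 2 * r = expR (ln 2 + ln r) by rewrite expRD !lnK ?posrE.
rewrite -{1}(lnK (x := r)) ?posrE//.
rewrite ler_expR ltr_expR; apply/andP; split; first by rewrite -ler_pdivrMr.
by move: A; rewrite ltr_pdivlMr// => A; lra.
Qed.

Lemma near_ncube1 (k : int) (x y : V) :
  (forall i, `|x ord0 i - y ord0 i| <= 2 ^ k) -> ncube 1 (k, dy k y) x.
Proof.
move=> H i; rewrite /= !dyE; have := H i; rewrite !ler_norml => /andP[A B].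
have s0 := side_gt0 R k.
have X (u v : R) : u <= v + 2 ^ k -> Num.floor (u / 2 ^ k) <= Num.floor (v / 2 ^ k) + 1.
  move=> uv; rewrite -ltzD1 floor_lt_int ltr_pdivrMr//.
  have := floorD1_gt (v / 2 ^ k); rewrite ltr_pdivrMr// => h.
  by rewrite intrD mulrDl mul1r; lra.
have X1 : x ord0 i <= y ord0 i + 2 ^ k by lra.
have X2 : y ord0 i <= x ord0 i + 2 ^ k by lra.
by have := X _ _ X1; have := X _ _ X2; lia.
Qed.

Lemma eball_ncube1 (c : V) (r : R) (k : int) : r <= 2 ^ k ->
  eball c r `<=` ncube 1 (k, dy k c).
Proof.
move=> rk y; rewrite /eball/= => yr; apply: near_ncube1 => i.
apply: le_trans rk; apply/ltW; apply: le_lt_trans yr.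
rewrite -sqrtr_sqr ler_wsqrtr// (bigD1 i)//= lerDl sumr_ge0// => j _.
exact: sqr_ge0.
Qed.

Definition closed_cube (a : V) (l : R) : set V :=
  [set y | forall i, a ord0 i <= y ord0 i <= a ord0 i + l].

Lemma closed_cube_ncube1 a l : 0 < l -> exists2 P : cubeT,
  l <= 2 ^ P.1 < 2 * l & closed_cube a l `<=` ncube 1 P.
Proof.
move=> l0; have [k kl] := scale_exists l0.
exists (k, dy k a) => // y /= ya; apply: near_ncube1 => i.
by have := ya i; move: kl => /andP[kl _] /andP[? ?]; rewrite ler_norml; lra.
Qed.

Lemma ncube2_closed_cube (P : cubeT) :
  ncube 2 P `<=` closed_cube (corner R P - const_mx (2 * 2 ^ P.1)) (5 * 2 ^ P.1).
Proof.
move=> x Px i; have := Px i; rewrite !mxE ler_norml => /andP[A B].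
have s0 := side_gt0 R P.1.
have := floor_itv (x ord0 i / 2 ^ P.1); rewrite intrD ler_pdivlMr// ltr_pdivrMr//.
have {}A : (P.2 ord0 i)%:~R - 2 <= (Num.floor (x ord0 i / 2 ^ P.1))%:~R :> R.
  have : P.2 ord0 i - 2 <= Num.floor (x ord0 i / 2 ^ P.1) by lia.
  by rewrite -(ler_int R) intrB.
have {}B : (Num.floor (x ord0 i / 2 ^ P.1))%:~R <= (P.2 ord0 i)%:~R + 2 :> R.
  have : Num.floor (x ord0 i / 2 ^ P.1) <= P.2 ord0 i + 2 by lia.
  by rewrite -(ler_int R) intrD.
by have := ler_wpM2r (ltW s0) A; have := ler_wpM2r (ltW s0) B; lra.
Qed.

Lemma closed_cube_cube a l (k : int) : 2 * 2 ^ k <= l ->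
  exists m, cube (k, m) `<=` closed_cube a l.
Proof.
move=> kl; exists (\row_i (dy k a ord0 i + 1)) => y ya i.
have /andP[] := cube_itv i ya; rewrite !mxE /= intrD.
have s0 := side_gt0 R k.
have := floor_itv (a ord0 i / 2 ^ k); rewrite intrD ler_pdivlMr// ltr_pdivrMr//.
by move=> /andP[? ?]; lra.
Qed.

End geometry.

(** * Comparison on sets, level sums and scaling *)

Section comparison.
Variables (R : realType) (n : nat) (b : R).
Hypotheses (b0 : 0 < b) (omega0 : 0 < omega b).
Local Notation V := 'rV[R]_n.
Local Notation cubeT := (cubeT n).
Local Notation rho := (rho b).
Local Notation hcontent := (hcontent b).
Local Notation dint := (dint b).
Local Notation ballC := (ballC n b).
Local Open Scope ereal_scope.

Let omegaW : (0 <= omega b)%R := ltW omega0.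

Lemma ballC_gt0 : (0 < ballC)%R.
Proof. by rewrite mulr_gt0// powR_gt0. Qed.

(** A ball lies in [nbrC] dyadic cubes of side less than twice its radius, and costs [omega b] times
    the power of the radius. *)
Definition hC : R := (nbrC R n * 2 `^ b / omega b)%R.

Lemma hC_gt0 : (0 < hC)%R.
Proof. by rewrite divr_gt0// mulr_gt0 ?powR_gt0 ?nbrC_gt0. Qed.

Lemma dint_hcontent (E : set V) : dint (cst 1 \_ E) <= hC%:E * hcontent E.
Proof.
rewrite -[hcontent E]/(ereal_inf _) -ereal_inf_pZl ?hC_gt0//.
apply: le_ereal_inf_tmp => _ [S [c [r [r0 Ecr SE]]] <-]; rewrite {}SE.
pose B j : V -> \bar R := cst 1 \_ (eball (c j) (r j)).
have B0 j x : 0 <= B j x by rewrite /B patchE; case: ifP.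
apply: (@le_trans _ _ (dint (fun x => \esum_(j in [set: nat]) B j x))).
  apply: dint_le => x; rewrite patchE; case: ifPn => [|_]; last exact: esum_ge0.
  rewrite inE => /Ecr [j _ jx].
  apply: le_trans (@esum_le_term _ _ setT (B^~ x) j _ _) => //.
  by rewrite /B patchE mem_set.
apply: le_trans (dint_esum b B0) _.
rewrite nneseries_esumT; last by move=> j; rewrite lee_fin mulr_ge0// powR_ge0.
rewrite -esumZ ?hC_gt0//; last by move=> j; rewrite lee_fin mulr_ge0// powR_ge0.
apply: le_esum => j _; rewrite -EFinM.
(* A ball of radius 0 is empty and has no dyadic scale of comparable size. *)
have [rj|rj] := eqVneq (r j) 0%R.
  rewrite (_ : B j = fun=> 0) ?dint0.
    by rewrite lee_fin mulr_ge0 ?(ltW hC_gt0)// mulr_ge0// powR_ge0.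
  apply/funext => x; rewrite /B patchE rj; case: ifPn => //.
  by rewrite inE /eball /= ltNge sqrtr_ge0.
have {}rj : (0 < r j)%R by rewrite lt_def rj r0.
have [k /andP[rk kr]] := scale_exists rj.
apply: (@le_trans _ _ (dint (cst 1 \_ (ncube 1 (k, dy k (c j)))))).
  apply: dint_le => x; rewrite /B !patchE; case: ifPn => [|_]; last by case: ifP.
  by rewrite inE => /(eball_ncube1 rk) xk; rewrite mem_set.
apply: le_trans (dint1_ncube1 _ _) _; rewrite lee_fin /= /hC.
rewrite [leRHS]mulrA divfK ?gt_eqF// -mulrA ler_pM2l ?nbrC_gt0//.
rewrite -powRM ?(ltW rj)// -side_powR.
apply: ge0_ler_powR; rewrite ?nnegrE ?(ltW b0) ?(ltW kr) ?(ltW (side_gt0 _ _))//.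
by rewrite mulr_ge0 ?(ltW rj).
Qed.

(** The level sets of the indicator at heights between 0 and 1 are [E], so its Choquet integral is
    at least the content. *)
Lemma hcontent_dint (E : set V) : hcontent E <= ballC%:E * dint (cst 1 \_ E).
Proof.
apply: le_trans (choquet_le_dint b0 omegaW _).
have <- : \int[@lebesgue_measure R]_(t in `]0%R, +oo[)
    (cst (hcontent E) \_ `]0%R, 1%R[%classic) t = hcontent E.
  rewrite -integral_mkcondr (_ : _ `&` _ = `]0%R, 1%R[%classic).
    rewrite integral_cst; last exact: measurable_itv.
    by rewrite -[X in _ * X]/(@lebesgue_measure R _) lebesgue_measure_itv /= lte_fin ltr01 oppr0 adde0 mule1.
  apply/setIidPr => t; rewrite /= !in_itv /= => /andP[-> _]//.
apply: le_nnintegral => t; first by move=> _; rewrite patchE; case: ifP => // _; exact: hcontent_ge0.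
move=> _; rewrite patchE; case: ifPn => [|_]; last exact: hcontent_ge0.
rewrite inE /= in_itv /= => /andP[t0 t1]; apply: le_hcontent => x Ex /=.
by rewrite patchE mem_set.
Qed.

Lemma hcontent_null (E : set V) : hcontent E = 0 <-> null b E.
Proof.
split=> h; apply/le_anti/andP; split.
- by apply: le_trans (dint_hcontent E) _; rewrite h mule0.
- exact: dint_ge0.
- by apply: le_trans (hcontent_dint E) _; rewrite h mule0.
- exact: hcontent_ge0.
Qed.

Lemma le_level_sum (f : V -> \bar R) x : 0 <= f x ->
  f x <= \esum_(m in [set: int]) ((expR (m%:~R + 1))%:E *
    (cst 1 \_ [set x | (expR m%:~R)%:E <= f x]) x).
Proof.
move=> f0; pose a (m : int) := (expR (m%:~R + 1) : R)%:E *
    (cst (1 : \bar R) \_ [set x | (expR m%:~R)%:E <= f x]) x.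
have a0 m : 0 <= a m by rewrite mule_ge0 ?lee_fin ?expR_ge0// patchE; case: ifP.
have H (m : int) : (expR m%:~R)%:E <= f x ->
    (expR (m%:~R + 1))%:E <= \esum_(m in [set: int]) a m.
  move=> mf; apply: le_trans (@esum_le_term _ _ setT a m a0 _) => //.
  by rewrite /a patchE mem_set// mule1.
have [fy|fy] := eqVneq (f x) +oo.
  rewrite (_ : esum _ _ = +oo) ?leey//; apply: eq_infty => r.
  apply: (le_trans _ (H (Num.floor r) _)); last by rewrite fy leey.
  rewrite lee_fin; apply: le_trans (expR_ge1Dx _).
  by rewrite addrC; apply: ltW; have := floorD1_gt r; rewrite intrD; lra.
have [r r0 fr] := ereal_ltyP f0 (etrans (ltey _) fy).
have [rz|rz] := eqVneq r 0%R; first by rewrite fr rz; apply: esum_ge0 => m _; exact: a0.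
have {}r0 : (0 < r)%R by rewrite lt_def rz.
apply: (le_trans _ (H (Num.floor (ln r)) _)); rewrite fr lee_fin.
  rewrite -{1}(lnK (x := r)) ?posrE// ler_expR.
  by apply: ltW; have := floorD1_gt (ln r); rewrite intrD.
by rewrite -{2}(lnK (x := r)) ?posrE// ler_expR floor_le.
Qed.

Lemma dint_levels (f : V -> \bar R) : (forall x, 0 <= f x) ->
  dint f <= (expR 1)%:E * \esum_(m in [set: int]) ((expR m%:~R)%:E *
    dint (cst 1 \_ [set x | (expR m%:~R)%:E <= f x])).
Proof.
move=> f0; rewrite -esumZ ?expR_gt0//; last first.
  by move=> m; rewrite mule_ge0 ?lee_fin ?expR_ge0// dint_ge0.
apply: le_trans (dint_le b (fun x => le_level_sum (f0 x))) _.
apply: le_trans (dint_esum b _) _.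
  by move=> m x; rewrite mule_ge0 ?lee_fin ?expR_ge0// patchE; case: ifP.
apply: le_esum => m _; rewrite dintZ ?expR_gt0// muleA -EFinM -expRD.
by rewrite [(1 + _)%R]addrC.
Qed.

Definition levC : R := (hC * 2 * ballC)%R.

Lemma levC_gt0 : (0 < levC)%R.
Proof. by apply: mulr_gt0 ballC_gt0; apply: mulr_gt0 => //; exact: hC_gt0. Qed.

Lemma levels_choquet (f : V -> \bar R) :
  \esum_(m in [set: int]) ((expR m%:~R)%:E *
    dint (cst 1 \_ [set x | (expR m%:~R)%:E <= f x])) <=
  (hC * 2)%:E * choquet b f.
Proof.
have hC0 : 0 <= hC%:E by rewrite lee_fin ltW// hC_gt0.
rewrite EFinM -muleA. apply: le_trans (lee_wpmul2l hC0 (level_sum_le_choquet omegaW f)).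
rewrite -esumZ ?hC_gt0//; last first.
  by move=> m; rewrite mule_ge0 ?lee_fin ?expR_ge0// hcontent_ge0.
apply: le_esum => m _; rewrite muleCA.
by apply: lee_wpmul2l; rewrite ?lee_fin ?expR_ge0//; exact: dint_hcontent.
Qed.

(** The detour over the Choquet integral makes this work: there the levels occupy disjoint intervals
    of heights, so their contributions do add up. *)
Lemma levels_dint (f : V -> \bar R) :
  \esum_(m in [set: int]) ((expR m%:~R)%:E *
    dint (cst 1 \_ [set x | (expR m%:~R)%:E <= f x])) <= levC%:E * dint f.
Proof.
apply: le_trans (levels_choquet f) _; rewrite /levC (EFinM (hC * 2)) -[leRHS]muleA.
apply: lee_wpmul2l; first by rewrite lee_fin mulr_ge0 ?(ltW hC_gt0).
exact: choquet_le_dint.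
Qed.

Definition choqC : R := (expR 1 * (hC * 2))%R.

Lemma choqC_gt0 : (0 < choqC)%R.
Proof. by apply: mulr_gt0 (expR_gt0 _) _; apply: mulr_gt0 => //; exact: hC_gt0. Qed.

Lemma dint_le_choquet (f : V -> \bar R) : (forall x, 0 <= f x) ->
  dint f <= choqC%:E * choquet b f.
Proof.
move=> f0; apply: le_trans (dint_levels f0) _; rewrite [choqC%:E]EFinM -muleA.
by apply: lee_wpmul2l; rewrite ?lee_fin ?expR_ge0//; exact: levels_choquet.
Qed.

Definition ucube : cubeT := (0%R, 0%R).

Lemma hcontent_affine (E : set V) (a : R) (v : V) : (0 < a)%R ->
  (a `^ b)%:E * hcontent [set x | E (a *: x + v)%R] <= hcontent E.
Proof.
move=> a0; have p0 : (0 < a `^ b)%R by exact: powR_gt0.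
apply: le_ereal_inf_tmp => _ [c [r [r0 Ecr ->]]].
rewrite muleC -lee_pdivlMr// [leRHS]muleC -nneseriesZl; last first.
  by move=> j _; rewrite lee_fin mulr_ge0// powR_ge0.
apply: ereal_inf_lbound.
exists (fun j => a^-1 *: (c j - v))%R, (fun j => r j / a)%R; split.
- by move=> j; rewrite divr_ge0// ltW.
- move=> x /= /Ecr [j _ jx].
  exists j => //; rewrite /eball /= ltr_pdivlMr// in jx *.
  apply: le_lt_trans jx; rewrite -[X in (_ * X)%R](@ger0_norm _ a) ?(ltW a0)//.
  rewrite -sqrtr_sqr -sqrtrM ?sumr_ge0//; last by move=> i _; exact: sqr_ge0.
  rewrite ler_wsqrtr// mulr_suml ler_sum// => i _; rewrite -exprMn !mxE.
  rewrite le_eqVlt; apply/orP; left; apply/eqP; congr (_ ^+ 2)%R.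
  by field; rewrite gt_eqF.
- apply: eq_eseriesr => j _; rewrite -EFinM; congr (_%:E).
  rewrite powRM ?invr_ge0 ?(ltW a0)// -powR_inv1 ?(ltW a0)// -!powRrM mulrC mulN1r powRN.
  by ring.
Qed.

(** Together with [hcontent_dint] this yields the lower bound on [dint] of a cube that later
    sections assume as [low], as soon as the unit cube has positive content. *)
Lemma hcontent_scale (P : cubeT) :
  (rho P.1)%:E * hcontent (cube ucube) <= hcontent (cube P).
Proof.
have s0 := side_gt0 R P.1.
apply: le_trans (hcontent_affine _ (corner R P) s0); rewrite side_powR.
apply: lee_wpmul2l; first by rewrite lee_fin ltW// rho_gt0.
apply: le_hcontent => x Px /=; rewrite /cube /=; apply/rowP => i; rewrite dyE !mxE.
have := Px; rewrite /cube /= => /rowP /(_ i); rewrite dyE !mxE expr0z divr1 => xi.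
rewrite mulrDl mulfK ?gt_eqF// [X in (X / _)%R]mulrC mulfK ?gt_eqF//.
by rewrite floorDrz ?intr_int// xi intrKfloor add0r.
Qed.

End comparison.

(** * Packing and interpolation *)

Section packing.
Variables (R : realType) (n : nat) (b : R).
Hypothesis b0 : 0 < b.
Local Notation V := 'rV[R]_n.
Local Notation cubeT := (cubeT n).
Local Notation rho := (rho b).
Local Notation dint := (dint b).
Local Notation sub := (subcube R).
Local Open Scope ereal_scope.

(** A Carleson condition. *)
Definition packed (A : set cubeT) (L : R) : Prop := forall P : cubeT,
  \esum_(S in A `&` [set S | sub S P]) (rho S.1)%:E <= (L * rho P.1)%:E.

Definition disjoint_cubes (A : set cubeT) : Prop :=
  forall (S T : cubeT) (x : V), A S -> A T -> cube S x -> cube T x -> S = T.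

Let upper (c : cubeT -> \bar R) (S : cubeT) : \bar R :=
  \esum_(Q in [set Q | sub S Q]) c Q.

(** A cover is localised to [S] by keeping the cubes inside [S] and moving the coefficients of all
    larger cubes onto [S], where they are charged at the price of [S]. *)
Lemma dint_restr_cube (c : cubeT -> \bar R) (f : V -> \bar R) (S : cubeT) :
  (forall P, 0 <= c P) -> (forall x, f x <= cov c x) ->
  dint (f \_ (cube S)) <=
  \esum_(P in [set P | sub P S]) ((rho P.1)%:E * c P) + (rho S.1)%:E * upper c S.
Proof.
move=> c0 fc.
pose c1 := c \_ [set P | sub P S].
pose c2 := cst (upper c S) \_ [set S].
have u0 : 0 <= upper c S by exact: esum_ge0.
have c10 P : 0 <= c1 P by rewrite /c1 patchE; case: ifP.
have c20 P : 0 <= c2 P by rewrite /c2 patchE; case: ifP.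
apply: (@le_trans _ _ (cost b (fun P => c1 P + c2 P))).
  apply: dint_le_cost => [P|x]; first by rewrite adde_ge0.
  rewrite patchE; case: ifPn => [|_]; last by apply: cov_ge0 => P; rewrite adde_ge0.
  rewrite inE => Sx; apply: le_trans (fc x) _.
  rewrite /cov (esumID [set k : int | (k <= S.1)%R])// !setTI.
  rewrite esumD//; apply: leeD.
    rewrite esum_mkcond; apply: le_esum => k _.
    case: ifPn => //; rewrite inE /= => kS.
    rewrite /c1 patchE mem_set//=.
    by apply/(@subcubeP R n (k, dy k x) S x erefl).
  apply: (@le_trans _ _ (upper c S)).
    rewrite -(@esum_image R _ _ _ (fun k => (k, dy k x) : cubeT) c); last by move=> i j _ _ [].
    apply: esum_sub => // _ [k /= kS <-].
    apply/(subcubeP _ Sx); split => //=.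
    by rewrite leNgt; apply/negP => /ltW.
  apply: le_trans (@esum_le_term _ _ setT (fun k => c2 (k, dy k x)) S.1 _ _) => //.
  by rewrite /c2 patchE mem_set//= Sx -surjective_pairing.
rewrite /cost.
under eq_esum => P _ do rewrite ge0_muleDr//.
have r0 (P : cubeT) : 0 <= (rho P.1)%:E by rewrite lee_fin ltW// rho_gt0.
rewrite esumD; [|by move=> P _; rewrite mule_ge0..].
apply: leeD.
  rewrite [leRHS]esum_mkcond; apply: le_esum => P _; rewrite /c1 patchE.
  by case: ifP => //; rewrite mule0.
rewrite (eq_esum (b := fun P => if P \in [set S] then (rho S.1)%:E * upper c S else 0)).
  by rewrite -esum_mkcond esum_set1// mule_ge0.
move=> P _; rewrite /c2 patchE; case: ifPn; last by rewrite mule0.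
by rewrite inE => /= ->.
Qed.

(** In the localised covers a cube inside some member of [A] is kept once, by disjointness. The
    coefficient of a larger cube [Q] is charged at the total price of the members inside [Q], which
    is at most [L * rho Q]. *)
Lemma packing (A : set cubeT) (L : R) (f : V -> \bar R) : (0 <= L)%R ->
  disjoint_cubes A -> packed A L ->
  \esum_(S in A) dint (f \_ (cube S)) <= (1 + L)%:E * dint f.
Proof.
move=> L0 dA pA.
have L1 : (0 < 1 + L)%R by lra.
rewrite -[dint f]/(ereal_inf _) -ereal_inf_pZl//.
apply: le_ereal_inf_tmp => _ [_ [c [c0 fc] <-] <-].
have [cfin|] := ltP (cost b c) +oo; last first.
  by rewrite leye_eq => /eqP ->; rewrite gt0_muley ?leey// lte_fin.
have r0 (P : cubeT) : 0 <= (rho P.1)%:E by rewrite lee_fin ltW// rho_gt0.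
have rc0 (P : cubeT) : 0 <= (rho P.1)%:E * c P by rewrite mule_ge0.
have cP (P : cubeT) : exists2 r : R, (0 <= r)%R & c P = r%:E.
  apply: ereal_ltyP => //.
  have := esum_le_term (A := setT) (i := P) rc0 I => /le_lt_trans /(_ cfin).
  have [->|cy] := eqVneq (c P) +oo; last by move=> _; rewrite ltey.
  by rewrite gt0_muley// lte_fin rho_gt0.
apply: (@le_trans _ _ (\esum_(S in A)
  (\esum_(P in [set P | sub P S]) ((rho P.1)%:E * c P) + (rho S.1)%:E * upper c S))).
  by apply: le_esum => S _; exact: dint_restr_cube.
have u0 S : 0 <= upper c S by apply: esum_ge0 => P _; exact: c0.
rewrite esumD; last 2 first.
- by move=> S _; apply: esum_ge0 => P _; exact: rc0.
- by move=> S _; rewrite mule_ge0.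
rewrite EFinD ge0_muleDl ?lee_fin// mul1e; apply: leeD.
  under eq_esum => S _ do rewrite esum_mkcond.
  rewrite esum_exchange; last by move=> S P; case: ifP.
  apply: le_esum => P _.
  have [[S [AS PS]]|nS] := pselect (exists S, A S /\ sub P S); last first.
    rewrite esum1// => S AS; case: ifPn => //; rewrite inE /= => PS.
    by exfalso; apply: nS; exists S.
  rewrite (esumID [set S]); last by move=> T _; case: ifP.
  rewrite [X in _ + X]esum1 ?adde0; last first.
    move=> T [AT /= TS]; case: ifPn => //; rewrite inE /= => PT.
    exfalso; apply: TS; apply: (dA _ _ (corner R P)) => //.
      by apply: subcube_sub PT _ _; exact: cube_corner.
    by apply: subcube_sub PS _ _; exact: cube_corner.
  have -> : A `&` [set S] = [set S] by apply/seteqP; split=> [T []//|T ->].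
  by rewrite esum_set1; case: ifP.
apply: (@le_trans _ _ (\esum_(S in A) \esum_(Q in [set: cubeT])
    (if Q \in [set Q | sub S Q] then (rho S.1)%:E * c Q else 0))).
  apply: le_esum => S _; rewrite -esumZ ?rho_gt0//.
  by rewrite esum_mkcond.
rewrite esum_exchange; last by move=> S Q; case: ifP => // _; rewrite mule_ge0.
rewrite /cost -esumZ0//; apply: le_esum => Q _.
have [r rr ->] := cP Q.
apply: (@le_trans _ _ (r%:E * \esum_(S in A `&` [set S | sub S Q]) (rho S.1)%:E)).
  rewrite -esumZ0// [leRHS]esum_mkcondr; apply: le_esum => S _.
  case: ifPn => [|_]; last by case: ifP => // _; rewrite mule_ge0.
  by rewrite inE /= => SQ; rewrite mem_set// muleC.
apply: (@le_trans _ _ (r%:E * (L * rho Q.1)%:E)).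
  by apply: lee_wpmul2l; [rewrite lee_fin|exact: pA].
by rewrite -!EFinM lee_fin; lra.
Qed.

End packing.

(** * Hölder's inequality in exponential form, geometric sums *)

Section hoelder.
Variables (R : realType) (n : nat) (b : R).
Local Notation V := 'rV[R]_n.
Local Notation dint := (dint b).
Local Open Scope ereal_scope.

Definition exf (u : V -> R) (x : V) : \bar R := (expR (u x))%:E.

Lemma exf_ge0 u x : 0 <= exf u x.
Proof. by rewrite lee_fin expR_ge0. Qed.

Lemma exf_restr_ge0 u (E : set V) x : 0 <= (exf u \_ E) x.
Proof. by rewrite patchE; case: ifP => // _; exact: exf_ge0. Qed.

Lemma expR_interp (t u v : R) : (0 <= t <= 1)%R ->
  (expR (t * u + (1 - t) * v) <= expR u + expR v)%R.
Proof.
move=> /andP[t0 t1]; have [uv|vu] := leP u v.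
  by apply: (@le_trans _ _ (expR v)); rewrite ?lerDr ?expR_ge0// ler_expR; nra.
by apply: (@le_trans _ _ (expR u)); rewrite ?lerDl ?expR_ge0// ler_expR; nra.
Qed.

(** The scheme behind every use of Hölder's inequality: normalise both functions by bounds of their
    integrals, interpolate pointwise, integrate by subadditivity. The factor 2 counts the two
    normalised terms. *)
Lemma dint_interp (f g h : V -> \bar R) (N : set V) (p q r : R) :
  null b N -> (forall x, 0 <= f x) -> (forall x, 0 <= g x) -> (forall x, 0 <= h x) ->
  (forall x, ~ N x -> h x <= (expR r)%:E * ((expR (- p))%:E * f x + (expR (- q))%:E * g x)) ->
  dint f <= (expR p)%:E -> dint g <= (expR q)%:E -> dint h <= (2 * expR r)%:E.
Proof.
move=> N0 f0 g0 h0 hfg fp gq.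
have F0 x : 0 <= (expR (- p))%:E * f x by rewrite mule_ge0// lee_fin expR_ge0.
have G0 x : 0 <= (expR (- q))%:E * g x by rewrite mule_ge0// lee_fin expR_ge0.
apply: le_trans (dint_ae N0 h0 _ hfg) _.
  by move=> x; rewrite mule_ge0 ?adde_ge0// lee_fin expR_ge0.
rewrite dintZ ?expR_gt0// mulrC EFinM; apply: lee_wpmul2l; first by rewrite lee_fin expR_ge0.
apply: le_trans (dintD b F0 G0) _; rewrite !dintZ ?expR_gt0//.
rewrite -[leRHS](_ : 1 + 1 = _); last by rewrite -EFinD.
by apply: leeD; rewrite expRN muleC lee_pdivrMr ?expR_gt0// mul1e.
Qed.

Lemma dint_hoelder (u v : V -> R) (E : set V) (t p q : R) : (0 <= t <= 1)%R ->
  dint (exf u \_ E) <= (expR p)%:E -> dint (exf v \_ E) <= (expR q)%:E ->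
  dint (exf (fun x => t * u x + (1 - t) * v x)%R \_ E) <=
  (2 * expR (t * p + (1 - t) * q))%:E.
Proof.
move=> t01; apply: (@dint_interp _ _ _ set0); rewrite /null.
- by rewrite patch_set0 dint0.
- exact: exf_restr_ge0.
- exact: exf_restr_ge0.
- exact: exf_restr_ge0.
move=> x _; rewrite !patchE; case: ifP => _; last by rewrite !mule0 adde0 mule0.
rewrite /exf -!EFinM lee_fin -!expRD.
apply: (@le_trans _ _ (expR (t * p + (1 - t) * q) *
    expR (t * (- p + u x) + (1 - t) * (- q + v x))))%R.
  by rewrite -expRD ler_expR; lra.
by apply: ler_wpM2l; [exact: expR_ge0|exact: expR_interp].
Qed.

End hoelder.

Section geometric_sums.
Variable R : realType.
Local Open Scope ereal_scope.

Lemma sum_geometric_le (x : R) k : (0 <= x < 1)%R ->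
  (\sum_(0 <= i < k) x ^+ i <= (1 - x)^-1)%R.
Proof.
move=> /andP[x0 x1]; have y0 : (0 < 1 - x)%R by rewrite subr_gt0.
suff -> : (\sum_(0 <= i < k) x ^+ i = (1 - x ^+ k) / (1 - x))%R.
  by rewrite ler_piMl ?invr_ge0 ?(ltW y0)// gerBl exprn_ge0.
elim: k => [|k IH]; first by rewrite big_geq// expr0 subrr mul0r.
rewrite big_nat_recr//= IH; apply: (mulIf (lt0r_neq0 y0)).
by rewrite mulrDl !divfK ?gt_eqF// exprS; ring.
Qed.

Lemma esum_geometric (x : R) : (0 <= x < 1)%R ->
  \esum_(k in [set: nat]) (x ^+ k)%:E <= ((1 - x)^-1)%:E.
Proof.
move=> x01; have x0 : (0 <= x)%R by case/andP: x01.
rewrite -nneseries_esumT; last by move=> k; rewrite lee_fin exprn_ge0.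
apply: lime_le; first by apply: is_cvg_nneseries => k _ _; rewrite lee_fin exprn_ge0.
by apply: nearW => k; rewrite sumEFin lee_fin; exact: sum_geometric_le.
Qed.

Definition geoC (a : R) : R := (1 - expR (- a))^-1%R.

Lemma geoC_gt0 a : (0 < a)%R -> (0 < geoC a)%R.
Proof. by move=> a0; rewrite invr_gt0 subr_gt0 expR_lt1 oppr_lt0. Qed.

Lemma geometric_down (a A : R) : (0 < a)%R ->
  \esum_(j in [set j : int | (j%:~R <= A)%R]) (expR (a * j%:~R))%:E <=
  (geoC a * expR (a * A))%:E.
Proof.
move=> a0.
apply: (@le_trans _ _ (\esum_(j in (fun k : nat => Num.floor A - k%:Z)%R @` [set: nat])
  (expR (a * j%:~R))%:E)).
  apply: esum_sub => [j|j /= jA]; first by rewrite lee_fin expR_ge0.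
  have {}jA : (j <= Num.floor A)%R by rewrite floor_ge_int.
  by exists (absz (Num.floor A - j)) => //; lia.
rewrite esum_image; last by move=> i j _ _ h; have := h; lia.
apply: (@le_trans _ _ (\esum_(k in [set: nat])
   ((expR (a * A))%:E * (expR (- a) ^+ k)%:E))).
  apply: le_esum => k _; rewrite -EFinM lee_fin -expRM_natl -expRD ler_expR.
  by rewrite intrB; have := floor_le A; nra.
rewrite esumZ ?expR_gt0//.
rewrite (mulrC (geoC a)) EFinM; apply: lee_wpmul2l; first by rewrite lee_fin expR_ge0.
by apply: esum_geometric; rewrite expR_ge0 expR_lt1 oppr_lt0.
Qed.

Lemma geometric_up (a A : R) : (0 < a)%R ->
  \esum_(j in [set j : int | (A <= j%:~R)%R]) (expR (- (a * j%:~R)))%:E <=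
  (geoC a * expR (- (a * A)))%:E.
Proof.
move=> a0; have := geometric_down (- A)%R a0; rewrite mulrN; apply: le_trans.
rewrite (@reindex_esum R _ _ [set j : int | (j%:~R <= - A)%R] _ (fun j => - j)%R).
  by apply: le_esum => j _; rewrite intrN mulrN opprK.
split=> [j /=|i j _ _|j /= Aj].
- by rewrite intrN lerNr.
- exact: oppr_inj.
- by exists (- j)%R; rewrite ?opprK//= intrN lerN2.
Qed.

(** Estimates of logarithms say nothing directly if [X] is 0; here this case is reached by letting
    [x] tend to minus infinity. *)
Lemma le_of_exp (X A : \bar R) (C : R) : 0 <= X -> (0 < C)%R ->
  (forall x : R, X <= (expR x)%:E -> A <= (C * expR x)%:E) -> A <= C%:E * X.
Proof.
move=> X0 C0 H.
have [->|Xy] := eqVneq X +oo; first by rewrite gt0_muley ?lte_fin ?leey.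
have [r r0 Xr] := ereal_ltyP X0 (etrans (ltey _) Xy); rewrite Xr in H *.
have [rz|rz] := eqVneq r 0%R; last first.
  have rp : (0 < r)%R by rewrite lt_def rz.
  by have := H (ln r); rewrite lnK// -EFinM; apply.
rewrite rz mule0; apply/lee_addgt0Pr => e e0; rewrite add0e.
have := H (ln (e / C)); rewrite lnK ?posrE ?divr_gt0//.
rewrite mulrCA divff ?gt_eqF// mulr1; apply.
by rewrite rz lee_fin divr_ge0// ltW.
Qed.

End geometric_sums.

Section family.
Variables (R : realType) (n : nat) (b : R).
Local Notation V := 'rV[R]_n.
Local Notation cubeT := (cubeT n).
Local Notation rho := (rho b).
Local Notation dint := (dint b).
Local Open Scope ereal_scope.

Lemma cov_le_esum (c : cubeT -> \bar R) (x : V) : (forall P, 0 <= c P) ->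
  cov c x <= \esum_(P in [set: cubeT]) (c P * (cst 1 \_ (cube P)) x).
Proof.
move=> c0; have F0 (P : cubeT) : 0 <= c P * (cst 1 \_ (cube P)) x.
  by rewrite mule_ge0// patchE; case: ifP.
apply: (@le_trans _ _ (\esum_(P in (fun k => (k, dy k x) : cubeT) @` [set: int])
    (c P * (cst 1 \_ (cube P)) x))); last by apply: esum_sub.
rewrite esum_image; last by move=> i j _ _ [].
by apply: le_esum => k _; rewrite patchE mem_set// mule1.
Qed.

(** A cover of [f] reduces the claim to indicators of single cubes, where it is the hypothesis. *)
Lemma dint_family (I : countType) (A : I -> set V) (K : R) (f : V -> \bar R) :
  (0 < K)%R ->
  (forall P : cubeT, \esum_(i in [set: I]) dint (cst 1 \_ (cube P `&` A i)) <= (K * rho P.1)%:E) ->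
  \esum_(i in [set: I]) dint (f \_ (A i)) <= K%:E * dint f.
Proof.
move=> K0 HA.
rewrite -[dint f]/(ereal_inf _) -ereal_inf_pZl//.
apply: le_ereal_inf_tmp => _ [_ [c [c0 fc] <-] <-].
have [cfin|] := ltP (cost b c) +oo; last first.
  by rewrite leye_eq => /eqP ->; rewrite gt0_muley ?leey// lte_fin.
have rc0 (P : cubeT) : 0 <= (rho P.1)%:E * c P by rewrite mule_ge0// lee_fin ltW// rho_gt0.
have cP (P : cubeT) : exists2 r : R, (0 <= r)%R & c P = r%:E.
  apply: ereal_ltyP => //.
  have := esum_le_term (A := setT) (i := P) rc0 Logic.I => /le_lt_trans /(_ cfin).
  have [->|cy] := eqVneq (c P) +oo; last by move=> _; rewrite ltey.
  by rewrite gt0_muley// lte_fin rho_gt0.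
have F0 i (P : cubeT) x : 0 <= c P * (cst 1 \_ (cube P `&` A i)) x.
  by rewrite mule_ge0// patchE; case: ifP.
have D0 i (P : cubeT) : 0 <= c P * dint (cst 1 \_ (cube P `&` A i)).
  by rewrite mule_ge0// dint_ge0.
apply: (@le_trans _ _ (\esum_(i in [set: I]) \esum_(P in [set: cubeT])
    (c P * dint (cst 1 \_ (cube P `&` A i))))).
  apply: le_esum => i _.
  apply: (@le_trans _ _ (dint (fun x => \esum_(P in [set: cubeT])
      (c P * (cst 1 \_ (cube P `&` A i)) x)))).
    apply: dint_le => x; rewrite patchE; case: ifPn => [|_]; last exact: esum_ge0.
    rewrite inE => Ax; apply: le_trans (fc x) _; apply: le_trans (cov_le_esum x c0) _.
    apply: le_esum => P _; rewrite !patchE; case: ifPn => [|_].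
      by rewrite inE => Px; rewrite mem_set.
    by rewrite mule0 mule_ge0//; case: ifP.
  apply: le_trans (dint_esum b (F0 i)) _; apply: le_esum => P _.
  have [r r0 ->] := cP P; have [->|rz] := eqVneq r 0%R.
    by rewrite mul0e (_ : (fun x => _) = fun=> 0) ?dint0//; apply/funext => x; rewrite mul0e.
  by rewrite dintZ// lt_def rz.
rewrite esum_exchange// /cost -esumZ//; apply: le_esum => P _.
have [r r0 ->] := cP P.
rewrite esumZ0//; last by move=> i; exact: dint_ge0.
apply: (@le_trans _ _ (r%:E * (K * rho P.1)%:E)).
  by apply: lee_wpmul2l => //; rewrite lee_fin.
by rewrite -!EFinM lee_fin; lra.
Qed.

End family.

(** * Muckenhoupt weights *)

Section weights.
Variables (R : realType) (n : nat) (b c0 : R).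
Local Notation V := 'rV[R]_n.
Local Notation cubeT := (cubeT n).
Local Notation rho := (rho b).
Local Notation dint := (dint b).
Local Open Scope ereal_scope.

Definition lrho (k : int) : R := (k%:~R * (b * ln 2))%R.

Lemma rhoE k : rho k = expR (lrho k). Proof. by []. Qed.

(* A weight of class [A_p], with [t = 1 / p], is written
   [w = exp ((1 - t) s)], so that its dual weight is [exp (- t s)]; the class is
   then invariant under [(t, s) -> (1 - t, - s)].  In [aw], [p] and [q] are
   logarithms of bounds of the two integrals over the cube enlarged by [d]
   layers of neighbours. *)
Definition wt (t : R) (s : V -> R) (x : V) : R := ((1 - t) * s x)%R.
Definition dl (t : R) (s : V -> R) (x : V) : R := (- t * s x)%R.

Definition aw (d : int) (t : R) (s : V -> R) : Prop := exists kap : R, forall P : cubeT,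
  exists p q : R, [/\ dint (exf (wt t s) \_ (ncube d P)) <= (expR p)%:E,
    dint (exf (dl t s) \_ (ncube d P)) <= (expR q)%:E &
    (t * p + (1 - t) * q <= kap + lrho P.1)%R].

Lemma wt_sym t s : wt (1 - t) (fun x => - s x)%R = dl t s.
Proof. by apply/funext => x; rewrite /wt /dl; ring. Qed.

Lemma dl_sym t s : dl (1 - t) (fun x => - s x)%R = wt t s.
Proof. by apply/funext => x; rewrite /wt /dl; ring. Qed.

Lemma aw_sym d t s : aw d t s -> aw d (1 - t) (fun x => - s x)%R.
Proof.
move=> [kap H]; exists kap => P; have [p [q [hp hq pq]]] := H P.
by exists q, p; rewrite wt_sym dl_sym; split => //; lra.
Qed.

Lemma dint_restr_le (f : V -> \bar R) (E F : set V) : (forall x, 0 <= f x) ->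
  E `<=` F -> dint (f \_ E) <= dint (f \_ F).
Proof.
move=> f0 EF; apply: dint_le => x; rewrite !patchE.
case: ifPn => [|_]; last by case: ifP.
by rewrite inE => /EF xF; rewrite mem_set.
Qed.

Lemma dint1_expR (E : set V) (u : V -> R) (p : R) :
  dint (exf u \_ E) <= (expR p)%:E -> forall r : R, (forall x, E x -> r <= u x)%R ->
  dint (cst 1 \_ E) <= (expR (p - r))%:E.
Proof.
move=> up r ru; rewrite expRD [in leRHS]mulrC EFinM.
apply: (@le_trans _ _ ((expR (- r))%:E * dint (exf u \_ E))); last first.
  by apply: lee_wpmul2l => //; rewrite lee_fin expR_ge0.
rewrite -dintZ ?expR_gt0//; apply: dint_le => x; rewrite !patchE.
case: ifPn => [|_]; last by rewrite mule0.
rewrite inE => /ru h; rewrite /exf -EFinM lee_fin -expRD -expR0 ler_expR; lra.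
Qed.

Section fixed_weight.
Variables (t : R) (s : V -> R).
Hypotheses (t0 : (0 < t)%R) (t1 : (t < 1)%R) (sA : aw 2 t s).
Hypotheses (b0 : (0 < b)%R) (c00 : (0 < c0)%R).
Hypothesis (low : forall P : cubeT, (c0 * rho P.1)%:E <= dint (cst 1 \_ (cube P))).

Let w := exf (wt t s).

Let w0 x : 0 <= w x. Proof. exact: exf_ge0. Qed.

Lemma aw_fin P : dint (w \_ (ncube 2 P)) < +oo.
Proof. by have [kap /(_ P) [p [q [wp _ _]]]] := sA; exact: le_lt_trans wp (ltry _). Qed.

(** The A-infinity property. With the dual weight [v] one has [1 = w^t v^(1-t)], so Hölder's
    inequality on [E] bounds [rho Q.1] by a multiple of [w(E)^t v(Q)^(1-t)], and the [A_p] condition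
    bounds [w(Q)^t v(Q)^(1-t)] by a multiple of [rho Q.1]. *)
Lemma aw_ainfty (e : R) : (0 < e)%R -> exists2 C : R, (0 < C)%R &
  forall (Q : cubeT) (E : set V), E `<=` ncube 2 Q ->
  (e * rho Q.1)%:E <= dint (cst 1 \_ E) ->
  dint (w \_ (ncube 2 Q)) <= C%:E * dint (w \_ E).
Proof.
move=> e0; have [kap H] := sA.
exists (expR ((kap + ln 2 - ln e) / t)); rewrite ?expR_gt0// => Q E EQ Elow.
apply: le_of_exp; rewrite ?dint_ge0 ?expR_gt0// => x wx.
have [p [q [wp sq pq]]] := H Q.
apply: le_trans wp _; rewrite lee_fin -expRD ler_expR.
have sE : dint (exf (dl t s) \_ E) <= (expR q)%:E.
  by apply: le_trans sq; apply: dint_restr_le => // y; exact: exf_ge0.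
have t01 : (0 <= t <= 1)%R by rewrite !ltW.
have := dint_hoelder t01 wx sE.
rewrite (_ : exf _ = cst 1); last first.
  apply/funext => y; rewrite /exf /wt /dl (_ : _ + _ = 0)%R ?expR0//; ring.
move=> /(le_trans Elow); rewrite lee_fin rhoE -(lnK (x := e)) ?posrE// -expRD.
rewrite -(lnK (x := 2%R)) ?posrE// -expRD ler_expR !expRK => h.
rewrite -(ler_pM2l t0) mulrDr mulrCA divff ?gt_eqF// mulr1.
by lra.
Qed.

Lemma aw_pos P : exists2 r : R, (0 < r)%R & dint (w \_ (cube P)) = r%:E.
Proof.
have sub2 : (cube P : set V) `<=` ncube 2 P by exact: cube_sub_ncube.
have fin : dint (w \_ (cube P)) < +oo.
  exact: le_lt_trans (dint_restr_le w0 sub2) (aw_fin P).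
have [r r0 rE] := ereal_ltyP (dint_ge0 b _) fin.
exists r => //; rewrite lt_def r0 andbT; apply/eqP => rz.
rewrite rz in rE.
have /dint0P : dint (w \_ (cube P)) = 0 by exact: rE.
have W0 x : 0 <= (w \_ (cube P)) x by exact: exf_restr_ge0.
move=> /(_ W0) N0.
have : dint (cst 1 \_ (cube P)) = 0.
  apply: null_sub N0 => x Px /=; rewrite patchE mem_set//.
  by rewrite /w /exf eqe gt_eqF// expR_gt0.
move=> h; have := low P; rewrite h lee_fin leNgt mulr_gt0//; exact: rho_gt0.
Qed.

(** On a slice the weight and its dual are constant up to a fixed factor. *)
Definition slice (i : int) : set V := [set x | Num.floor (s x) = i].

Lemma sliceP i x : slice i x -> (i%:~R <= s x /\ s x <= i%:~R + 1)%R.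
Proof.
by move=> <-; have /andP[h1 /ltW h2] := floor_itv (s x); rewrite intrD in h2; split.
Qed.

(** Chebyshev's inequality for [w] decays geometrically in [i] upwards, the one for the dual weight
    downwards. At the threshold [z], determined by the size of [w] on the cube, both are comparable
    to [rho P.1] because of the [A_p] condition. *)
Lemma aw_slice_cube : exists2 K : R, (0 < K)%R & forall P : cubeT,
  \esum_(i in [set: int]) dint (cst 1 \_ (cube P `&` slice i)) <= (K * rho P.1)%:E.
Proof.
have [kap H] := sA.
have T0 : (0 < 1 - t)%R by rewrite subr_gt0.
pose C1 := (geoC (1 - t))%R; pose C2 := (expR (t + kap / (1 - t)) * geoC t)%R.
exists (C1 + C2)%R.
  by rewrite addr_gt0// ?geoC_gt0// mulr_gt0 ?expR_gt0 ?geoC_gt0.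
move=> P; have [p [q [wp sq pq]]] := H P.
have sub2 i : cube P `&` slice i `<=` ncube 2 P.
  by move=> x [Px _]; apply: cube_sub_ncube Px.
pose z := ((p - lrho P.1) / (1 - t))%R.
have zE : ((1 - t) * z = p - lrho P.1)%R by rewrite /z mulrC divfK// gt_eqF.
have kE : ((1 - t) * (kap / (1 - t)) = kap)%R by rewrite mulrC divfK// gt_eqF.
have qle : (q <= kap / (1 - t) + lrho P.1 - t * z)%R.
  rewrite -(ler_pM2l T0).
  have -> : ((1 - t) * (kap / (1 - t) + lrho P.1 - t * z) =
      kap + (1 - t) * lrho P.1 - t * (p - lrho P.1))%R by rewrite -zE -{2}kE; ring.
  by lra.
have e1 (i : int) : dint (cst 1 \_ (cube P `&` slice i)) <=
    (rho P.1)%:E * (expR ((1 - t) * z) * expR (- ((1 - t) * i%:~R)))%:E.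
  have wi := le_trans (dint_restr_le w0 (sub2 i)) wp.
  apply: le_trans (dint1_expR wi (r := (1 - t) * i%:~R)%R _) _.
    by move=> x [_ /sliceP [h _]]; rewrite /wt ler_pM2l.
  by rewrite -EFinM lee_fin rhoE -!expRD ler_expR; lra.
have e2 (i : int) : dint (cst 1 \_ (cube P `&` slice i)) <=
    (rho P.1)%:E * (expR (t + kap / (1 - t) - t * z) * expR (t * i%:~R))%:E.
  have s0 x : 0 <= exf (dl t s) x by exact: exf_ge0.
  have si := le_trans (dint_restr_le s0 (sub2 i)) sq.
  apply: le_trans (dint1_expR si (r := - t * (i%:~R + 1))%R _) _.
    by move=> x [_ /sliceP [_ h]]; rewrite /dl !mulNr lerN2 ler_pM2l.
  by rewrite -EFinM lee_fin rhoE -!expRD ler_expR; lra.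
have r0 : (0 <= rho P.1)%R by rewrite ltW// rho_gt0.
have g0 (f : int -> R) (i : int) : 0 <= (expR (f i))%:E by rewrite lee_fin expR_ge0.
rewrite (esumID [set i : int | (z <= i%:~R)%R]); last by move=> i _; exact: dint_ge0.
rewrite !setTI mulrC mulrDr EFinD; apply: leeD.
  apply: (@le_trans _ _ (\esum_(i in [set i : int | (z <= i%:~R)%R])
      ((rho P.1 * expR ((1 - t) * z))%:E * (expR (- ((1 - t) * i%:~R)))%:E))).
    by apply: le_esum => i _; apply: le_trans (e1 i) _; rewrite -!EFinM mulrA.
  rewrite [leLHS]esumZ; [|by move=> i; rewrite lee_fin expR_ge0|by apply: mulr_gt0; [exact: rho_gt0|exact: expR_gt0]].
  apply: (@le_trans _ _ ((rho P.1 * expR ((1 - t) * z))%:E *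
      (C1 * expR (- ((1 - t) * z)))%:E)).
    apply: lee_wpmul2l; first by rewrite lee_fin mulr_ge0 ?expR_ge0.
    exact: geometric_up.
  rewrite -EFinM lee_fin expRN -!mulrA ler_wpM2l//.
  by rewrite mulrCA divff ?mulr1// gt_eqF ?expR_gt0.
apply: (@le_trans _ _ (\esum_(i in [set i : int | (i%:~R <= z)%R])
    ((rho P.1 * expR (t + kap / (1 - t) - t * z))%:E * (expR (t * i%:~R))%:E))).
  apply: le_trans (esum_sub _ (B := [set i : int | (i%:~R <= z)%R]) _) _.
  - by move=> i; exact: dint_ge0.
  - by move=> i /= /negP; rewrite -ltNge => /ltW.
  by apply: le_esum => i _; apply: le_trans (e2 i) _; rewrite -!EFinM mulrA.
rewrite [leLHS]esumZ; [|by move=> i; rewrite lee_fin expR_ge0|by apply: mulr_gt0; [exact: rho_gt0|exact: expR_gt0]].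
apply: (@le_trans _ _ ((rho P.1 * expR (t + kap / (1 - t) - t * z))%:E *
    (geoC t * expR (t * z))%:E)).
  apply: lee_wpmul2l; first by rewrite lee_fin mulr_ge0 ?expR_ge0.
  exact: geometric_down.
rewrite -EFinM lee_fin /C2 expRD expRN -!mulrA ler_wpM2l// ler_wpM2l ?expR_ge0//.
by rewrite mulrCA -[X in (_ <= X)%R]mulr1 mulVf ?mulr1// gt_eqF ?expR_gt0.
Qed.

Lemma aw_slice : exists2 K : R, (0 < K)%R & forall f : V -> \bar R,
  \esum_(i in [set: int]) dint (f \_ (slice i)) <= K%:E * dint f.
Proof.
have [K K0 HK] := aw_slice_cube; exists K => // f; exact: dint_family HK.
Qed.

End fixed_weight.

End weights.

(** * Growth of a weight along the ancestors of a cube *)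

Section siblings.
Variables (R : realType) (n : nat).
Local Notation V := 'rV[R]_n.
Local Notation cubeT := (cubeT n).
Local Notation sub := (subcube R).
Variable i0 : 'I_n.

Lemma dy_step (k : int) (x : V) i :
  dy (k + 1) x ord0 i * 2 <= dy k x ord0 i < dy (k + 1) x ord0 i * 2 + 2.
Proof.
rewrite !dyE.
have E : absz (k + 1 - k)%R = 1%N by rewrite addrAC subrr add0r.
have kk : k <= k + 1 by rewrite lerDl.
have := floor_scale (x ord0 i) (Num.floor (x ord0 i / 2 ^ (k + 1))) kk.
have := floor_scale (x ord0 i) (Num.floor (x ord0 i / 2 ^ (k + 1)) + 1) kk.
rewrite E expr1; move: (Num.floor _) (Num.floor _) => u v; lia.
Qed.

(** In direction [i0] the two children of index [u] have indices [2 u] and [2 u + 1], and [v]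
    becomes [4 u + 1 - v] when they are exchanged. *)
Definition sib (x : V) (k : int) : cubeT := (k, \row_i
  if i == i0 then 4 * dy (k + 1) x ord0 i + 1 - dy k x ord0 i else dy k x ord0 i).

Lemma sib_parent (x : V) k : sub (sib x k) (k + 1, dy (k + 1) x).
Proof.
split; first by rewrite /= lerDl.
apply/rowP => i /=; have := cube_corner R (sib x k); rewrite /cube/= => /rowP/(_ i).
have := dy_step k (corner R (sib x k)) i; have := dy_step k x i.
rewrite [X in _ = X -> _]mxE; case: ifP => _;
move: (dy _ _ _ _) (dy _ _ _ _) (dy _ _ _ _) (dy _ _ _ _) => u v u' v'; lia.
Qed.

Lemma sib_neq (x : V) k : ~ cube (sib x k) x.
Proof.
rewrite /cube /= => /rowP/(_ i0); rewrite [RHS]mxE eqxx.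
by have := dy_step k x i0; move: (dy _ _ _ _) (dy _ _ _ _) => u v; lia.
Qed.

(** The finer sibling lies in the ancestor of [x] of scale [j + 1], hence in that of scale [k],
    which the coarser sibling avoids. *)
Lemma sib_disjoint (x y : V) (j k : int) : j < k -> cube (sib x j) y -> cube (sib x k) y -> False.
Proof.
move=> jk yj yk.
have := subcube_sub (sib_parent x j) yj; rewrite /cube /= => yx.
apply: (@sib_neq x k); move: yk; rewrite /cube /= => <-.
by apply: dy_up (esym yx); rewrite lezD1.
Qed.

End siblings.

Section growth.
Variables (R : realType) (n : nat) (b c0 : R).
Local Notation V := 'rV[R]_n.
Local Notation cubeT := (cubeT n).
Local Notation rho := (rho b).
Local Notation dint := (dint b).
Local Notation sub := (subcube R).
Local Open Scope ereal_scope.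
Variables (t : R) (s : V -> R).
Hypotheses (t0 : (0 < t)%R) (t1 : (t < 1)%R) (sA : aw b 2 t s).
Hypotheses (b0 : (0 < b)%R) (c00 : (0 < c0)%R) (n0 : (0 < n)%N).
Hypothesis (low : forall P : cubeT, (c0 * rho P.1)%:E <= dint (cst 1 \_ (cube P))).

Let w := exf (wt t s).
Let w0 x : 0 <= w x. Proof. exact: exf_ge0. Qed.

(** The siblings of the cubes containing [x] are disjoint and packed, and by the A-infinity property
    each carries at least a fixed fraction of the weight of the cube of scale 0. By [packing], the
    ancestor of scale [m] has weight at least a multiple of [m]. *)
Lemma aw_growth (x : V) (B : R) : exists K : int, forall P : cubeT,
  cube P x -> dint (w \_ (cube P)) <= B%:E -> (P.1 <= K)%R.
Proof.
pose i0 : 'I_n := Ordinal n0.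
pose L : R := (b * ln 2)%R.
have L0 : (0 < L)%R by rewrite mulr_gt0// ln_gt0// ltr1n.
have rhoL k : rho k = expR (L * k%:~R) by rewrite rhoE /lrho mulrC.
have e0 : (0 < c0 * expR (- L))%R by rewrite mulr_gt0// expR_gt0.
have [C C0 HC] := aw_ainfty t0 t1 sA e0.
pose Q (k : int) : cubeT := (k, dy k x).
have Qx k : cube (Q k) x by [].
have QS j k : (j <= k)%R -> cube (Q j) `<=` (cube (Q k) : set V).
  by move=> jk; apply: subcube_sub; apply/(subcubeP _ (Qx j)).
have [d d0 dE] := aw_pos sA c00 low (Q 0%R).
have sibw (k : nat) : d%:E <= C%:E * dint (w \_ (cube (sib i0 x k%:Z))).
  have sibQ : cube (sib i0 x k%:Z) `<=` (cube (Q (k%:Z + 1)%R) : set V).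
    by apply: subcube_sub; exact: sib_parent.
  apply: le_trans (HC (Q (k%:Z + 1)%R) _ _ _).
  - rewrite -dE; apply: dint_restr_le => // y Qy; apply: cube_sub_ncube => //.
    by apply: QS Qy.
  - by move=> y /sibQ; exact: cube_sub_ncube.
  - apply: le_trans (low _); rewrite lee_fin !rhoL /= -mulrA -expRD.
    by rewrite ler_wpM2l ?(ltW c00)// ler_expR intrD; lra.
have pk (K : nat) : packed b ((fun k : nat => sib i0 x k%:Z) @` `I_K) (geoC L).
  move=> P; rewrite rhoL.
  apply: le_trans (geometric_down _ L0).
  rewrite (eq_esum (b := fun j => (rho j)%:E)); last by move=> j _; rewrite rhoL.
  rewrite -(@esum_image R _ _ _ (fun j => sib i0 x j) (fun S => (rho S.1)%:E)); last by move=> i j _ _ [].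
  apply: esum_sub => [S|_ [[k kK <-] [/= kP _]]]; first by rewrite lee_fin ltW// rho_gt0.
  by exists k%:Z => //=; rewrite ler_int.
have dj (K : nat) : disjoint_cubes R ((fun k : nat => sib i0 x k%:Z) @` `I_K).
  move=> _ _ y [j _ <-] [k _ <-] yj yk.
  have [jk|kj|[->]//] := ltgtP (j%:Z) (k%:Z).
    by case: (sib_disjoint jk yj yk).
  by case: (sib_disjoint kj yk yj).
have G0 : (0 < geoC L)%R by exact: geoC_gt0.
have main (m : nat) : (m%:R * d)%:E <= (C * (1 + geoC L))%:E * dint (w \_ (cube (Q m%:Z))).
  have := @packing _ _ _ _ (geoC L) (w \_ (cube (Q m%:Z))) (ltW G0) (dj m) (pk m).
  rewrite esum_image; last first.
    by move=> i j _ _ /(congr1 fst) /= [].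
  move=> H; rewrite (EFinM C) -muleA.
  have C00 : 0 <= C%:E by rewrite lee_fin ltW.
  apply: le_trans (lee_wpmul2l C00 H).
  rewrite -esumZ//; last by move=> k; exact: dint_ge0.
  apply: (@le_trans _ _ (\esum_(k in `I_m) d%:E)).
    rewrite esum_fset; [|exact: finite_II|by move=> i _; rewrite lee_fin ltW].
    by rewrite -fsbig_ord sumEFin sumr_const card_ord mulr_natl.
  apply: le_esum => k kK; apply: le_trans (sibw k) _; apply: lee_wpmul2l => //.
  apply: dint_le => y; rewrite !patchE; case: ifPn => // kS; rewrite mem_set//.
  have : cube (Q (k%:Z + 1)%R) y.
    by apply: subcube_sub (sib_parent i0 x k%:Z) _ _; exact: set_mem.
  by apply: QS; rewrite lezD1 ltz_nat.
exists (Num.truncn (C * (1 + geoC L) * B / d)).+1%:Z => P Px PB.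
rewrite leNgt; apply/negP => KP.
set K := (Num.truncn _).+1 in KP *.
have PQ : P = Q P.1 by rewrite /Q Px -surjective_pairing.
have : (K%:R * d)%:E <= (C * (1 + geoC L))%:E * B%:E.
  apply: le_trans (main K) _; apply: lee_wpmul2l.
    by rewrite lee_fin mulr_ge0// ltW// ltr_wpDl.
  apply: le_trans PB; apply: dint_restr_le => //.
  by rewrite PQ; apply: QS; exact: ltW.
rewrite -EFinM lee_fin -ler_pdivlMr// leNgt.
by rewrite truncnS_gt.
Qed.

(* The weights of the ancestors of a cube tend to infinity. *)
Lemma maximal_cube (Pr : cubeT -> Prop) (B : R) :
  (forall P, Pr P -> dint (w \_ (cube P)) <= B%:E) ->
  forall P, Pr P -> exists Q, [/\ sub P Q, Pr Q &
    forall S, sub Q S -> Pr S -> S = Q].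
Proof.
move=> PrB P PrP; have Px := cube_corner R P.
have [K HK] := aw_growth (corner R P) B.
have {}HK Q : sub P Q -> Pr Q -> (Q.1 <= K)%R.
  by move=> /(subcube_sub)/(_ _ Px) QP /PrB; exact: HK.
suff H (m : nat) : forall P', sub P P' -> Pr P' -> (K - P'.1 <= m%:Z)%R ->
    exists Q, [/\ sub P' Q, Pr Q & forall S, sub Q S -> Pr S -> S = Q].
  apply: (H (absz (K - P.1)%R) P (subcube_refl R P) PrP).
  by have := HK P (subcube_refl R P) PrP; lia.
elim: m => [|m IH] P' PP' PrP' Km.
  exists P'; split => //; first exact: subcube_refl.
  move=> S PS PrS; apply/esym; apply: (subcube_anti PS).
  by have := HK S (subcube_trans PP' PS) PrS; lia.
have [[S [PS PrS SP]]|H] := pselect (exists S, [/\ sub P' S, Pr S & S <> P']).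
  have [Q [SQ PrQ Qm]] : exists Q, [/\ sub S Q, Pr Q & forall T, sub Q T -> Pr T -> T = Q].
    apply: IH => //; first exact: subcube_trans PS.
    have : (P'.1 < S.1)%R.
      rewrite ltNge; apply/negP => SP1; apply: SP; apply/esym.
      exact: (subcube_anti PS).
    lia.
  by exists Q; split => //; exact: subcube_trans SQ.
exists P'; split => //; first exact: subcube_refl.
move=> S PS PrS; apply: contrapT => SP; apply: H; by exists S.
Qed.

End growth.

(** * Maximal inequalities *)

Section weak_type.
Variables (R : realType) (n : nat) (b c0 : R).
Local Notation V := 'rV[R]_n.
Local Notation cubeT := (cubeT n).
Local Notation rho := (rho b).
Local Notation dint := (dint b).
Local Notation sub := (subcube R).
Local Open Scope ereal_scope.

Lemma dint_bigcup (I : countType) (A : set I) (E : I -> set V) (f : V -> \bar R) :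
  (forall x, 0 <= f x) ->
  dint (f \_ (\bigcup_(i in A) E i)) <= \esum_(i in A) dint (f \_ (E i)).
Proof.
move=> f0.
pose g i : V -> \bar R := if i \in A then f \_ (E i) else fun=> 0.
have g0 i x : 0 <= g i x by rewrite /g; case: ifP => // _; rewrite patchE; case: ifP.
apply: (@le_trans _ _ (dint (fun x => \esum_(i in [set: I]) g i x))).
  apply: dint_le => x; rewrite patchE; case: ifPn => [|_]; last exact: esum_ge0.
  rewrite inE => -[i Ai Ex].
  apply: le_trans (@esum_le_term _ _ setT (g^~ x) i _ _) => //.
  by rewrite /g mem_set// patchE mem_set.
apply: le_trans (dint_esum b g0) _; rewrite [leRHS]esum_mkcond.
by apply: le_esum => i _; rewrite /g; case: ifP => // _; rewrite dint0.
Qed.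

Lemma esum_antichain (M A : set cubeT) (a : cubeT -> \bar R) : (forall S, 0 <= a S) ->
  (forall S Q Q', M Q -> M Q' -> sub S Q -> sub S Q' -> Q = Q') ->
  \esum_(Q in M) \esum_(S in A `&` [set S | sub S Q]) a S <= \esum_(S in A) a S.
Proof.
move=> a0 MM.
under eq_esum => Q _ do rewrite esum_mkcondr.
rewrite esum_exchange; last by move=> Q S; case: ifP.
apply: le_esum => S _.
have [[Q [MQ SQ]]|nQ] := pselect (exists Q, M Q /\ sub S Q); last first.
  rewrite esum1// => Q MQ; case: ifPn => //; rewrite inE /= => SQ.
  by exfalso; apply: nQ; exists Q.
rewrite (esumID [set Q]); last by move=> T _; case: ifP.
rewrite [X in _ + X]esum1 ?adde0; last first.
  move=> T [MT /= TQ]; case: ifPn => //; rewrite inE /= => ST.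
  by exfalso; apply: TQ; exact: MM ST SQ.
have -> : M `&` [set Q] = [set Q] by apply/seteqP; split=> [T []//|T ->].
by rewrite esum_set1; case: ifP.
Qed.

(** Zorn's lemma applies because packing is tested on finite subfamilies, and a finite subfamily of
    the union of a chain lies in one member of the chain. *)
Lemma packed_maximal (M : set cubeT) : exists A : set cubeT,
  [/\ A `<=` M, packed b A 2 & forall B, A `<` B -> B `<=` M -> ~ packed b B 2].
Proof.
have [|A [[AM Ap] Amax]] := @Zorn_bigcup cubeT
    [set A : set cubeT | A `<=` M /\ packed b A 2]; last first.
  by exists A; split => // B AB BM Bp; exact: (Amax B).
move=> F FP Ftot; split.
  by move=> P [X FX XP]; have [XM _] := FP _ FX; exact: XM.
move=> P; apply: ge_ereal_sup => _ [X [finX XF] <-].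
have [->|/set0P [S0 XS0]] := eqVneq X set0.
  by rewrite fsbig_set0 lee_fin mulr_ge0// ltW// rho_gt0.
have [Y FY XY] : exists2 Y, F Y & X `<=` Y.
  have {S0 XS0} : exists Y, F Y by have [[Y FY _] _] := XF _ XS0; exists Y.
  move=> [Y0 FY0]; move: finX XF => /finite_seqP [l ->].
  elim: l => [|S l IH] lF; first by exists Y0 => // S.
  have [Y FY lY] := IH (fun T Tl => lF T (mem_behead (s := S :: l) Tl)).
  have [[Z FZ ZS] _] := lF S (mem_head _ _).
  have [YZ|ZY] := Ftot _ _ FY FZ.
    exists Z => // T; rewrite /= inE => /orP[/eqP ->//|/lY/YZ//].
  by exists Y => // T; rewrite /= inE => /orP[/eqP ->|/lY//]; exact: ZY.
have [_ /(_ P)] := FP _ FY; apply: le_trans; apply: ereal_sup_ubound.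
exists X => //; split => // S XS; split; first exact: XY.
by have [] := XF _ XS.
Qed.

Variables (t : R) (s : V -> R).
Hypotheses (t0 : (0 < t)%R) (t1 : (t < 1)%R) (sA : aw b 2 t s).
Hypotheses (b0 : (0 < b)%R) (c00 : (0 < c0)%R) (n0 : (0 < n)%N).
Hypothesis (low : forall P : cubeT, (c0 * rho P.1)%:E <= dint (cst 1 \_ (cube P))).

Let w := exf (wt t s).
Let w0 x : 0 <= w x. Proof. exact: exf_ge0. Qed.

(** From the maximal cubes [M] with a large average a maximal packed family [A] is kept. Every cube
    of [M] lies in a cube [Q] saturated by members of [A]; the A-infinity property bounds the weight
    of [ncube 2 Q] by that of these members, and their integrals of [f] sum up by [packing]. *)
Lemma weak_type : exists2 C : R, (0 < C)%R & forall (f : V -> \bar R) (la : R),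
  (forall x, 0 <= f x) -> (0 < la)%R ->
  la%:E * dint (w \_ [set x | exists2 P, ncube 2 P x &
    la%:E * dint (w \_ (cube P)) < dint (f \_ (cube P))]) <= C%:E * dint f.
Proof.
have e0 : (0 < c0 / 3)%R by rewrite divr_gt0.
have [C C0 HC] := aw_ainfty t0 t1 sA e0.
exists (C * 3)%R; first by rewrite mulr_gt0.
move=> f la f0 la0.
have C3 : (0 < C * 3)%R by rewrite mulr_gt0.
have [ffin|] := ltP (dint f) +oo; last first.
  by rewrite leye_eq => /eqP ->; rewrite gt0_muley ?leey// lte_fin.
have [F F0 FE] := ereal_ltyP (dint_ge0 b f) ffin.
have la0' : 0 <= la%:E by rewrite lee_fin ltW.
pose Pr (P : cubeT) := la%:E * dint (w \_ (cube P)) < dint (f \_ (cube P)).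
have fle (E : set V) : dint (f \_ E) <= dint f.
  by apply: dint_le => x; rewrite patchE; case: ifP.
have PrB P : Pr P -> dint (w \_ (cube P)) <= (F / la)%:E.
  move=> /ltW/le_trans /(_ (fle _)); rewrite FE muleC => h.
  by rewrite EFinM -lee_pdivlMr// in h *.
pose M := [set P | Pr P /\ forall S, sub P S -> Pr S -> S = P].
have Mmax := maximal_cube t0 t1 sA b0 c00 n0 low PrB.
have [A [AM Ap Amax]] := packed_maximal M.
have Adisj : disjoint_cubes R A.
  move=> S T x AS AT Sx Tx.
  have [PS mS] := AM _ AS; have [PT mT] := AM _ AT.
  by have [ST|TS] := cube_nested Sx Tx; [rewrite (mS T)|rewrite (mT S)].
have pack (g : V -> \bar R) : \esum_(S in A) dint (g \_ (cube S)) <= 3%:E * dint g.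
  have := @packing _ _ _ _ 2%R g _ Adisj Ap.
  by rewrite (_ : 1 + 2 = 3)%R; [apply|ring].
(* This explains the packing constant 2: a cube of [M] inside [Q] adds at most [rho Q.1], so it can
   break the packing in [Q] only if [A] already contributes [rho Q.1]. *)
pose sat (Q : cubeT) := (rho Q.1)%:E <= \esum_(S in A `&` [set S | sub S Q]) (rho S.1)%:E.
pose AQ (Q : cubeT) := A `&` [set S | sub S Q].
have r0 (P : cubeT) : 0 <= (rho P.1)%:E by rewrite lee_fin ltW// rho_gt0.
have satM P : M P -> exists2 Q, sub P Q & sat Q.
  move=> MP; have [AP|AP] := pselect (A P).
    exists P; first exact: subcube_refl.
    apply: (@esum_le_term _ _ _ (fun S : cubeT => (rho S.1)%:E) P) => //.
    by split => //=; exact: subcube_refl.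
  have : ~ packed b (A `|` [set P]) 2.
    apply: Amax; last by move=> S [/AM//|->].
    split; first by move=> S; left.
    by move=> /(_ P) h; apply: AP; apply: h; right.
  move=> /existsNP [Q /negP]; rewrite -ltNge => Qlt; exists Q.
    apply: contrapT => nPQ; move: Qlt; apply/negP; rewrite -leNgt.
    apply: le_trans (Ap Q); apply: esum_sub => // S [[AS|->] SQ]//.
  have [PQ|nPQ] := pselect (sub P Q); last first.
    exfalso; move: Qlt; apply/negP; rewrite -leNgt.
    apply: le_trans (Ap Q); apply: esum_sub => // S [[AS|->] SQ]//.
  rewrite /sat leNgt; apply/negP => Qsat.
  move: Qlt; apply/negP; rewrite -leNgt.
  apply: (@le_trans _ _ (\esum_(S in AQ Q) (rho S.1)%:E + (rho P.1)%:E)).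
    rewrite (esumID A)//; apply: leeD.
      by apply: esum_sub => // S [[_ SQ] AS].
    rewrite -(@esum_set1 R _ P (fun S : cubeT => (rho S.1)%:E))//.
    by apply: esum_sub => // S [[[//|->] _] _].
  rewrite mulrDl mul1r EFinD; apply: leeD; first exact: ltW.
  by rewrite lee_fin rho_le//; case: PQ.
have satw Q : sat Q -> la%:E * dint (w \_ (ncube 2 Q)) <=
    C%:E * \esum_(S in AQ Q) dint (f \_ (cube S)).
  move=> Qsat; pose E : set V := \bigcup_(S in AQ Q) cube S.
  have EQ : E `<=` ncube 2 Q.
    move=> x [S [_ /= SQ] Sx]; apply: cube_sub_ncube => //.
    exact: subcube_sub SQ _ Sx.
  (* Packing with constant [1 + 2], applied to the indicator of [E], bounds the content of the union
     from below by a third of the sum. *)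
  have Elow : (c0 / 3 * rho Q.1)%:E <= dint (cst 1 \_ E).
    have := pack (cst 1 \_ E).
    have -> : (c0 / 3 * rho Q.1)%:E = (c0 * rho Q.1)%:E * (3^-1)%:E.
      by rewrite -EFinM; congr (_%:E); ring.
    rewrite lee_pdivrMr// [in X in _ -> X]muleC; apply: le_trans.
    apply: (@le_trans _ _ (c0%:E * \esum_(S in AQ Q) (rho S.1)%:E)).
      by rewrite EFinM; apply: lee_wpmul2l => //; rewrite lee_fin ltW.
    rewrite -esumZ//; apply: (@le_trans _ _ (\esum_(S in AQ Q)
        dint ((cst 1 \_ E) \_ (cube S)))).
      apply: le_esum => S AS; rewrite -EFinM; apply: le_trans (low S) _.
      apply: dint_le => x; rewrite !patchE; case: ifPn => // Sx.
      by rewrite mem_set//; exists S => //; exact: set_mem.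
    by apply: esum_sub => [S|S []//]; exact: dint_ge0.
  apply: le_trans (lee_wpmul2l la0' (HC Q E EQ Elow)) _.
  rewrite muleCA; apply: lee_wpmul2l; first by rewrite lee_fin ltW.
  apply: le_trans (lee_wpmul2l la0' (dint_bigcup _ _ w0)) _.
  rewrite -esumZ//; last by move=> S; exact: dint_ge0.
  by apply: le_esum => S [/AM [/ltW PS _] _].
have C0' : 0 <= C%:E by rewrite lee_fin ltW.
have satB Q : sat Q -> dint (w \_ (cube Q)) <= (C * 3 * F / la)%:E.
  move=> Qsat; rewrite EFinM lee_pdivlMr// muleC.
  apply: (@le_trans _ _ (la%:E * dint (w \_ (ncube 2 Q)))).
    by apply: lee_wpmul2l => //; apply: dint_restr_le => //; exact: cube_sub_ncube.
  apply: le_trans (satw Q Qsat) _; rewrite -mulrA EFinM; apply: lee_wpmul2l => //.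
  rewrite EFinM -FE; apply: le_trans (pack f).
  by apply: esum_sub => [S|S []//]; exact: dint_ge0.
have satmax := maximal_cube t0 t1 sA b0 c00 n0 low satB.
(* Maximal saturated cubes contain each member of [A] at most once, so no member is counted twice in
   the final sum. *)
pose MM := [set Q | sat Q /\ forall S, sub Q S -> sat S -> S = Q].
have cover : [set x : V | exists2 P, ncube 2 P x &
    la%:E * dint (w \_ (cube P)) < dint (f \_ (cube P))] `<=` \bigcup_(Q in MM) ncube 2 Q.
  move=> x [P Px PrP].
  have [P' [PP' PrP' mP']] := Mmax P PrP.
  have [P2 PP2 satP2] := satM P' (conj PrP' mP').
  have [Q [PQ satQ mQ]] := satmax P2 satP2.
  exists Q => //; apply: subcube_nsub Px => //.
  exact: subcube_trans PP' (subcube_trans PP2 PQ).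
apply: le_trans (lee_wpmul2l la0' (dint_restr_le b w0 cover)) _.
apply: le_trans (lee_wpmul2l la0' (dint_bigcup _ _ w0)) _.
rewrite -esumZ//; last by move=> Q; exact: dint_ge0.
apply: (@le_trans _ _ (\esum_(Q in MM) (C%:E * \esum_(S in AQ Q) dint (f \_ (cube S))))).
  by apply: le_esum => Q [Qsat _]; exact: satw.
rewrite esumZ//; last by move=> Q; apply: esum_ge0 => S _; exact: dint_ge0.
rewrite EFinM -muleA; apply: lee_wpmul2l => //; apply: le_trans (pack f).
apply: (@esum_antichain MM A (fun S => dint (f \_ (cube S)))).
  by move=> S; exact: dint_ge0.
move=> S Q Q' [satQ mQ] [satQ' mQ'] SQ SQ'.
have Sx := cube_corner R S.
have [QQ|QQ] := cube_nested (subcube_sub SQ Sx) (subcube_sub SQ' Sx).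
  by rewrite (mQ Q').
by rewrite (mQ' Q).
Qed.

End weak_type.

(** * Strong type bounds for weighted maximal functions *)

Section strong_type.
Variables (R : realType) (n : nat) (b c0 L : R).
Local Notation V := 'rV[R]_n.
Local Notation cubeT := (cubeT n).
Local Notation rho := (rho b).
Local Notation dint := (dint b).
Local Open Scope ereal_scope.

Hypotheses (b0 : (0 < b)%R) (c00 : (0 < c0)%R) (n0 : (0 < n)%N) (L0 : (0 < L)%R).
Hypothesis (low : forall P : cubeT, (c0 * rho P.1)%:E <= dint (cst 1 \_ (cube P))).
Hypothesis (lev : forall f : V -> \bar R, \esum_(m in [set: int]) ((expR m%:~R)%:E *
    dint (cst 1 \_ [set x | (expR m%:~R)%:E <= f x])) <= L%:E * dint f).

Lemma dint_exf_gt0 (u : V -> R) (P : cubeT) : 0 < dint (exf u \_ (cube P)).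
Proof.
rewrite lt_def dint_ge0 andbT; apply/eqP => /(dint0P b (exf_restr_ge0 u (cube P))) N0.
have : dint (cst 1 \_ (cube P)) = 0.
  apply: null_sub N0 => x Px /=; rewrite patchE mem_set//.
  by rewrite /exf eqe gt_eqF// expR_gt0.
by move=> h; have := low P; rewrite h lee_fin leNgt mulr_gt0//; exact: rho_gt0.
Qed.

Lemma null_exf (u : V -> R) (N : set V) : dint (exf u \_ N) = 0 -> null b N.
Proof.
move=> /(dint0P b (exf_restr_ge0 u N)); apply: null_sub => x Nx /=.
by rewrite patchE mem_set// /exf eqe gt_eqF// expR_gt0.
Qed.

Variables (t : R) (s : V -> R).
Hypotheses (t0 : (0 < t)%R) (t1 : (t < 1)%R) (sA : aw b 2 t s).

Let w := exf (wt t s).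
Let w0 x : 0 <= w x. Proof. exact: exf_ge0. Qed.

(** The logarithm of [f^r w] for [f = exp phi]. *)
Definition addw (r : R) (phi : V -> R) (x : V) : R := (r * phi x + wt t s x)%R.

(* Pieces on which both the weight and the function to integrate are constant
   up to a factor; they replace the levels of [phi] in Marcinkiewicz
   interpolation. *)
Let piece (r : R) (phi : V -> R) (z : int * int) : set V :=
  [set x | Num.floor (addw r phi x) = z.1] `&` slice s z.2.

Lemma pieces_le (r : R) : exists2 K : R, (0 < K)%R & forall phi : V -> R,
  \esum_(z in [set: int * int]) ((expR z.1%:~R)%:E * dint (cst 1 \_ (piece r phi z)))
  <= K%:E * dint (exf (addw r phi)).
Proof.
have [K K0 HK] := aw_slice t0 t1 sA.
exists (K * L)%R; first by rewrite mulr_gt0.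
move=> phi.
have D0 (z : int * int) : 0 <= (expR z.1%:~R)%:E * dint (cst 1 \_ (piece r phi z)).
  by rewrite mule_ge0 ?lee_fin ?expR_ge0// dint_ge0.
rewrite EFinM -muleA; apply: le_trans (lee_wpmul2l _ (lev _)); last by rewrite lee_fin ltW.
rewrite -esumZ//; last by move=> m; rewrite mule_ge0 ?lee_fin ?expR_ge0// dint_ge0.
rewrite (_ : [set: int * int] = [set: int] `*`` (fun=> [set: int])); last first.
  by apply/seteqP; split.
rewrite -(@esum_esum R _ _ _ _ (fun m l => (expR m%:~R)%:E * dint (cst 1 \_ (piece r phi (m, l)))));
  last by move=> m l _ _; exact: (D0 (m, l)).
apply: le_esum => m _; rewrite esumZ ?expR_gt0//; last by move=> l; exact: dint_ge0.
rewrite muleCA; apply: lee_wpmul2l; first by rewrite lee_fin expR_ge0.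
apply: le_trans (HK _); apply: le_esum => l _; apply: dint_le => x.
rewrite !patchE; case: ifPn => [|_]; last by case: ifP => //; case: ifP.
rewrite inE => -[/= xm xl]; rewrite mem_set// mem_set//=.
by rewrite /exf lee_fin ler_expR -xm floor_le.
Qed.

(** The maximal function of [exp phi] with respect to [w], over cubes with [x] in their second
    layer. *)
Let Y (phi : V -> R) (x : V) : \bar R :=
  ereal_sup [set dint (exf (addw 1 phi) \_ (cube P)) * ((fine (dint (w \_ (cube P))))^-1)%:E
    | P in [set P | ncube 2 P x]].

(** Marcinkiewicz interpolation. Where [phi <= j - 1] the function adds at most [e^(j-1)] to an
    average, too little to exceed [e^j]; the weak type inequality is applied to the rest. On a piece
    the sum over [j] is geometric because [r > 1], and [pieces_le] adds up the pieces. *)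
Lemma Y_level (r : R) : (1 < r)%R -> exists2 C : R, (0 < C)%R &
  forall phi : V -> R,
  \esum_(j in [set: int]) ((expR (r * (j%:~R + 1)))%:E *
     dint (w \_ [set x | (expR j%:~R)%:E < Y phi x])) <= C%:E * dint (exf (addw r phi)).
Proof.
move=> r1; have r0 : (0 < r)%R by apply: lt_trans r1.
have [C C0 HC] := weak_type t0 t1 sA b0 c00 n0 low.
have [K K0 HK] := pieces_le r.
have d0 : (0 < r - 1)%R by rewrite subr_gt0.
pose G := geoC (r - 1).
have G0 : (0 < G)%R by exact: geoC_gt0.
pose C1 : R := (C * expR (r + 1))%R.
pose C2 : R := (G * expR (r - 1 + 1 + (1 - t)))%R.
have C10 : (0 < C1)%R by rewrite mulr_gt0// expR_gt0.
have C20 : (0 < C2)%R by rewrite mulr_gt0// expR_gt0.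
exists (C1 * (C2 * K))%R; first by do !apply: mulr_gt0 => //.
move=> phi; pose g := exf (addw 1 phi).
pose gj (j : int) := g \_ [set x | (j%:~R - 1 < phi x)%R].
have g0 x : 0 <= g x by exact: exf_ge0.
have gj0 j x : 0 <= gj j x by exact: exf_restr_ge0.
have step1 (j : int) : (expR (j%:~R - 1))%:E * dint (w \_ [set x | (expR j%:~R)%:E < Y phi x]) <=
    C%:E * dint (gj j).
  apply: le_trans (HC _ _ (gj0 j) (expR_gt0 _)); apply: lee_wpmul2l.
    by rewrite lee_fin expR_ge0.
  apply: dint_restr_le => // x /= /ereal_sup_gt [_ [P Px <-] jP].
  exists P => //; have [wP wP0 wPE] := aw_pos sA c00 low P.
  rewrite -[w]/(exf (wt t s)) wPE /= in jP *.
  rewrite lte_pdivlMr// -EFinM in jP.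
  rewrite -EFinM.
  have gsplit : dint (g \_ (cube P)) <=
      (expR (j%:~R - 1))%:E * wP%:E + dint (gj j \_ (cube P)).
    rewrite -wPE -dintZ ?expR_gt0//; apply: le_trans (dintD b _ _).
    - apply: dint_le => y; rewrite !patchE; case: ifPn => yP; last by rewrite mule0 adde0.
      rewrite /gj patchE; case: ifPn => [_|].
        by rewrite leeDr// mule_ge0// lee_fin expR_ge0.
      rewrite notin_setE /= => /negP; rewrite -leNgt => jy.
      by rewrite adde0 /g /exf /addw mul1r -EFinM lee_fin -expRD ler_expR lerD2r.
    - by move=> y; rewrite mule_ge0 ?lee_fin ?expR_ge0//; exact: exf_restr_ge0.
    - by move=> y; rewrite patchE; case: ifP.
  have := lt_le_trans jP gsplit; rewrite -EFinM -lteBlDl// -EFinB.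
  apply: le_lt_trans; rewrite lee_fin lerBrDl -mulrDl ler_wpM2r ?(ltW wP0)//.
  have -> : (expR j%:~R = expR (j%:~R - 1) * expR 1 :> R)%R.
    by rewrite -expRD subrK.
  rewrite -[X in (X + X)%R]mulr1 -mulrDr ler_wpM2l ?expR_ge0//.
  by have := expR_ge1Dx (1 : R).
have step2 (j : int) : (expR (r * (j%:~R + 1)))%:E *
     dint (w \_ [set x | (expR j%:~R)%:E < Y phi x]) <=
     C1%:E * ((expR ((r - 1) * j%:~R))%:E * dint (gj j)).
  have -> : expR (r * (j%:~R + 1)) = (expR (r + 1) * expR ((r - 1) * j%:~R) * expR (j%:~R - 1))%R.
    by rewrite -!expRD; congr expR; ring.
  rewrite EFinM -muleA.
  apply: le_trans (lee_wpmul2l _ (step1 j)) _; first by rewrite lee_fin mulr_ge0 ?expR_ge0.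
  rewrite [leLHS]muleA [leRHS]muleA -!EFinM /C1.
  have -> : (expR (r + 1) * expR ((r - 1) * j%:~R) * C =
      C * expR (r + 1) * expR ((r - 1) * j%:~R) :> R)%R by ring.
  exact: lexx.
pose h z := dint (cst 1 \_ (piece r phi z)).
(* An upper bound of [phi] on the piece, from [addw r phi < z.1 + 1] and [s >= z.2]; with
   [s <= z.2 + 1], [E z] then bounds [exp phi] times the weight there. *)
pose Aml (z : int * int) : R := ((z.1%:~R + 1 - (1 - t) * z.2%:~R) / r)%R.
have h0 z : 0 <= h z by exact: dint_ge0.
pose E z : R := expR (Aml z + (1 - t) * (z.2%:~R + 1)).
have E0 z : 0 <= (E z)%:E by rewrite lee_fin expR_ge0.
have step3 (j : int) : dint (gj j) <= \esum_(z in [set: int * int])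
    ((E z)%:E * (if (j%:~R <= Aml z + 1)%R then h z else 0)).
  apply: (@le_trans _ _ (dint (gj j \_ (\bigcup_(z in [set: int * int]) piece r phi z)))).
    apply: dint_le => x; rewrite [leRHS]patchE mem_set//.
    by exists (Num.floor (addw r phi x), Num.floor (s x)).
  apply: le_trans (dint_bigcup b _ _ (gj0 j)) _; apply: le_esum => z _.
  have phiA x : piece r phi z x -> (phi x <= Aml z)%R.
    move=> [/= xm xl]; rewrite /Aml ler_pdivlMr// mulrC.
    have [l1 l2] := sliceP xl.
    have := floorD1_gt (addw r phi x); rewrite xm intrD /addw /wt => h1.
    have T0 : (0 <= 1 - t)%R by rewrite subr_ge0 ltW.
    by have := ler_wpM2l T0 l1; lra.
  have [jA|jA] := ifP; last first.
    rewrite mule0 (_ : gj j \_ _ = fun=> 0) ?dint0//; apply/funext => x.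
    rewrite patchE; case: ifPn => // /set_mem zx; rewrite /gj patchE.
    case: ifPn => //; rewrite inE /= => jx.
    exfalso; move/negP: jA; apply; have := phiA x zx; lra.
  rewrite -dintZ ?expR_gt0//; apply: dint_le => x; rewrite !patchE.
  case: ifPn => [/set_mem zx|_]; last by rewrite mule0.
  rewrite mule1 /gj patchE; case: ifP => _; last by rewrite lee_fin expR_ge0.
  rewrite /g /exf lee_fin ler_expR /addw mul1r; apply: lerD; first exact: phiA.
  have [_ l2] := sliceP zx.2; rewrite /wt ler_wpM2l// subr_ge0 ltW//.
apply: (@le_trans _ _ (\esum_(j in [set: int])
    (C1%:E * ((expR ((r - 1) * j%:~R))%:E * dint (gj j))))).
  by apply: le_esum => j _; exact: step2.
rewrite esumZ//; last by move=> j; rewrite mule_ge0 ?lee_fin ?expR_ge0// dint_ge0.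
rewrite (EFinM C1) -muleA; apply: lee_wpmul2l; first by rewrite lee_fin ltW.
have I0 (j : int) z : 0 <= (if (j%:~R <= Aml z + 1)%R then h z else 0) by case: ifP.
apply: (@le_trans _ _ (\esum_(j in [set: int]) \esum_(z in [set: int * int])
    ((expR ((r - 1) * j%:~R))%:E * ((E z)%:E * (if (j%:~R <= Aml z + 1)%R then h z else 0))))).
  apply: le_esum => j _; rewrite esumZ ?expR_gt0//; last first.
    by move=> z; apply: mule_ge0.
  by apply: lee_wpmul2l; rewrite ?lee_fin ?expR_ge0//; exact: step3.
rewrite esum_exchange; last first.
  by move=> j z; rewrite mule_ge0 ?lee_fin ?expR_ge0//; apply: mule_ge0.
rewrite EFinM -muleA; apply: le_trans (lee_wpmul2l _ (HK phi)); last by rewrite lee_fin ltW.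
rewrite -esumZ//; last by move=> z; rewrite mule_ge0 ?h0// lee_fin expR_ge0.
apply: le_esum => z _.
apply: (@le_trans _ _ ((\esum_(j in [set j : int | (j%:~R <= Aml z + 1)%R])
    (expR ((r - 1) * j%:~R))%:E) * ((E z)%:E * h z))).
  have [hz|hz] := eqVneq (h z) +oo; last first.
    have [H H0 HE] := ereal_ltyP (h0 z) (etrans (ltey _) hz).
    rewrite HE -EFinM muleC -esumZ0 ?mulr_ge0 ?expR_ge0//.
    rewrite [leRHS]esum_mkcond; apply: le_esum => j _.
    have [jA|jA] := ifP; last by rewrite !mule0; case: ifP => // _; rewrite -EFinM lee_fin !mulr_ge0 ?expR_ge0.
    by rewrite mem_set// -!EFinM lee_fin mulrC.
  rewrite hz gt0_muley ?lte_fin ?expR_gt0// gt0_muley ?leey//.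
  apply: lt_le_trans (@esum_le_term _ _ _ (fun j : int => (expR ((r - 1) * j%:~R))%:E)
    (Num.floor (Aml z + 1)) _ _) => //=; first by rewrite lte_fin expR_gt0.
  exact: floor_le.
apply: le_trans (lee_wpmul2r _ (geometric_down _ d0)) _.
  exact: mule_ge0.
rewrite muleA [leRHS]muleA; apply: lee_wpmul2r => //.
rewrite -!EFinM lee_fin /C2 -!mulrA ler_wpM2l ?(ltW G0)// -!expRD ler_expR.
have : (r * Aml z = z.1%:~R + 1 - (1 - t) * z.2%:~R)%R by rewrite /Aml mulrC divfK ?gt_eqF.
by lra.
Qed.

(* The weighted maximal function is replaced by a real-valued majorant. *)
Lemma strong_type (r : R) : (1 < r)%R -> exists2 C : R, (0 < C)%R &
  forall phi : V -> R, dint (exf (addw r phi)) < +oo -> exists psi : V -> R,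
  dint (exf (addw r psi)) <= C%:E * dint (exf (addw r phi)) /\
  exists2 N, null b N & forall P x, ncube 2 P x -> ~ N x ->
    dint (exf (addw 1 phi) \_ (cube P)) <= (expR (psi x))%:E * dint (w \_ (cube P)).
Proof.
move=> r1; have r0 : (0 < r)%R by apply: lt_trans r1.
have [C C0 HC] := Y_level r1; exists C => // phi Ufin.
have {}HC := HC phi; set S := esum _ _ in HC.
pose N := [set x | Y phi x = +oo].
have T0 (j : int) : 0 <= (expR (r * (j%:~R + 1)))%:E *
     dint (w \_ [set x | (expR j%:~R)%:E < Y phi x]).
  by rewrite mule_ge0 ?lee_fin ?expR_ge0// dint_ge0.
have Nnull : null b N.
  apply: (@null_exf (wt t s)); apply/le_anti/andP; split; last exact: dint_ge0.
  have [F F0 FE] := ereal_ltyP (dint_ge0 b _) Ufin.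
  (* [N] lies in all level sets of [Y phi], and a single term of the series already has an
     arbitrarily large factor. *)
  have H (x : R) : (0 < x)%R -> dint (w \_ N) <= (C * F / x)%:E.
    move=> x0; rewrite EFinM lee_pdivlMr// EFinM -FE; apply: le_trans HC.
    pose j := Num.ceil (ln x / r).
    apply: le_trans (@esum_le_term _ _ setT _ j T0 _) => //.
    rewrite muleC; apply: (@le_trans _ _ (x%:E * dint (w \_ [set x | (expR j%:~R)%:E < Y phi x]))).
      apply: lee_wpmul2l; first by rewrite lee_fin ltW.
      by apply: dint_restr_le => // y /= ->; exact: ltry.
    apply: lee_wpmul2r; first exact: dint_ge0.
    rewrite lee_fin -[leLHS](lnK (x := x)) ?posrE// ler_expR.
    have /andP[_] := ceil_itv (ln x / r); rewrite ler_pdivrMr// -/j => h.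
    by rewrite mulrDr mulrC; lra.
  apply/lee_addgt0Pr => e e0; rewrite add0e.
  have CF : (0 <= C * F)%R by rewrite mulr_ge0 ?(ltW C0).
  have x0 : (0 < (C * F + 1) / e)%R by rewrite divr_gt0// ltr_wpDl.
  apply: le_trans (H _ x0) _; rewrite lee_fin ler_pdivrMr// mulrCA divff ?gt_eqF// mulr1.
  by rewrite lerDl.
have YP P x : ncube 2 P x -> dint (exf (addw 1 phi) \_ (cube P)) *
    ((fine (dint (w \_ (cube P))))^-1)%:E <= Y phi x.
  by move=> Px; apply: ereal_sup_ubound; exists P.
have Y0 x : 0 < Y phi x.
  have Px : ncube 2 (0%R : int, dy 0 x) x by exact: cube_sub_ncube.
  apply: lt_le_trans (YP _ _ Px); apply: mule_gt0; first exact: dint_exf_gt0.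
  have [wP wP0 wPE] := aw_pos sA c00 low (0%R : int, dy 0 x).
  by rewrite -[w]/(exf (wt t s)) wPE lte_fin invr_gt0.
have YE x : ~ N x -> Y phi x = (expR (ln (fine (Y phi x))))%:E.
  move=> /eqP Nx; have [y y0 yE] := ereal_ltyP (ltW (Y0 x)) (etrans (ltey _) Nx).
  by have := Y0 x; rewrite yE /= lte_fin => yp; rewrite lnK.
exists (fun x => ln (fine (Y phi x))); split; last first.
  exists N => // P x Px Nx; have := YP _ _ Px.
  have [wP wP0 wPE] := aw_pos sA c00 low P.
  by rewrite -[w]/(exf (wt t s)) wPE /= lee_pdivrMr// -YE.
apply: le_trans HC.
pose T (j : int) x : \bar R := (expR (r * (j%:~R + 1)))%:E * (w \_ [set x | (expR j%:~R)%:E < Y phi x]) x.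
have TT0 j x : 0 <= T j x by rewrite mule_ge0 ?lee_fin ?expR_ge0//; exact: exf_restr_ge0.
apply: (@le_trans _ _ (dint (fun x => \esum_(j in [set: int]) T j x))).
  apply: (dint_ae Nnull) => [x|x|x Nx]; [exact: exf_ge0|exact: esum_ge0|].
  have yE := YE x Nx; set y := ln _ in yE *.
  (* The level sets are strict, so [j] must satisfy [j < y <= j + 1]; the floor would not do. *)
  pose j := (Num.ceil y - 1)%R.
  have /andP[j1 j2] := ceil_itv y.
  apply: le_trans (@esum_le_term _ _ setT (T^~ x) j _ _) => //.
  rewrite /T patchE mem_set/=; last by rewrite yE lte_fin ltr_expR.
  rewrite /w /exf -EFinM lee_fin -expRD ler_expR /addw -/y lerD2r.
  by rewrite ler_pM2l// intrB subrK.
apply: le_trans (dint_esum b TT0) _; apply: le_esum => j _.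
by rewrite dintZ ?expR_gt0.
Qed.

End strong_type.

(** * The maximal operator on weighted spaces and A_1 majorants *)

Section maximal.
Variables (R : realType) (n : nat) (b c0 L : R).
Local Notation V := 'rV[R]_n.
Local Notation cubeT := (cubeT n).
Local Notation rho := (rho b).
Local Notation lrho := (lrho b).
Local Notation dint := (dint b).
Local Open Scope ereal_scope.

Hypotheses (b0 : (0 < b)%R) (c00 : (0 < c0)%R) (n0 : (0 < n)%N) (L0 : (0 < L)%R).
Hypothesis (low : forall P : cubeT, (c0 * rho P.1)%:E <= dint (cst 1 \_ (cube P))).
Hypothesis (lev : forall f : V -> \bar R, \esum_(m in [set: int]) ((expR m%:~R)%:E *
    dint (cst 1 \_ [set x | (expR m%:~R)%:E <= f x])) <= L%:E * dint f).

Lemma null_pinfty (f : V -> \bar R) : (forall x, 0 <= f x) -> dint f < +oo ->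
  null b [set x | f x = +oo].
Proof.
move=> f0 ffin; have [F F0 FE] := ereal_ltyP (dint_ge0 b f) ffin.
apply/le_anti/andP; split; last exact: dint_ge0.
apply/lee_addgt0Pr => e e0; rewrite add0e.
have F1 : (0 < F + 1)%R by rewrite ltr_wpDl.
have eF : (0 < e / (F + 1))%R by rewrite divr_gt0.
apply: (@le_trans _ _ ((e / (F + 1))%:E * dint f)).
  rewrite -dintZ//; apply: dint_le => x; rewrite patchE; case: ifPn => [|_].
    by rewrite inE /= => ->; rewrite gt0_muley ?lte_fin ?leey.
  by rewrite mule_ge0// lee_fin ltW.
rewrite FE -EFinM lee_fin mulrAC ler_pdivrMr// ler_pM2l//; lra.
Qed.

Lemma cube_nonnull (P : cubeT) (N : set V) : null b N -> exists2 x, cube P x & ~ N x.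
Proof.
move=> N0; apply: contrapT => H.
have : null b (cube P).
  by apply: null_sub N0 => x Px; apply: contrapT => Nx; apply: H; exists x.
by rewrite /null => h; have := low P; rewrite h lee_fin leNgt mulr_gt0//; exact: rho_gt0.
Qed.

Lemma dint_diff_null (E N : set V) : null b N -> dint (cst 1 \_ E) <= dint (cst 1 \_ (E `\` N)).
Proof.
move=> N0; apply: (dint_ae N0) => x; rewrite !patchE; [by case: ifP|by case: ifP|move=> Nx].
case: ifPn => [|_]; last by case: ifP.
by rewrite inE => Ex; rewrite mem_set.
Qed.

Section majorant.
Variables (t : R) (s : V -> R).
Hypotheses (t0 : (0 < t)%R) (t1 : (t < 1)%R) (sA : aw b 2 t s).

(** The logarithm of [f^p w] for [f = exp phi] and [p = 1 / t]. *)
Definition powt (phi : V -> R) (x : V) : R := (phi x / t + wt t s x)%R.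

(* Lerner's argument: for a weight [w] of class [A_p] with dual weight [v],
   [(M f)^(p-1)] is controlled by [M_w ((M_v (f / v))^(p-1) / w)], where [M_w]
   and [M_v] are the maximal operators with respect to [w] and [v]. *)
Lemma maximal_majorant : exists2 C : R, (0 < C)%R & forall phi : V -> R,
  dint (exf (powt phi)) < +oo -> exists psi : V -> R,
  dint (exf (powt psi)) <= C%:E * dint (exf (powt phi)) /\
  exists2 N, null b N & forall P x, ncube 2 P x -> ~ N x ->
    dint (exf phi \_ (cube P)) <= (rho P.1 * expR (psi x))%:E.
Proof.
have T0 : (0 < 1 - t)%R by rewrite subr_gt0.
have T1 : (1 - t < 1)%R by rewrite gtrBl.
have r1 : (1 < t^-1)%R by rewrite invf_gt1.
have r2 : (1 < (1 - t)^-1)%R by rewrite invf_gt1.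
have [C1 C10 H1] := strong_type b0 c00 n0 L0 low lev T0 T1 (aw_sym sA) r1.
have [C2 C20 H2] := strong_type b0 c00 n0 L0 low lev t0 t1 sA r2.
have [kap Hkap] := sA.
pose c : R := ((kap - t * ln c0) / (1 - t))%R.
exists (expR (c / t) * C2 * C1)%R; first by rewrite !mulr_gt0 ?expR_gt0.
move=> phi Dfin.
(* The logarithm of [f / v]; [psi1] will be that of a majorant of [M_v (f / v)], bounded with
   exponent [p = 1 / t] with respect to [v]. *)
pose phi1 x := (phi x + t * s x)%R.
have tV : (t / t = 1)%R by rewrite divff ?gt_eqF.
have TV : ((1 - t) / (1 - t) = 1)%R by rewrite divff ?gt_eqF.
have e1 : addw (1 - t) (fun x => - s x)%R t^-1 phi1 = powt phi.
  apply/funext => x; rewrite /addw /phi1 /powt wt_sym /dl /wt mulrDr mulrA [(t^-1 * t)%R]mulrC tV.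
  by ring.
have e2 : addw (1 - t) (fun x => - s x)%R 1 phi1 = phi.
  by apply/funext => x; rewrite /addw /phi1 wt_sym /dl; ring.
have := H1 phi1; rewrite e1 e2 => /(_ Dfin) [psi1 [D1 [N1 N1null HN1]]].
rewrite wt_sym in HN1.
(* The logarithm of [(M_v (f / v))^(p-1) / w], to which [M_w] is applied with the conjugate exponent
   [1 / (1 - t)]. *)
pose phi2 x := ((t^-1 - 1) * psi1 x - wt t s x)%R.
have e3 : addw t s (1 - t)^-1 phi2 = addw (1 - t) (fun x => - s x)%R t^-1 psi1.
  apply/funext => x; rewrite /addw /phi2 wt_sym /dl /wt.
  have -> : ((1 - t)^-1 * ((t^-1 - 1) * psi1 x - (1 - t) * s x) =
     ((1 - t) / (1 - t)) * (t^-1 * psi1 x - s x))%R.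
    have -> : (t^-1 - 1 = (1 - t) * t^-1)%R by rewrite mulrBl mul1r tV.
    by ring.
  by rewrite TV; ring.
have e4 : addw t s 1 phi2 = fun x => ((t^-1 - 1) * psi1 x)%R.
  by apply/funext => x; rewrite /addw /phi2; ring.
have D1fin : dint (exf (addw t s (1 - t)^-1 phi2)) < +oo.
  rewrite e3; apply: le_lt_trans D1 _.
  have [F F0 ->] := ereal_ltyP (dint_ge0 b _) Dfin.
  by rewrite -EFinM ltry.
have [psi2 [D2 [N2 N2null HN2]]] := H2 phi2 D1fin.
rewrite e4 in HN2; rewrite e3 in D2.
exists (fun x => (t * psi2 x + kap - t * ln c0) / (1 - t))%R; split.
  have -> : exf (powt (fun x => (t * psi2 x + kap - t * ln c0) / (1 - t))%R) =
      fun x => (expR (c / t))%:E * exf (addw t s (1 - t)^-1 psi2) x.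
    apply/funext => x; rewrite /exf -EFinM -expRD; congr ((expR _)%:E).
    rewrite /powt /addw /c; field.
    by rewrite !gt_eqF.
  rewrite dintZ ?expR_gt0// !EFinM -!muleA; apply: lee_wpmul2l.
    by rewrite lee_fin expR_ge0.
  apply: le_trans D2 _; apply: lee_wpmul2l => //.
  by rewrite lee_fin ltW.
exists N2 => // P x Px Nx.
have [p [q [wp sq pq]]] := Hkap P.
have PP : (cube P : set V) `<=` ncube 2 P by exact: cube_sub_ncube.
have E0 (u : V -> R) y : 0 <= exf u y by exact: exf_ge0.
have {}wp := le_trans (dint_restr_le b (E0 _) PP) wp.
have {}sq := le_trans (dint_restr_le b (E0 _) PP) sq.
have [z Pz Nz] := cube_nonnull P N1null.
have Afin : dint (exf phi \_ (cube P)) < +oo.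
  apply: le_lt_trans (HN1 P z (PP z Pz) Nz) _.
  apply: le_lt_trans (lee_wpmul2l _ sq) _; first by rewrite lee_fin expR_ge0.
  by rewrite -EFinM ltry.
have [A A0 AE] := ereal_ltyP (dint_ge0 b _) Afin.
have {A0}Ap : (0 < A)%R.
  by have := dint_exf_gt0 c00 low phi P; rewrite AE lte_fin.
pose a := ln A; have Aa : A = expR a by rewrite lnK.
(* On almost all of [P] the first maximal function is at least the integral of [f] over [P] divided
   by the bound for [v(P)], so the lower bound [low] on the content of [P] bounds its integral from
   below. *)
have psi1z y : cube P y -> ~ N1 y -> (a - q <= psi1 y)%R.
  move=> Py Ny; have := le_trans (HN1 P y (PP y Py) Ny) (lee_wpmul2l _ sq).
  rewrite lee_fin => /(_ (expR_ge0 _)).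
  by rewrite AE Aa -EFinM lee_fin -expRD ler_expR; lra.
have := HN2 P x Px Nx => /le_trans /(_ (lee_wpmul2l _ wp)).
rewrite lee_fin => /(_ (expR_ge0 _)); rewrite -EFinM -expRD => h.
have tI : (0 <= t^-1 - 1)%R by rewrite subr_ge0 ltW.
have hE : dint (exf (fun x => (t^-1 - 1) * psi1 x)%R \_ (cube P `\` N1)) <= (expR (psi2 x + p))%:E.
  by apply: le_trans (dint_restr_le b (E0 _) _) h; exact: subDsetl.
have {h hE} := dint1_expR hE (r := (t^-1 - 1) * (a - q))%R.
have H : forall y, (cube P `\` N1) y -> ((t^-1 - 1) * (a - q) <= (t^-1 - 1) * psi1 y)%R.
  by move=> y [Py Ny]; apply: ler_wpM2l => //; exact: psi1z.
move=> /(_ H) /(le_trans (dint_diff_null _ N1null)) /(le_trans (low P)).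
rewrite AE !lee_fin rhoE Aa -(lnK (x := c0)) ?posrE// -!expRD !ler_expR expRK => h.
have {}h := ler_wpM2l (ltW t0) h.
have tt : (t * ((t^-1 - 1) * (a - q)) = (1 - t) * (a - q))%R.
  by rewrite mulrA (mulrBr t) tV mulr1.
rewrite mulrBr tt in h.
rewrite -lerBlDl ler_pdivlMr// mulrC; lra.
Qed.

(** A positive integrable function, added to a nonnegative one to give it a real logarithm. *)
Lemma exf_integrable : exists phi : V -> R, dint (exf phi) < +oo.
Proof.
pose e (m : 'rV[int]_n) : R := (1 / (2 ^ (pickle m).+1)%:R)%R.
have e0 m : (0 < e m)%R by rewrite divr_gt0// ltr0n expn_gt0.
exists (fun x => ln (e (dy 0 x))).
pose T (m : 'rV[int]_n) : V -> \bar R := fun x => (e m)%:E * (cst 1 \_ (cube (0%R : int, m))) x.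
have T0 m x : 0 <= T m x by rewrite mule_ge0 ?lee_fin ?(ltW (e0 m))// patchE; case: ifP.
apply: (@le_lt_trans _ _ (dint (fun x => \esum_(m in [set: 'rV[int]_n]) T m x))).
  apply: dint_le => x.
  apply: le_trans (@esum_le_term _ _ setT (T^~ x) (dy 0 x) _ _) => //.
  by rewrite /T patchE mem_set// mule1 /exf lnK// posrE.
apply: le_lt_trans (dint_esum b T0) _.
apply: (@le_lt_trans _ _ (\esum_(m in [set: 'rV[int]_n]) ((rho 0)%:E * (e m)%:E))).
  apply: le_esum => m _; rewrite /T dintZ// muleC; apply: lee_wpmul2r.
    by rewrite lee_fin ltW.
  exact: dint_cube.
rewrite esumZ ?rho_gt0//; last by move=> m; rewrite lee_fin ltW.
apply: (@le_lt_trans _ _ ((rho 0)%:E * 1%:E)); last by rewrite -EFinM ltry.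
by apply: lee_wpmul2l; [rewrite lee_fin ltW// rho_gt0|exact: esum_countable_eps].
Qed.

(* Rubio de Francia's iteration of the maximal operator. *)
Lemma a1_majorant (U : V -> \bar R) : (forall x, 0 <= U x) -> dint U < +oo ->
  exists (g : V -> R) (kap : R) (N : set V), [/\ null b N,
   forall x, ~ N x -> U x <= exf (powt g) x,
   dint (exf (powt g)) < +oo &
   forall P x, ncube 1 P x -> ~ N x ->
     dint (exf g \_ (ncube 1 P)) <= (expR (kap + lrho P.1 + g x))%:E].
Proof.
move=> U0 Ufin; have [C C0 HC] := maximal_majorant.
have [phiF Ffin] := exf_integrable.
pose U' x := U x + exf phiF x.
have U'0 x : 0 < U' x.
  by apply: (@lt_le_trans _ _ (exf phiF x)); rewrite ?lte_fin ?expR_gt0// leeDr.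
have U'fin : dint U' < +oo.
  apply: le_lt_trans (dintD b U0 (fun x => exf_ge0 _ x)) _.
  exact: lte_add_pinfty.
have N0null := null_pinfty (fun x => ltW (U'0 x)) U'fin.
set N0 := [set x | U' x = +oo] in N0null.
pose phi0 x := (t * (ln (fine (U' x)) - wt t s x))%R.
have U'E x : ~ N0 x -> U' x = exf (powt phi0) x.
  move=> /eqP Nx; have [y y0 yE] := ereal_ltyP (ltW (U'0 x)) (etrans (ltey _) Nx).
  have := U'0 x; rewrite /exf /powt /phi0 yE /= lte_fin => yp.
  by rewrite [(t * _)%R]mulrC mulfK ?gt_eqF// subrK lnK.
have /choice[M HM] : forall phi : V -> R, exists psi : V -> R,
    dint (exf (powt phi)) < +oo -> 
    dint (exf (powt psi)) <= C%:E * dint (exf (powt phi)) /\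
    exists2 N, null b N & forall P x, ncube 2 P x -> ~ N x ->
    dint (exf phi \_ (cube P)) <= (rho P.1 * expR (psi x))%:E.
  move=> phi; have [fin|nfin] := pselect (dint (exf (powt phi)) < +oo).
    by have [psi H] := HC phi fin; exists psi.
  by exists phi.
pose ph k := iter k M phi0.
have [D0 D00 D0E] : exists2 D : R, (0 <= D)%R & dint (exf (powt phi0)) <= D%:E.
  have [D D0 DE] := ereal_ltyP (dint_ge0 b _) U'fin; exists D => //.
  rewrite -DE; apply: (dint_ae N0null) => [x|x|x Nx]; [exact: exf_ge0|exact: ltW|].
  by rewrite U'E.
have Dk k : dint (exf (powt (ph k))) <= (C ^+ k * D0)%:E.
  elim: k => [|k IH]; first by rewrite expr0 mul1r.
  have fin := le_lt_trans IH (ltry _).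
  apply: le_trans (HM _ fin).1 _; rewrite exprS -mulrA EFinM; apply: lee_wpmul2l => //.
  by rewrite lee_fin ltW.
have /choice[Nk HNk] : forall k, exists N : set V, null b N /\
    forall P x, ncube 2 P x -> ~ N x ->
    dint (exf (ph k) \_ (cube P)) <= (rho P.1 * expR (ph k.+1 x))%:E.
  move=> k; have fin := le_lt_trans (Dk k) (ltry _).
  by have [_ [N N0' HN]] := HM _ fin; exists N.
(* Chosen so that [C ^ k] times [exp (- (eta / t) k)] is at most [exp (- k)]. *)
pose eta : R := (t * (`|ln C| + 1))%R.
have eta0 : (0 < eta)%R by rewrite mulr_gt0// ltr_wpDl.
pose Z x := \esum_(k in [set: nat]) ((expR (- (eta / t) * k%:R))%:E * exf (powt (ph k)) x).
have Zt0 k x : 0 <= (expR (- (eta / t) * k%:R))%:E * exf (powt (ph k)) x.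
  by rewrite mule_ge0 ?lee_fin ?expR_ge0//; exact: exf_ge0.
have Z0 x : 0 <= Z x by exact: esum_ge0.
have Zfin : dint Z < +oo.
  apply: le_lt_trans (dint_esum b Zt0) _.
  have x01 : (0 <= expR (-1 : R) < 1)%R by rewrite expR_ge0 expR_lt1 oppr_lt0 ltr01.
  apply: (@le_lt_trans _ _ (\esum_(k in [set: nat]) (D0%:E * (expR (-1) ^+ k)%:E))).
    apply: le_esum => k _; rewrite dintZ ?expR_gt0//.
    apply: le_trans (lee_wpmul2l _ (Dk k)) _; first by rewrite lee_fin expR_ge0.
    rewrite -!EFinM lee_fin mulrA [leRHS]mulrC ler_wpM2r//.
    rewrite -expRM_natl -{1}(lnK (x := C)) ?posrE// -expRM_natl -expRD ler_expR.
    have -> : (eta / t = `|ln C| + 1)%R by rewrite /eta mulrC mulKf ?gt_eqF.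
    have := ler_norm (ln C); have : (0 <= k%:R :> R)%R by []. 
    move=> k0 /(ler_wpM2l k0); lra.
  rewrite esumZ0//.
  apply: (@le_lt_trans _ _ (D0%:E * ((1 - expR (-1))^-1)%:E)).
    by apply: lee_wpmul2l; rewrite ?lee_fin//; exact: esum_geometric.
  by rewrite -EFinM ltry.
have NZ := null_pinfty Z0 Zfin.
(* Each term of [Z] bounds the iterate [exp (ph k)] by [exp (eta k) (Z / w)^t]. The doubled rate
   therefore leaves a geometric series, and [G^p w] is at most a multiple of the integrable [Z]. *)
pose G x := \esum_(k in [set: nat]) ((expR (- (2 * eta) * k%:R))%:E * exf (ph k) x).
have Gt0 k x : 0 <= (expR (- (2 * eta) * k%:R))%:E * exf (ph k) x.
  by rewrite mule_ge0 ?lee_fin ?expR_ge0//; exact: exf_ge0.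
have Gph x : exf phi0 x <= G x.
  apply: le_trans (@esum_le_term _ _ setT _ 0%N (fun k => Gt0 k x) _) => //=.
  by rewrite mulr0 expR0 mul1e.
have G0 x : 0 < G x by apply: lt_le_trans (Gph x); rewrite lte_fin expR_gt0.
pose z x := ln (fine (Z x)).
have GZ x : ~ [set x | Z x = +oo] x ->
    G x <= (geoC eta * expR (t * (z x - wt t s x)))%:E /\ Z x = (expR (z x))%:E.
  move=> /eqP Nx; have [y y0 yE] := ereal_ltyP (Z0 x) (etrans (ltey _) Nx).
  have term k : (expR (- (eta / t) * k%:R))%:E * exf (powt (ph k)) x <= y%:E.
    by rewrite -yE; apply: (@esum_le_term _ _ setT _ k (fun k => Zt0 k x)).
  have yp : (0 < y)%R.
    rewrite -lte_fin; apply: lt_le_trans (term 0%N).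
    by rewrite -EFinM lte_fin mulr_gt0 ?expR_gt0.
  have zy : y = expR (z x) by rewrite /z yE /= lnK.
  split; last by rewrite yE zy.
  apply: (@le_trans _ _ (\esum_(k in [set: nat])
      ((expR (t * (z x - wt t s x)))%:E * (expR (- eta) ^+ k)%:E))).
    apply: le_esum => k _; rewrite -!EFinM lee_fin -expRM_natl -!expRD ler_expR.
    have := term k; rewrite zy -EFinM lee_fin -expRD ler_expR /powt => h.
    have {}h := ler_wpM2l (ltW t0) h.
    have e : (t * (- (eta / t) * k%:R + (ph k x / t + wt t s x)) =
      - eta * k%:R + ph k x + t * wt t s x)%R by field; rewrite gt_eqF.
    by rewrite e in h; lra.
  rewrite esumZ ?expR_gt0//.
  rewrite (mulrC (geoC eta)) EFinM; apply: lee_wpmul2l; first by rewrite lee_fin expR_ge0.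
  by apply: esum_geometric; rewrite expR_ge0 expR_lt1 oppr_lt0.
pose g x := ln (fine (G x)).
pose N := N0 `|` ([set x | Z x = +oo] `|` \bigcup_k Nk k).
have Nnull : null b N.
  apply: null_setU => //; apply: null_setU => //; apply: null_bigcup => k.
  by case: (HNk k).
have GE x : ~ N x -> G x = exf g x.
  move=> Nx; have [|GZx _] := GZ x; first by move=> h; apply: Nx; right; left.
  have [y y0 yE] := ereal_ltyP (ltW (G0 x)) (le_lt_trans GZx (ltry _)).
  by have := G0 x; rewrite /exf /g yE /= lte_fin => yp; rewrite lnK.
exists g, (ln (nbrC R n) + 2 * eta)%R, N; split => //.
- move=> x Nx; apply: (@le_trans _ _ (U' x)); first by rewrite leeDl// exf_ge0.
  rewrite U'E; last by move=> h; apply: Nx; left.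
  have := Gph x; rewrite GE// !lee_fin !ler_expR => h.
  by rewrite /powt lerD2r ler_pM2r ?invr_gt0.
- apply: (@le_lt_trans _ _ (dint (fun x => (expR (ln (geoC eta) / t))%:E * Z x))).
    apply: (dint_ae Nnull) => [x|x|x Nx]; first exact: exf_ge0.
      by rewrite mule_ge0// lee_fin expR_ge0.
    have [|GZx ZE] := GZ x; first by move=> h; apply: Nx; right; left.
    rewrite ZE -EFinM lee_fin -expRD ler_expR /powt.
    move: GZx; rewrite GE// lee_fin -[geoC eta]lnK ?posrE ?geoC_gt0// -expRD ler_expR expRK => h.
    rewrite -(ler_pM2l t0).
    have e1 : (t * (g x / t + wt t s x) = g x + t * wt t s x)%R by field; rewrite gt_eqF.
    have e2 : (t * (ln (geoC eta) / t + z x) = ln (geoC eta) + t * z x)%R by field; rewrite gt_eqF.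
    by rewrite e1 e2; lra.
  rewrite dintZ ?expR_gt0//.
  by have [F F0 ->] := ereal_ltyP (dint_ge0 b _) Zfin; rewrite -EFinM ltry.
- move=> P x Px Nx.
  apply: (@le_trans _ _ ((nbrC R n)%:E * (expR (2 * eta + lrho P.1 + g x))%:E)); last first.
    rewrite -EFinM lee_fin -{1}(lnK (x := nbrC R n)) ?posrE ?nbrC_gt0// -expRD ler_expR.
    lra.
  apply: dint_ncube1 => [y|e]; first exact: exf_ge0.
  have Qx : ncube 2 (shift P e) x by exact: ncube1_ncube2.
  apply: (@le_trans _ _ (dint (G \_ (cube (shift P e))))).
    apply: (dint_ae Nnull) => [y|y|y Ny]; first exact: exf_restr_ge0.
      by rewrite patchE; case: ifP => // _; exact: ltW.
    by rewrite !patchE GE.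
  pose T k : V -> \bar R := fun y => (expR (- (2 * eta) * k%:R))%:E * (exf (ph k) \_ (cube (shift P e))) y.
  have T0 k y : 0 <= T k y by rewrite mule_ge0 ?lee_fin ?expR_ge0//; exact: exf_restr_ge0.
  apply: (@le_trans _ _ (dint (fun y => \esum_(k in [set: nat]) T k y))).
    apply: dint_le => y; rewrite patchE; case: ifPn => [yP|_]; last exact: esum_ge0.
    by apply: le_esum => k _; rewrite /T patchE yP.
  apply: le_trans (dint_esum b T0) _.
  have -> : expR (2 * eta + lrho P.1 + g x) = (rho P.1 * expR (2 * eta) * expR (g x))%R.
    by rewrite rhoE -!expRD; congr expR; ring.
  rewrite EFinM -[(expR (g x))%:E]/(exf g x) -GE// -esumZ; last 2 first.
  - by move=> k; exact: Gt0.
  - by rewrite mulr_gt0 ?expR_gt0//; exact: rho_gt0.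
  (* The maximal bound shifts the series by one index, at the price of the ratio [expR (2 * eta)] of
     consecutive coefficients. *)
  apply: (@le_trans _ _ (\esum_(k in [set: nat]) ((rho P.1 * expR (2 * eta))%:E *
      ((expR (- (2 * eta) * k.+1%:R))%:E * exf (ph k.+1) x)))).
    apply: le_esum => k _; rewrite /T dintZ ?expR_gt0//.
    apply: le_trans (lee_wpmul2l _ ((HNk k).2 _ x Qx _)) _.
    - by rewrite lee_fin expR_ge0.
    - by move=> h; apply: Nx; right; right; exists k.
    rewrite /exf -!EFinM lee_fin /= rhoE -!expRD ler_expR -natr1; lra.
  pose a k := (rho P.1 * expR (2 * eta))%:E * ((expR (- (2 * eta) * k%:R))%:E * exf (ph k) x).
  have a0 k : 0 <= a k.
    by apply: mule_ge0 => //; rewrite lee_fin mulr_ge0 ?expR_ge0// ltW// rho_gt0.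
  rewrite -(@esum_image R _ _ _ S a); last by move=> i j _ _ [].
  exact: esum_sub.
Qed.

End majorant.

End maximal.

(** * Extrapolation *)

Section extrapolation_weight.
Variables (R : realType) (n : nat) (b c0 : R).
Local Notation V := 'rV[R]_n.
Local Notation cubeT := (cubeT n).
Local Notation rho := (rho b).
Local Notation lrho := (lrho b).
Local Notation dint := (dint b).
Local Open Scope ereal_scope.

Hypotheses (b0 : (0 < b)%R) (c00 : (0 < c0)%R).
Hypothesis (low : forall P : cubeT, (c0 * rho P.1)%:E <= dint (cst 1 \_ (cube P))).

(* [w g^(1/t - 1/t')] with [w] in [A_(1/t)] and [g] in [A_1]. *)
Definition xweight (t t' : R) (s g : V -> R) (x : V) : R :=
  (((1 - t) * s x - (t'^-1 - t^-1) * g x) / (1 - t'))%R.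

(** In the weight [exp g] has a negative power, and the [A_1] condition bounds it from below by an
    average. The dual weight is a weighted geometric mean of [exp g] and the old dual weight, with
    [al] the ratio of [1 / t - 1] to [1 / t' - 1], so Hölder's inequality applies. *)
Lemma xweight_aw (t t' kap : R) (s g : V -> R) (N : set V) :
  (0 < t')%R -> (t' < t)%R -> (t < 1)%R -> aw b 2 t s -> null b N ->
  (forall P x, ncube 1 P x -> ~ N x ->
     dint (exf g \_ (ncube 1 P)) <= (expR (kap + lrho P.1 + g x))%:E) ->
  aw b 1 t' (xweight t t' s g).
Proof.
move=> t'0 t't t1 [kap1 Hs] N0 gA1.
have t0 : (0 < t)%R by apply: lt_trans t't.
have T0 : (0 < 1 - t)%R by rewrite subr_gt0.
have T'0 : (0 < 1 - t')%R by rewrite subr_gt0 (lt_trans t't).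
exists (t' / t * kap1 + (1 - t' / t) * kap + (1 - t') * ln 2)%R => P.
have [p [q [wp sq pq]]] := Hs P.
have P12 : (ncube 1 P : set V) `<=` ncube 2 P.
  by move=> x Px i; apply: le_trans (Px i) _.
have P01 : (cube P : set V) `<=` ncube 1 P by exact: cube_sub_ncube.
have E0 (u : V -> R) y : 0 <= exf u y by exact: exf_ge0.
have {}wp := le_trans (dint_restr_le b (E0 _) P12) wp.
have {}sq := le_trans (dint_restr_le b (E0 _) P12) sq.
have [z Pz Nz] := cube_nonnull c00 low P N0.
have gfin := le_lt_trans (gA1 P z (P01 z Pz) Nz) (ltry _).
have [G G0 GE] := ereal_ltyP (dint_ge0 b _) gfin.
have {G0}G0 : (0 < G)%R.
  rewrite -lte_fin -GE; apply: lt_le_trans (dint_restr_le b (E0 _) P01).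
  exact: dint_exf_gt0 c00 low g P.
pose l := ln G; have Gl : G = expR l by rewrite lnK.
pose de : R := (t'^-1 - t^-1)%R.
have de0 : (0 <= de)%R by rewrite subr_ge0 lef_pV2 ?posrE// ltW.
have gl x : ncube 1 P x -> ~ N x -> (l - kap - lrho P.1 <= g x)%R.
  move=> Px Nx; have := gA1 P x Px Nx.
  by rewrite GE Gl lee_fin ler_expR; lra.
exists (p - de * (l - kap - lrho P.1))%R.
exists (ln 2 + (t' / (1 - t') * ((1 - t) / t) * q + t' / (1 - t') * de * l))%R; split.
- apply: (@le_trans _ _ (dint (fun x => (expR (- (de * (l - kap - lrho P.1))))%:E *
      (exf (wt t s) \_ (ncube 1 P)) x))).
    apply: (dint_ae N0) => [x|x|x Nx]; first exact: exf_restr_ge0.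
      by rewrite mule_ge0 ?lee_fin ?expR_ge0//; exact: exf_restr_ge0.
    rewrite !patchE; case: ifPn => [/set_mem Px|_]; last by rewrite mule0.
    rewrite /exf -EFinM lee_fin -expRD ler_expR /wt /xweight.
    rewrite [X in (X <= _)%R]mulrC divfK ?gt_eqF// -/de.
    by have := ler_wpM2l de0 (gl x Px Nx); lra.
  rewrite dintZ ?expR_gt0// expRD [X in _ <= X%:E]mulrC EFinM.
  by apply: lee_wpmul2l; [rewrite lee_fin expR_ge0|exact: wp].
- pose al := (t' / (1 - t') * ((1 - t) / t))%R.
  have alE : (1 - al = t' / (1 - t') * de)%R.
    by rewrite /al /de; field; rewrite !gt_eqF.
  have al0 : (0 <= al)%R by rewrite mulr_ge0// divr_ge0// ltW.
  have al1 : (al <= 1)%R.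
    by rewrite -subr_ge0 alE mulr_ge0// divr_ge0// ltW.
  have al01 : (0 <= al <= 1)%R by rewrite al0 al1.
  have gl' : dint (exf g \_ (ncube 1 P)) <= (expR l)%:E by rewrite GE Gl.
  have := dint_hoelder al01 sq gl'.
  have -> : (fun x => al * dl t s x + (1 - al) * g x)%R = dl t' (xweight t t' s g).
    apply/funext => x; rewrite alE /dl /xweight /al /de; field.
    by rewrite !gt_eqF.
  move=> h; apply: le_trans h _.
  by rewrite lee_fin alE -{1}(lnK (x := 2%R)) ?posrE// -expRD.
have tde : (t' * de = 1 - t' / t)%R by rewrite /de; field; rewrite !gt_eqF.
have -> : ((1 - t') * (ln 2 + (t' / (1 - t') * ((1 - t) / t) * q + t' / (1 - t') * de * l)) =
   (1 - t') * ln 2 + t' / t * ((1 - t) * q) + (1 - t' / t) * l)%R.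
  by rewrite -tde; field; rewrite !gt_eqF.
have -> : (t' * (p - de * (l - kap - lrho P.1)) =
    t' * p - (1 - t' / t) * (l - kap - lrho P.1))%R by rewrite -tde; ring.
have tt0 : (0 <= t' / t)%R by rewrite divr_ge0// ltW.
have h := ler_wpM2l tt0 pq.
have e : (t' / t * (t * p + (1 - t) * q) = t' * p + t' / t * ((1 - t) * q))%R.
  by field; rewrite gt_eqF.
by rewrite e in h; lra.
Qed.

End extrapolation_weight.

(** * Truncation of functions with infinite integral *)

Section truncation.
Variables (R : realType) (n : nat) (b L : R).
Local Notation V := 'rV[R]_n.
Local Notation cubeT := (cubeT n).
Local Notation rho := (rho b).
Local Notation dint := (dint b).
Local Notation sub := (subcube R).
Local Open Scope ereal_scope.

Hypotheses (b0 : (0 < b)%R) (omega0 : (0 < omega b)%R) (L0 : (0 < L)%R).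
Hypothesis (lev : forall f : V -> \bar R, \esum_(m in [set: int]) ((expR m%:~R)%:E *
    dint (cst 1 \_ [set x | (expR m%:~R)%:E <= f x])) <= L%:E * dint f).

(* A cover that is cheap compared with cubes of scale [k] covers mostly by
   smaller cubes, so it splits over the cubes of scale [k]. *)
Lemma dint_split_scale (k : int) (E : set V) (A : set 'rV[int]_n) (l : R) :
  (2 * l <= rho k)%R -> dint (cst 1 \_ (E `&` \bigcup_(m in A) cube (k, m))) < l%:E ->
  \esum_(m in A) dint (cst 1 \_ (E `&` cube (k, m))) <= (2 * l)%:E.
Proof.
move=> lk /dint_cover [c [cp Ec cl]].
have cfin : cost b c < +oo by exact: lt_le_trans cl (leey _).
have up (x : V) : upsum c ((k + 1)%R, dy (k + 1) x) <= (2^-1)%:E.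
  have := upsum_le_cost b0 cp (k + 1)%R x => h.
  have r0 := rho_gt0 b (k + 1).
  have {}h : (rho (k + 1))%:E * upsum c ((k + 1)%R, dy (k + 1) x) <= (2^-1 * rho (k + 1))%:E.
    apply: le_trans h _; apply: le_trans (ltW cl) _; rewrite lee_fin.
    have : (rho k <= rho (k + 1))%R by rewrite rho_le// lerDl.
    lra.
  by rewrite -(lee_pmul2l (x := (rho (k + 1))%:E))// -EFinM [X in _ <= X%:E]mulrC.
have rc0 (P : cubeT) : 0 <= (rho P.1)%:E * c P by rewrite mule_ge0// lee_fin ltW// rho_gt0.
apply: (@le_trans _ _ (\esum_(m in A) (2%:E *
    \esum_(P in [set P | sub P (k, m)]) ((rho P.1)%:E * c P)))).
  apply: le_esum => m Am.
  pose c' := (fun P => 2%:E * (c \_ [set P | sub P (k, m)]) P).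
  have c'0 P : 0 <= c' P by rewrite mule_ge0// patchE; case: ifP.
  apply: (@le_trans _ _ (cost b c')).
    apply: dint_le_cost => // x; rewrite patchE; case: ifPn => [|_]; last exact: cov_ge0.
    rewrite inE => -[Ex xm].
    have := Ec x; rewrite patchE mem_set; last by split => //; exists m.
    rewrite /cov (esumID [set j : int | (j <= k)%R])// !setTI.
    have -> : \esum_(i in ~` [set j : int | (j <= k)%R]) c (i, dy i x) =
        upsum c ((k + 1)%R, dy (k + 1) x).
      rewrite (upsumE c); congr esum; apply/seteqP; split => j /=.
        by move=> /negP; rewrite -ltNge lezD1.
      by rewrite lezD1 ltNge => /negP.
    move=> h; have {}h := le_trans h (leeD2l _ (up x)).
    have {}h : (2^-1)%:E <= \esum_(i in [set j : int | (j <= k)%R]) c (i, dy i x).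
      rewrite -(leeD2rE (x := (2^-1)%:E))//; apply: le_trans h; rewrite -EFinD lee_fin; lra.
    rewrite /c' esumZ//; last by move=> j; rewrite patchE; case: ifP.
    apply: (@le_trans _ _ (2%:E * (2^-1)%:E)).
      by rewrite -EFinM lee_fin divff.
    apply: lee_wpmul2l => //; apply: le_trans h _; rewrite esum_mkcond.
    apply: le_esum => j _; case: ifPn => [|_]; last by rewrite patchE; case: ifP.
    rewrite inE /= => jk; rewrite patchE mem_set//=.
    by apply/(@subcubeP R n (j, dy j x) (k, m) x erefl).
  rewrite /cost /c'; under eq_esum => P _ do rewrite muleCA.
  rewrite esumZ//; last by move=> P; rewrite mule_ge0 ?lee_fin ?(ltW (rho_gt0 _ _))// patchE; case: ifP.
  apply: lee_wpmul2l => //; rewrite [leRHS]esum_mkcond; apply: le_esum => P _.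
  by rewrite patchE; case: ifP => //; rewrite mule0.
rewrite esumZ//; last by move=> m; exact: esum_ge0.
rewrite EFinM; apply: lee_wpmul2l => //; apply: le_trans (ltW cl).
rewrite -(@esum_image R _ _ _ (fun m => (k, m) : cubeT)
  (fun Q => \esum_(P in [set P | sub P Q]) ((rho P.1)%:E * c P))); last by move=> i j _ _ [].
have := @esum_antichain R n ((fun m => (k, m) : cubeT) @` A) [set: cubeT]
   (fun P => (rho P.1)%:E * c P) rc0.
under eq_esum => Q _ do rewrite setTI.
apply; move=> S _ _ [m _ <-] [m' _ <-] [_ /= <-] [_ /= <-] //.
Qed.

(** At a scale with [rho k >= 2 (l + 1)], the part of [E] in finitely many cubes has finite
    integral. If this never exceeded [l], [dint_split_scale] would bound the sum over all cubes of
    that scale, and with it the integral of [E]. *)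
Lemma truncate_set (E : set V) (l : R) : (0 <= l)%R -> dint (cst 1 \_ E) = +oo ->
  exists E' : set V, [/\ E' `<=` E, dint (cst 1 \_ E') < +oo & l%:E < dint (cst 1 \_ E')].
Proof.
move=> l0 Ey.
have [k lk] : exists k : int, (2 * (l + 1) <= rho k)%R.
  have LL : (0 < b * ln 2)%R by rewrite mulr_gt0// ln_gt0// ltr1n.
  exists (Num.ceil (ln (2 * (l + 1)) / (b * ln 2))).
  have p0 : (0 < 2 * (l + 1))%R by lra.
  rewrite -[leLHS](lnK (x := 2 * (l + 1))%R) ?posrE// ler_expR -ler_pdivrMr//.
  by have /andP[] := ceil_itv (ln (2 * (l + 1)) / (b * ln 2)).
apply: contrapT => H.
have {}H (A : set 'rV[int]_n) : finite_set A ->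
    \esum_(m in A) dint (cst 1 \_ (E `&` cube (k, m))) <= (2 * (l + 1))%:E.
  move=> Afin; apply: dint_split_scale => //.
  pose E' := E `&` \bigcup_(m in A) cube (k, m).
  rewrite -/E'; apply: (@le_lt_trans _ _ l%:E); last by rewrite lte_fin ltrDl.
  rewrite leNgt; apply/negP => lE'; apply: H; exists E'; split => //; first by move=> x [].
  have E'le x : (cst 1 \_ E') x <= (cst 1 \_ (\bigcup_(m in A) cube (k, m))) x :> \bar R.
    rewrite !patchE; case: ifPn => [|_]; last by case: ifP.
    by rewrite inE => -[_ h]; rewrite mem_set.
  apply: le_lt_trans (dint_le b E'le) _.
  have one0 (x : V) : 0 <= cst (1 : \bar R) x by [].
  apply: le_lt_trans (@dint_bigcup R n b _ A (fun m => cube (k, m)) (cst 1) one0) _.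
  apply: (@le_lt_trans _ _ (\esum_(m in A) (rho k)%:E)).
    by apply: le_esum => m _; exact: dint_cube.
  rewrite esum_fset//; last by move=> i _; rewrite lee_fin ltW// rho_gt0.
  by rewrite fsbig_finite//= sumEFin ltry.
have : dint (cst 1 \_ E) <= (2 * (l + 1))%:E.
  have one0 (x : V) : 0 <= (cst 1 \_ E) x :> \bar R by rewrite patchE; case: ifP.
  apply: (@le_trans _ _ (dint ((cst 1 \_ E) \_ (\bigcup_(m in [set: 'rV[int]_n]) cube (k, m))))).
    by apply: dint_le => x; rewrite [leRHS]patchE mem_set//; exists (dy k x).
  apply: le_trans (dint_bigcup b _ _ one0) _.
  apply: ge_ereal_sup => _ [X [Xfin _] <-].
  apply: le_trans (H X Xfin).
  rewrite -esum_fset//; last by move=> i _; exact: dint_ge0.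
  apply: le_esum => m _; apply: dint_le => x; rewrite !patchE.
  case: ifPn => [|_]; last by case: ifP.
  rewrite inE => xm; case: ifPn => [/set_mem Ex|_]; last by case: ifP.
  by rewrite mem_set.
by rewrite Ey leye_eq.
Qed.

(** If the integral is infinite, either a level set has infinite integral and [truncate_set]
    applies, or the level sum diverges. Then finitely many levels, isolated by cutting [u] below and
    above, exceed [l], and [lev] returns from their sum to the cut function. *)
Lemma truncation (u : V -> \bar R) (l : R) : (forall x, 0 <= u x) -> (0 <= l)%R ->
  l%:E < dint u -> exists u' : V -> \bar R,
  [/\ forall x, 0 <= u' x, forall x, u' x <= u x, dint u' < +oo &
      l%:E < (L + 1)%:E * dint u'].
Proof.
move=> u0 l0 lu.
have L1 : (0 < L + 1)%R by rewrite ltr_wpDl// ltW.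
have one (x : \bar R) : 0 <= x -> x <= (L + 1)%:E * x.
  by move=> x0; rewrite -[leLHS]mul1e lee_wpmul2r// lee_fin lerDr ltW.
have [fin|] := ltP (dint u) +oo.
  exists u; split => //; apply: lt_le_trans lu _; apply: one; exact: dint_ge0.
rewrite leye_eq => /eqP uy.
pose E (m : int) := [set x | (expR m%:~R)%:E <= u x].
have [[m my]|nm] := pselect (exists m, dint (cst 1 \_ (E m)) = +oo).
  have l1 : (0 <= l * expR (- m%:~R))%R by rewrite mulr_ge0 ?expR_ge0.
  have [E' [E'E E'fin lE']] := truncate_set l1 my.
  pose u' := fun x => (expR m%:~R)%:E * (cst 1 \_ E') x : \bar R.
  have D : dint u' = (expR m%:~R)%:E * dint (cst 1 \_ E') by rewrite /u' dintZ// expR_gt0.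
  exists u'; split.
  - by move=> x; rewrite mule_ge0 ?lee_fin ?expR_ge0// patchE; case: ifP.
  - move=> x; rewrite /u' patchE; case: ifPn => [|_]; last by rewrite mule0.
    by rewrite inE => /E'E; rewrite mule1.
  - rewrite D; have [F F0 ->] := ereal_ltyP (dint_ge0 b _) E'fin.
    by rewrite -EFinM ltry.
  - apply: lt_le_trans (one _ (dint_ge0 b _)); rewrite D.
    move: lE'; have [F F0 ->] := ereal_ltyP (dint_ge0 b _) E'fin.
    by rewrite -EFinM !lte_fin expRN ltr_pdivrMr ?expR_gt0// mulrC.
have Efin m : dint (cst 1 \_ (E m)) < +oo.
  by rewrite ltey; apply/eqP => h; apply: nm; exists m.
have := dint_levels b u0; rewrite uy leye_eq => /eqP.
set S := esum _ _ => Sy.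
have {}Sy : S = +oo.
  have S0 : 0 <= S by apply: esum_ge0 => m _; rewrite mule_ge0 ?lee_fin ?expR_ge0// dint_ge0.
  have [//|nS] := eqVneq S +oo.
  have [F F0 FE] := ereal_ltyP S0 (etrans (ltey _) nS).
  by rewrite FE -EFinM in Sy.
have : l%:E < S by rewrite Sy ltry.
move=> /ereal_sup_gt [_ [X [Xfin _] <-] lX].
have [m0 [M HX]] : exists m0 M : int, forall j, X j -> (m0 <= j <= M)%R.
  move: Xfin => /finite_seqP[r ->].
  exists (- \sum_(j <- r) `|j|)%R, (\sum_(j <- r) `|j|)%R => j /= jr.
  rewrite -ler_norml (big_rem _ jr)/= lerDl sumr_ge0//.
pose u' x := if (expR m0%:~R)%:E <= u x then mine (u x) (expR M%:~R)%:E else 0.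
have u'0 x : 0 <= u' x.
  by rewrite /u'; case: ifP => // _; rewrite le_min u0 lee_fin expR_ge0.
have level m : X m -> [set x | (expR m%:~R)%:E <= u' x] = E m.
  move=> /HX /andP[m0m mM]; apply/seteqP; split => x /=; rewrite /E /u' /=.
    case: ifP => _; first by rewrite le_min => /andP[].
    by rewrite lee_fin leNgt expR_gt0.
  move=> mx; rewrite ifT; last by apply: le_trans mx; rewrite lee_fin ler_expR ler_int.
  by rewrite le_min mx lee_fin ler_expR ler_int.
exists u'; split => //.
- move=> x; rewrite /u'; case: ifP => _; last exact: u0.
  by rewrite ge_min lexx.
- apply: (@le_lt_trans _ _ ((expR M%:~R)%:E * dint (cst 1 \_ (E m0)))); last first.
    have [F F0 ->] := ereal_ltyP (dint_ge0 b _) (Efin m0).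
    by rewrite -EFinM ltry.
  rewrite -dintZ ?expR_gt0//; apply: dint_le => x; rewrite /u' patchE /E.
  case: ifPn => h; first by rewrite mem_set// mule1 ge_min lexx orbT.
  by rewrite mule_ge0 ?lee_fin ?expR_ge0//; case: ifP.
- apply: lt_le_trans lX _; apply: (@le_trans _ _ (L%:E * dint u')); last first.
    by rewrite lee_wpmul2r ?dint_ge0// lee_fin lerDl.
  apply: le_trans (lev u'); apply: esum_ge; exists X => //.
  apply: lee_fsum => // m Xm.
  by rewrite level.
Qed.

End truncation.

(** * From the classes [Ap] and [A1] to [aw] and back *)

Section muckenhoupt.
Variables (R : realType) (n : nat) (b : R).
Local Notation V := 'rV[R]_n.
Local Notation cubeT := (cubeT n).
Local Notation rho := (rho b).
Local Notation lrho := (lrho b).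
Local Notation hcontent := (hcontent b).
Local Notation dint := (dint b).
Local Notation ballC := (ballC n b).
Local Open Scope ereal_scope.

Hypotheses (b0 : (0 < b)%R) (omega0 : (0 < omega b)%R).
Hypothesis nondeg : 0 < hcontent (cube (ucube n)).

Let omegaW : (0 <= omega b)%R := ltW omega0.

Definition hc0 : R := fine (hcontent (cube (ucube n))).

Lemma hc0E : hcontent (cube (ucube n)) = hc0%:E.
Proof.
rewrite fineK// ge0_fin_numE ?hcontent_ge0//.
apply: le_lt_trans (hcontent_dint b0 omega0 _) _.
apply: le_lt_trans (lee_wpmul2l _ (dint_cube b _)) _; first by rewrite lee_fin ballC_ge0.
by rewrite -EFinM ltry.
Qed.

Lemma hc0_gt0 : (0 < hc0)%R.
Proof. by rewrite -lte_fin -hc0E. Qed.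

Definition lowC : R := (hc0 / ballC)%R.

Lemma lowC_gt0 : (0 < lowC)%R.
Proof. by rewrite divr_gt0 ?hc0_gt0// ballC_gt0. Qed.

Lemma dint_cube_ge (P : cubeT) : (lowC * rho P.1)%:E <= dint (cst 1 \_ (cube P)).
Proof.
have B0 := ballC_gt0 n omega0.
rewrite -(lee_pmul2l (x := ballC%:E))//.
apply: le_trans (hcontent_dint b0 omega0 _); apply: le_trans (hcontent_scale omega0 P).
by rewrite hc0E -!EFinM lee_fin /lowC mulrA mulrCA divff ?gt_eqF// mulr1 mulrC.
Qed.

Lemma rho_10 (k l : int) : ((2 : R) ^ k < 2 * (5 * 2 ^ l))%R ->
  (rho k <= 10 `^ b * rho l)%R.
Proof.
move=> kl; have l0 := side_gt0 R l; have k0 := side_gt0 R k.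
rewrite -!side_powR -powRM ?(ltW l0)//.
apply: ge0_ler_powR; rewrite ?nnegrE ?(ltW b0) ?(ltW k0)//; last by lra.
by rewrite mulr_ge0// ltW.
Qed.

(** The cube and two layers on either side make five sides. *)
Definition bigQ (P : cubeT) : set V :=
  closed_cube (corner R P - const_mx (2 * 2 ^ P.1)%R) (5 * 2 ^ P.1)%R.

Lemma bigQ_cube P : is_cube (bigQ P).
Proof.
exists (corner R P - const_mx (2 * 2 ^ P.1)%R)%R, (5 * 2 ^ P.1)%R; split => //.
by rewrite mulr_gt0// side_gt0.
Qed.

Lemma dint1_bigQ (P : cubeT) :
  dint (cst 1 \_ (bigQ P)) <= (nbrC R n * 10 `^ b * rho P.1)%:E.
Proof.
have l0 : (0 < 5 * 2 ^ P.1 :> R)%R by rewrite mulr_gt0// side_gt0.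
have [P' /andP[_ PP] QP] := closed_cube_ncube1 (corner R P - const_mx (2 * 2 ^ P.1)%R)%R l0.
have c0 (x : V) : 0 <= cst (1 : \bar R) x by [].
apply: le_trans (dint_restr_le b c0 QP) _.
apply: le_trans (dint1_ncube1 _ _) _; rewrite lee_fin -mulrA.
by apply: ler_wpM2l; [exact: ltW (nbrC_gt0 R n)|exact: rho_10].
Qed.

Lemma ncube2_bigQ (P : cubeT) : ncube 2 P `<=` bigQ P.
Proof. exact: ncube2_closed_cube. Qed.

Definition hcU : R := (ballC * (nbrC R n * 10 `^ b))%R.

Lemma hcU_gt0 : (0 < hcU)%R.
Proof.
by apply: mulr_gt0 (ballC_gt0 n omega0) _; apply: mulr_gt0 (nbrC_gt0 R n) _; exact: powR_gt0.
Qed.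

Lemma hcontent_bigQ (P : cubeT) : exists h : R,
  [/\ (0 < h)%R, hcontent (bigQ P) = h%:E & (h <= hcU * rho P.1)%R].
Proof.
have le : hcontent (bigQ P) <= (hcU * rho P.1)%:E.
  apply: le_trans (hcontent_dint b0 omega0 _) _.
  apply: le_trans (lee_wpmul2l _ (dint1_bigQ P)) _; first by rewrite lee_fin ballC_ge0.
  by rewrite -EFinM lee_fin /hcU !mulrA.
have [h h0 hE] := ereal_ltyP (hcontent_ge0 omegaW _) (le_lt_trans le (ltry _)).
exists h; split => //; last by rewrite -lee_fin -hE.
rewrite -lte_fin -hE; apply: (@lt_le_trans _ _ (hcontent (cube P))).
  apply: lt_le_trans (hcontent_scale omega0 P); rewrite hc0E -EFinM lte_fin.
  by apply: mulr_gt0 (rho_gt0 _ _) hc0_gt0.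
apply: le_hcontent => x Px; apply: ncube2_bigQ; exact: cube_sub_ncube.
Qed.

Lemma hcontent_closed_cube (a : V) (l : R) (P : cubeT) : (0 < l)%R -> (2 ^ P.1 < 2 * l)%R ->
  closed_cube a l `<=` ncube 1 P -> exists h : R,
  hcontent (closed_cube a l) = h%:E /\ (hc0 * rho (- (2 : int)) * rho P.1 <= h)%R.
Proof.
move=> l0 Pl QP.
have fin : hcontent (closed_cube a l) < +oo.
  apply: le_lt_trans (hcontent_dint b0 omega0 _) _.
  have c0 (x : V) : 0 <= cst (1 : \bar R) x by [].
  apply: le_lt_trans (lee_wpmul2l _ (dint_restr_le b c0 QP)) _; first by rewrite lee_fin ballC_ge0.
  apply: le_lt_trans (lee_wpmul2l _ (dint1_ncube1 b _)) _; first by rewrite lee_fin ballC_ge0.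
  by rewrite -EFinM ltry.
have [h h0 hE] := ereal_ltyP (hcontent_ge0 omegaW _) fin.
exists h; split => //; rewrite -lee_fin -hE.
(* Two scales below [P] the side is less than half of [l], so the closed cube contains a whole
   dyadic cube of that scale. *)
have kl : (2 * 2 ^ (P.1 - 2) <= l)%R.
  have -> : (2 : R) ^ (P.1 - 2) = (2 ^ P.1 / 4)%R.
    by rewrite expfzDr// -[(2 ^ (- 2))%R]/((2 ^+ 2)^-1)%R -natrX.
  by lra.
have [m mQ] := closed_cube_cube a kl.
apply: le_trans (le_hcontent b mQ); apply: le_trans (hcontent_scale omega0 _).
rewrite hc0E -EFinM lee_fin /= (_ : rho (P.1 - 2) = rho (- (2 : int)) * rho P.1)%R.
  by rewrite -mulrA mulrC.
by rewrite !rhoE -expRD /lrho; congr expR; rewrite intrD; ring.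
Qed.

Lemma choquet_onE (E : set V) (f : V -> \bar R) : choquet_on b E f = choquet b (f \_ E).
Proof.
congr choquet; apply/funext => x; rewrite patchE indicE.
by case: ifP => _; rewrite ?mule1 ?mule0.
Qed.

Lemma dint_choquet_on (E : set V) (f : V -> \bar R) : (forall x, 0 <= f x) ->
  dint (f \_ E) <= (choqC n b)%:E * choquet_on b E f.
Proof.
move=> f0; rewrite choquet_onE; apply: dint_le_choquet => // x.
by rewrite patchE; case: ifP.
Qed.

Lemma choquet_on_dint (E : set V) (f : V -> \bar R) :
  choquet_on b E f <= ballC%:E * dint (f \_ E).
Proof. by rewrite choquet_onE; exact: choquet_le_dint. Qed.

Lemma dual_weight_exf (p : R) (w : V -> \bar R) (s : V -> R) x : (1 < p)%R ->
  w x = exf (wt p^-1 s) x -> dual_weight p w x = exf (dl p^-1 s) x.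
Proof.
move=> p1 wx; rewrite /dual_weight wx /exf poweR_EFin inver gt_eqF ?powR_gt0 ?expR_gt0//.
rewrite -expRM -expRN; congr ((expR _)%:E); rewrite /wt /dl.
have p0 : p != 0%R by rewrite gt_eqF// (lt_trans _ p1).
have p10 : (p - 1 != 0)%R by rewrite subr_eq0 gt_eqF.
by field; rewrite ?p0 ?p10.
Qed.

Lemma dual_weight_ge0 (p : R) (w : V -> \bar R) x : 0 <= dual_weight p w x.
Proof. by rewrite inve_ge0 poweR_ge0. Qed.

(** Finite integrals over cubes make both [w] and its dual weight finite off a null set, so [w] has
    a real logarithm there. *)
Lemma Ap_aw (p : R) (w : V -> \bar R) : (1 < p)%R -> Ap b p w ->
  exists (s : V -> R) (N : set V), [/\ null b N, aw b 2 p^-1 s &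
    forall x, ~ N x -> w x = exf (wt p^-1 s) x].
Proof.
move=> p1 [w0 wfin [A [A0 HA]]].
have p0 : (0 < p)%R by rewrite (lt_trans _ p1).
pose v := dual_weight p w.
have v0 x : 0 <= v x by exact: dual_weight_ge0.
pose Nw m := [set x | (w \_ (bigQ (0%R : int, m))) x = +oo].
pose Nv m := [set x | (v \_ (bigQ (0%R : int, m))) x = +oo].
have locfin (f : V -> \bar R) P : (forall x, 0 <= f x) -> choquet_on b (bigQ P) f < +oo ->
    dint (f \_ (bigQ P)) < +oo.
  move=> f0 fP; apply: le_lt_trans (dint_choquet_on _ f0) _.
  have [F F0 ->] : exists2 F : R, (0 <= F)%R & choquet_on b (bigQ P) f = F%:E.
    by apply: ereal_ltyP fP; rewrite choquet_onE; exact: choquet_ge0.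
  by rewrite -EFinM ltry.
have f0P (f : V -> \bar R) (E : set V) x : (forall x, 0 <= f x) -> 0 <= (f \_ E) x.
  by move=> f0; rewrite patchE; case: ifP.
pose N := (\bigcup_m Nw m) `|` (\bigcup_m Nv m).
have Nnull : null b N.
  apply: null_setU; apply: null_bigcup => m; apply: null_pinfty.
  - by move=> x; exact: f0P.
  - by apply: locfin => //; have [] := wfin _ (bigQ_cube (0%R : int, m)).
  - by move=> x; exact: f0P.
  - by apply: locfin => //; have [] := wfin _ (bigQ_cube (0%R : int, m)).
have inQ x : bigQ (0%R : int, dy 0 x) x by apply: ncube2_bigQ; exact: cube_sub_ncube.
have T0 : (1 - p^-1 != 0)%R by rewrite subr_eq0 eq_sym lt_eqF// invf_lt1.
pose s x := (ln (fine (w x)) / (1 - p^-1))%R.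
have wE x : ~ N x -> w x = exf (wt p^-1 s) x.
  move=> Nx.
  have wy : w x != +oo.
    by apply/eqP => h; apply: Nx; left; exists (dy 0 x) => //=; rewrite /Nw /= patchE mem_set.
  have wz : w x != 0.
    apply/eqP => h; apply: Nx; right; exists (dy 0 x) => //=; rewrite /Nv /= patchE mem_set//.
    rewrite /v /dual_weight h poweR0r ?inve0//.
    by rewrite invr_eq0 subr_eq0 gt_eqF.
  have [r r0 rE] := ereal_ltyP (w0 x) (etrans (ltey _) wy).
  have rp : (0 < r)%R by rewrite lt_def r0 andbT; apply: contra_neq wz => h; rewrite rE h.
  by rewrite /exf /wt /s rE /= mulrC divfK// lnK.
have vE x : ~ N x -> v x = exf (dl p^-1 s) x by move=> Nx; exact/dual_weight_exf/wE.
exists s, N; split => //.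
exists (p^-1 * ln A + ln hcU + ln (choqC n b))%R => P.
have [h [hp hE hU]] := hcontent_bigQ P.
have C0 := choqC_gt0 n omega0.
have [Xfin Yfin] := wfin _ (bigQ_cube P).
have ch0 f : 0 <= choquet_on b (bigQ P) f by rewrite choquet_onE; exact: choquet_ge0.
have [X X0 XE] := ereal_ltyP (ch0 _) Xfin.
have [Y Y0 YE] := ereal_ltyP (ch0 _) Yfin.
have wQ : dint (exf (wt p^-1 s) \_ (ncube 2 P)) <= (choqC n b * X)%:E.
  rewrite EFinM -XE; apply: le_trans (dint_choquet_on _ w0).
  apply: (dint_ae Nnull) => [x|x|x Nx]; [exact: exf_restr_ge0|exact: f0P|].
  rewrite !patchE; case: ifPn => [/set_mem Px|_]; last by case: ifP.
  by rewrite mem_set ?wE//; exact: ncube2_bigQ.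
have vQ : dint (exf (dl p^-1 s) \_ (ncube 2 P)) <= (choqC n b * Y)%:E.
  rewrite EFinM -YE; apply: le_trans (dint_choquet_on _ v0).
  apply: (dint_ae Nnull) => [x|x|x Nx]; [exact: exf_restr_ge0|exact: f0P|].
  rewrite !patchE; case: ifPn => [/set_mem Px|_]; last by case: ifP.
  by rewrite mem_set ?vE//; exact: ncube2_bigQ.
have pos (u : V -> R) (Z : R) : (0 <= Z)%R -> dint (exf u \_ (ncube 2 P)) <= (choqC n b * Z)%:E ->
    (0 < Z)%R.
  move=> Z0 uZ; rewrite -(pmulr_rgt0 _ C0) -lte_fin; apply: lt_le_trans uZ.
  have PP : (cube P : set V) `<=` ncube 2 P by exact: cube_sub_ncube.
  apply: lt_le_trans (dint_restr_le b (fun x => exf_ge0 u x) PP).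
  exact: dint_exf_gt0 lowC_gt0 dint_cube_ge u P.
have {X0}X0 := pos _ _ X0 wQ; have {Y0}Y0 := pos _ _ Y0 vQ.
exists (ln (choqC n b * X))%R, (ln (choqC n b * Y))%R; split.
- by rewrite lnK// posrE mulr_gt0.
- by rewrite lnK// posrE mulr_gt0.
have := HA _ (bigQ_cube P); rewrite /average XE YE hE inver gt_eqF//.
rewrite -!EFinM lee_fin => h1.
have hX : (0 < h^-1 * X)%R by rewrite mulr_gt0// invr_gt0.
have hY : (0 < h^-1 * Y)%R by rewrite mulr_gt0// invr_gt0.
have {}h1 : (ln X - ln h + (p - 1) * (ln Y - ln h) <= ln A)%R.
  have -> : (ln X - ln h + (p - 1) * (ln Y - ln h) =
      ln (h^-1 * X * (h^-1 * Y) `^ (p - 1)))%R.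
    rewrite lnM ?posrE ?powR_gt0// ln_powR !lnM ?posrE ?invr_gt0// lnV ?posrE//.
    by ring.
  by rewrite ler_ln ?posrE// mulr_gt0// powR_gt0.
have hl : (ln h <= ln hcU + lrho P.1)%R.
  rewrite -[lrho _]expRK -rhoE -lnM ?posrE ?hcU_gt0//; last exact: rho_gt0.
  by rewrite ler_ln ?posrE//; apply: mulr_gt0 hcU_gt0 (rho_gt0 _ _).
rewrite (lnM (x := choqC n b) (y := X)) ?posrE// (lnM (x := choqC n b) (y := Y)) ?posrE//.
have pV0 : (0 <= p^-1)%R by rewrite invr_ge0 ltW.
have {}h1 := ler_wpM2l pV0 h1.
have e : (p^-1 * (ln X - ln h + (p - 1) * (ln Y - ln h)) =
  p^-1 * ln X + (1 - p^-1) * ln Y - ln h)%R by field; rewrite gt_eqF.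
by rewrite e in h1; lra.
Qed.

(** One layer suffices by [closed_cube_ncube1]; the content of the closed cube is bounded below by
    that of a dyadic cube inside it. *)
Lemma aw_Ap (t : R) (s : V -> R) : (0 < t)%R -> (t < 1)%R -> aw b 1 t s ->
  Ap b t^-1 (exf (wt t s)).
Proof.
move=> t0 t1 [kap Hs].
have p1 : (1 < t^-1)%R by rewrite invf_gt1.
have B0 := ballC_gt0 n omega0.
pose w := exf (wt t s).
have vE : dual_weight t^-1 w = exf (dl t s).
  by apply/funext => x; rewrite (@dual_weight_exf _ _ s)// invrK.
have bound (Q : set V) : is_cube Q -> exists P : cubeT, exists p q h X Y : R,
    [/\ choquet_on b Q w = X%:E, choquet_on b Q (dual_weight t^-1 w) = Y%:E,
        hcontent Q = h%:E, (hc0 * rho (- (2 : int)) * rho P.1 <= h)%R &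
    [/\ (0 <= X <= ballC * expR p)%R, (0 <= Y <= ballC * expR q)%R &
     (t * p + (1 - t) * q <= kap + lrho P.1)%R]].
  move=> [a [l [l0 ->]]]; rewrite -/(closed_cube a l).
  have [P /andP[lP Pl] QP] := closed_cube_ncube1 a l0.
  have [p [q [wp sq pq]]] := Hs P.
  have [h [hE hl]] := hcontent_closed_cube l0 Pl QP.
  have Xle (u : V -> R) r : dint (exf u \_ (ncube 1 P)) <= (expR r)%:E ->
      exists2 X : R, (0 <= X <= ballC * expR r)%R & choquet_on b (closed_cube a l) (exf u) = X%:E.
    move=> ur.
    have le : choquet_on b (closed_cube a l) (exf u) <= (ballC * expR r)%:E.
      apply: le_trans (choquet_on_dint _ _) _; rewrite (EFinM ballC); apply: lee_wpmul2l.
        by rewrite lee_fin ltW.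
      by apply: le_trans ur; apply: dint_restr_le => // x; exact: exf_ge0.
    have [X X0 XE] : exists2 X : R, (0 <= X)%R & choquet_on b (closed_cube a l) (exf u) = X%:E.
      apply: ereal_ltyP; last exact: le_lt_trans le (ltry _).
      by rewrite choquet_onE; exact: choquet_ge0.
    by exists X => //; rewrite X0 -lee_fin -XE.
  have [X X0 XE] := Xle _ _ wp; have [Y Y0 YE] := Xle _ _ sq.
  by exists P, p, q, h, X, Y; rewrite vE.
split; first by move=> x; exact: exf_ge0.
  move=> Q /bound [P [p [q [h [X [Y [XE YE _ _ _]]]]]]].
  by rewrite XE YE !ltry.
pose cc := (hc0 * rho (- (2 : int)))%R.
have cc0 : (0 < cc)%R by apply: mulr_gt0 hc0_gt0 (rho_gt0 _ _).
exists (expR (t^-1 * (ln ballC - ln cc + kap)))%R; split; first exact: expR_gt0.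
move=> Q /bound [P [p [q [h [X [Y [XE YE hE hl [/andP[X0 Xp] /andP[Y0 Yq] pq]]]]]]]].
have h0 : (0 < h)%R by apply: lt_le_trans hl; apply: mulr_gt0 cc0 (rho_gt0 _ _).
rewrite /average XE YE hE inver gt_eqF// -!EFinM lee_fin.
have hlog : (ln cc + lrho P.1 <= ln h)%R.
  rewrite -[lrho _]expRK -rhoE -lnM ?posrE//; last exact: rho_gt0.
  by rewrite ler_ln ?posrE//; apply: mulr_gt0 cc0 (rho_gt0 _ _).
have est (Z r : R) : (0 <= Z <= ballC * expR r)%R ->
    (h^-1 * Z <= expR (ln ballC - ln cc - lrho P.1 + r))%R.
  move=> /andP[Z0 Zr]; rewrite mulrC ler_pdivrMr//; apply: le_trans Zr _.
  rewrite -{1}(lnK (x := ballC)) ?posrE// -{1}(lnK (x := h)) ?posrE// -!expRD ler_expR; lra.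
have q0 : (0 <= t^-1 - 1)%R by rewrite subr_ge0 ltW.
apply: (@le_trans _ _ (expR (ln ballC - ln cc - lrho P.1 + p) *
    (expR (ln ballC - ln cc - lrho P.1 + q)) `^ (t^-1 - 1))%R).
  apply: ler_pM.
  - by rewrite mulr_ge0// invr_ge0 ltW.
  - exact: powR_ge0.
  - by apply: est; rewrite X0.
  - apply: ge0_ler_powR => //; rewrite ?nnegrE ?expR_ge0//.
      by rewrite mulr_ge0// invr_ge0 ltW.
    by apply: est; rewrite Y0.
rewrite -expRM -expRD ler_expR.
have tV0 : (0 <= t^-1)%R by rewrite invr_ge0 ltW.
have := ler_wpM2l tV0 pq.
have e : (t^-1 * (t * p + (1 - t) * q) = p + (t^-1 - 1) * q)%R by field; rewrite gt_eqF.
by rewrite e; lra.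
Qed.

(** A cube on which the integral is infinite, or positive, can be enlarged to contain any given
    point [x]; the [A_1] inequality then makes [w x] infinite, or positive. In the remaining case
    averages bound [w] from below, hence the dual weight from above pointwise. *)
Lemma A1_cases (t : R) (w : V -> \bar R) : (0 < t)%R -> (t < 1)%R -> A1 b w ->
  exists N : set V, null b N /\
  [\/ forall x, ~ N x -> w x = 0, forall x, ~ N x -> w x = +oo |
      exists2 s : V -> R, aw b 2 t s & forall x, ~ N x -> w x = exf (wt t s) x].
Proof.
move=> t0 t1 [w0 [K K0 [E /(hcontent_null b0 omega0) E0 HE]]].
have T0 : (0 < 1 - t)%R by rewrite subr_gt0.
have C0 := choqC_gt0 n omega0.
have avg (Q : set V) x : is_cube Q -> Q x -> ~ E x -> average b Q w <= K%:E * w x.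
  move=> Qc Qx Ex; apply: le_trans (HE x Ex); apply: ereal_sup_ubound.
  exists Q => //; congr average; apply/funext => y; exact: gee0_abs.
have big (P : cubeT) (x : V) : exists (Q : set V) (h : R), [/\ is_cube Q, Q x, ncube 2 P `<=` Q,
    (0 < h)%R & hcontent Q = h%:E].
  have [h0 [h0p h0E _]] := hcontent_bigQ P.
  set a := (corner R P - const_mx (2 * 2 ^ P.1))%R.
  pose r := (\sum_i `|x ord0 i - a ord0 i|)%R.
  have r0 : (0 <= r)%R by apply: sumr_ge0.
  have s0 := side_gt0 R P.1.
  have l0 : (0 < 5 * 2 ^ P.1 + 2 * r)%R by apply: ltr_wpDr; [rewrite mulr_ge0|rewrite mulr_gt0].
  pose Q := closed_cube (a - const_mx r)%R (5 * 2 ^ P.1 + 2 * r)%R.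
  have bQ : bigQ P `<=` Q.
    move=> y Py i; have := Py i; rewrite -/a [X in _ -> X]/= !mxE; lra.
  have [P' /andP[_ lP] QP'] := closed_cube_ncube1 (a - const_mx r)%R l0.
  have [h [hE _]] := hcontent_closed_cube l0 lP QP'.
  exists Q, h; split => //.
  - by exists (a - const_mx r)%R, (5 * 2 ^ P.1 + 2 * r)%R.
  - move=> i; have : (`|x ord0 i - a ord0 i| <= r)%R.
      by rewrite /r (bigD1 i)//= lerDl sumr_ge0.
    by rewrite ler_norml !mxE; lra.
  - by apply: subset_trans bQ; exact: ncube2_bigQ.
  - rewrite -lte_fin -hE; apply: lt_le_trans (le_hcontent b bQ).
    by rewrite h0E.
have [[P Py]|nP] := pselect (exists P, dint (w \_ (ncube 2 P)) = +oo).
  exists E; split => //; apply: Or32 => x Ex.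
  have [Q [h [Qc Qx PQ h0 hE]]] := big P x.
  have := avg Q x Qc Qx Ex.
  have wQ : choquet_on b Q w = +oo.
    have : +oo <= (choqC n b)%:E * choquet_on b Q w.
      rewrite -Py; apply: le_trans (dint_choquet_on Q w0).
      exact: dint_restr_le.
    have [//|fin] := eqVneq (choquet_on b Q w) +oo.
    have [F F0 ->] : exists2 F : R, (0 <= F)%R & choquet_on b Q w = F%:E.
      by apply: ereal_ltyP; rewrite ?ltey// choquet_onE; exact: choquet_ge0.
    by rewrite -EFinM leye_eq.
  rewrite /average hE wQ inver gt_eqF// gt0_muley ?lte_fin ?invr_gt0// leye_eq => /eqP Kw.
  have [//|fin] := eqVneq (w x) +oo.
  have [F F0 wF] := ereal_ltyP (w0 x) (etrans (ltey _) fin).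
  by rewrite wF -EFinM in Kw.
have wfin P : dint (w \_ (ncube 2 P)) < +oo.
  by rewrite ltey; apply/eqP => h; apply: nP; exists P.
have [wz|wnz] := eqVneq (dint w) 0.
  exists [set x | w x != 0]; split; first exact/(dint0P b w0).
  by apply: Or31 => x /= /negP; rewrite negbK => /eqP.
have [P0 P0pos] : exists P, 0 < dint (w \_ (ncube 2 P)).
  apply: contrapT => H; move/negP : wnz; apply; apply/eqP/le_anti/andP; split; last exact: dint_ge0.
  apply: (@le_trans _ _ (dint (w \_ (\bigcup_(P in [set: cubeT]) ncube 2 P)))).
    apply: dint_le => x; rewrite patchE mem_set//; exists (0%R : int, dy 0 x) => //.
    exact: cube_sub_ncube.
  apply: le_trans (dint_bigcup b _ _ w0) _; rewrite esum1// => P _.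
  apply/le_anti/andP; split; last exact: dint_ge0.
  by rewrite leNgt; apply/negP => h; apply: H; exists P.
pose N1 := \bigcup_m [set x | (w \_ (ncube 2 (0%R : int, m))) x = +oo].
have f0P (D : set V) x : 0 <= (w \_ D) x by rewrite patchE; case: ifP.
have N1null : null b N1.
  by apply: null_bigcup => m; apply: null_pinfty => // x; exact: f0P.
exists (E `|` N1); split; first exact: null_setU.
have wpos x : ~ (E `|` N1) x -> exists2 r : R, (0 < r)%R & w x = r%:E.
  move=> Nx.
  have wy : w x != +oo.
    apply/eqP => h; apply: Nx; right; exists (dy 0 x) => //=; rewrite patchE mem_set//.
    exact: cube_sub_ncube.
  have [r r0 rE] := ereal_ltyP (w0 x) (etrans (ltey _) wy).
  exists r => //; rewrite lt_def r0 andbT; apply/eqP => rz.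
  have [Q [h [Qc Qx PQ h0 hE]]] := big P0 x.
  have := avg Q x Qc Qx (fun h => Nx (or_introl h)).
  rewrite rE rz mule0 /average hE inver gt_eqF// pmule_rle0 ?lte_fin ?invr_gt0// => wQ.
  move: P0pos; apply/negP; rewrite -leNgt.
  apply: le_trans (dint_restr_le b w0 PQ) _; apply: le_trans (dint_choquet_on Q w0) _.
  by rewrite pmule_rle0 ?lte_fin.
pose s x := (ln (fine (w x)) / (1 - t))%R.
have wE x : ~ (E `|` N1) x -> w x = exf (wt t s) x.
  move=> /wpos [r r0 rE]; rewrite /exf /wt /s rE /= mulrC divfK ?gt_eqF// lnK//.
apply: Or33; exists s => //.
pose c1 := ln (choqC n b * K * hcU)%R.
pose c2 := ln (nbrC R n * 10 `^ b)%R.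
exists (t * c1 + (1 - t) * c2)%R => P.
have NN : null b (E `|` N1) by exact: null_setU.
have wP : dint (exf (wt t s) \_ (ncube 2 P)) = dint (w \_ (ncube 2 P)).
  apply/le_anti/andP; split; apply: (dint_ae NN) => x; rewrite ?f0P ?exf_restr_ge0//.
    by move=> Nx; rewrite !patchE wE.
  by move=> Nx; rewrite !patchE wE.
have [G G0 GE] := ereal_ltyP (dint_ge0 b _) (wfin P).
have {}G0 : (0 < G)%R.
  rewrite -lte_fin -GE -wP.
  have PP : (cube P : set V) `<=` ncube 2 P by exact: cube_sub_ncube.
  apply: lt_le_trans (dint_restr_le b (fun x => exf_ge0 _ x) PP).
  exact: dint_exf_gt0 lowC_gt0 dint_cube_ge _ P.
exists (ln G), (c2 + lrho P.1 - t / (1 - t) * (ln G - c1 - lrho P.1))%R; split.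
- by rewrite wP GE lnK.
- have low x : ncube 2 P x -> ~ (E `|` N1) x -> (ln G - c1 - lrho P.1 <= (1 - t) * s x)%R.
    move=> Px Nx; have [h [h0 hE hU]] := hcontent_bigQ P.
    have := avg _ x (bigQ_cube P) (ncube2_bigQ Px) (fun h => Nx (or_introl h)).
    rewrite /average hE inver gt_eqF// wE// => h1.
    have h2 : choquet_on b (bigQ P) w <= (h * K)%:E * exf (wt t s) x.
      rewrite EFinM -muleA; apply: le_trans (lee_wpmul2l _ h1); last by rewrite lee_fin ltW.
      by rewrite muleA -EFinM divff ?gt_eqF// mul1e.
    have h3 : G%:E <= (choqC n b * (h * K))%:E * exf (wt t s) x.
      rewrite -GE EFinM -muleA; apply: le_trans (lee_wpmul2l _ h2); last by rewrite lee_fin ltW.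
      by apply: le_trans (dint_choquet_on _ w0); apply: dint_restr_le => //; exact: ncube2_bigQ.
    have h4 : (G <= choqC n b * K * hcU * rho P.1 * expR (wt t s x))%R.
      have : (G <= choqC n b * (h * K) * expR (wt t s x))%R by rewrite -lee_fin.
      move=> /le_trans; apply; rewrite ler_wpM2r ?expR_ge0//.
      rewrite -(mulrA _ hcU) -(mulrA (choqC n b)) (mulrC h).
      by apply: ler_wpM2l (ltW C0) _ _ _; exact: ler_wpM2l (ltW K0) _ _ hU.
    have cp : (0 < choqC n b * K * hcU)%R by apply: mulr_gt0 hcU_gt0; apply: mulr_gt0.
    move: h4; rewrite -{1}(lnK (x := G)) ?posrE// -(lnK (x := (choqC n b * K * hcU)%R)) ?posrE//.
    by rewrite -/c1 rhoE -!expRD ler_expR /wt; lra.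
  have cp2 : (0 < nbrC R n * 10 `^ b)%R by apply: mulr_gt0 (nbrC_gt0 R n) (powR_gt0 _ _).
  pose A := (- (t / (1 - t) * (ln G - c1 - lrho P.1)))%R.
  apply: (@le_trans _ _ (dint (fun x => (expR A)%:E * (cst 1 \_ (bigQ P)) x))).
    apply: (dint_ae NN) => [x|x|x Nx]; first exact: exf_restr_ge0.
      by rewrite mule_ge0 ?lee_fin ?expR_ge0// patchE; case: ifP.
    rewrite !patchE; case: ifPn => [/set_mem Px|_]; last first.
      by rewrite mule_ge0 ?lee_fin ?expR_ge0//; case: ifP.
    rewrite mem_set; last exact: ncube2_bigQ.
    rewrite mule1 /exf lee_fin ler_expR /dl /A mulNr lerN2.
    have tt : (0 <= t / (1 - t))%R by rewrite divr_ge0// ltW.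
    have := ler_wpM2l tt (low x Px Nx).
    by rewrite mulrA divfK ?gt_eqF.
  rewrite dintZ ?expR_gt0//; apply: le_trans (lee_wpmul2l _ (dint1_bigQ P)) _.
    by rewrite lee_fin expR_ge0.
  rewrite -EFinM lee_fin -(lnK (x := (nbrC R n * 10 `^ b)%R)) ?posrE// -/c2 rhoE -!expRD ler_expR /A.
  lra.
rewrite mulrBr mulrDr.
have -> : ((1 - t) * (t / (1 - t) * (ln G - c1 - lrho P.1)) = t * (ln G - c1 - lrho P.1))%R.
  by field; rewrite gt_eqF.
lra.
Qed.

End muckenhoupt.

(** * Pointwise estimates of the integrand [|f|^p w] *)

Section power_integrand.
Variables (R : realType) (n : nat) (b : R).
Local Notation V := 'rV[R]_n.
Local Notation dint := (dint b).
Local Open Scope ereal_scope.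

Definition Lp_fun (p : R) (w f : V -> \bar R) (x : V) : \bar R := `|f x| `^ p * w x.

Lemma Lp_fun_ge0 p w f : (forall x, 0 <= w x) -> forall x, 0 <= Lp_fun p w f x.
Proof. by move=> w0 x; rewrite mule_ge0// poweR_ge0. Qed.

Lemma nonneg_ereal_cases (y : \bar R) : 0 <= y ->
  [\/ y = +oo, y = 0 | exists v : R, y = (expR v)%:E].
Proof.
move=> y0; have [->|yy] := eqVneq y +oo; first exact: Or31.
have [r r0 ->] := ereal_ltyP y0 (etrans (ltey _) yy).
have [->|rz] := eqVneq r 0%R; first exact: Or32.
by apply: Or33; exists (ln r); rewrite lnK// posrE lt_def rz.
Qed.

Lemma poweR_expR (v p : R) : (expR v)%:E `^ p = (expR (p * v))%:E.
Proof. by rewrite poweR_EFin -expRM mulrC. Qed.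

(** Hölder's inequality for [|f|^q w1] and [exp c]. It is stated apart from [dint_hoelder] because
    [f] may take the values 0 and [+oo]. *)
Lemma Lp_fun_interp (t q A B : R) (a c : V -> R) (w1 w2 f : V -> \bar R) (N : set V) :
  (0 < t)%R -> (t < 1)%R -> (0 < q)%R -> null b N ->
  (forall x, 0 <= w1 x) -> (forall x, 0 <= w2 x) ->
  (forall x, ~ N x -> w1 x = exf a x) ->
  (forall x, ~ N x -> w2 x = exf (fun x => t * a x + (1 - t) * c x)%R x) ->
  dint (Lp_fun q w1 f) <= (expR A)%:E -> dint (exf c) <= (expR B)%:E ->
  dint (Lp_fun (t * q) w2 f) <= (2 * expR (t * A + (1 - t) * B))%:E.
Proof.
move=> t0 t1 q0 N0 w10 w20 w1E w2E.
apply: (dint_interp N0 (Lp_fun_ge0 _ _ w10) (exf_ge0 c) (Lp_fun_ge0 _ _ w20)) => x Nx.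
have tq : (0 < t * q)%R by rewrite mulr_gt0.
rewrite /Lp_fun w1E// w2E// /exf.
have [->|->|[v ->]] := nonneg_ereal_cases (abse_ge0 (f x)).
- rewrite !poweRyr ?gt_eqF// !gt0_mulye ?lte_fin ?expR_gt0//.
  rewrite (gt0_muley (x := (expR (- A))%:E)) ?lte_fin ?expR_gt0//.
  by rewrite -EFinM addye// gt0_muley ?lte_fin ?expR_gt0// leey.
- rewrite !poweR0r ?gt_eqF// !mul0e mule0 add0e -!EFinM lee_fin.
  by rewrite !mulr_ge0 ?expR_ge0.
- rewrite !poweR_expR -!EFinM lee_fin -!expRD.
  apply: le_trans (ler_wpM2l (expR_ge0 _) (expR_interp _ _ (t := t) _)); last first.
    by rewrite (ltW t0) (ltW t1).
  by rewrite -expRD ler_expR; lra.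
Qed.

(** The hypothesis amounts to [y <= exp (g + k / p)], and the factor [exp (- (q - p) g)] absorbs the
    surplus power of [y]. *)
Lemma Lp_fun_raise (p q k a g : R) (y : \bar R) : (0 < p)%R -> (p < q)%R -> 0 <= y ->
  y `^ p * (expR a)%:E <= (expR (p * g + a + k))%:E ->
  y `^ q * (expR (a - (q - p) * g))%:E <=
    (expR ((q - p) * (k / p)))%:E * (y `^ p * (expR a)%:E).
Proof.
move=> p0 pq y0; have q0 : (0 < q)%R by exact: lt_trans pq.
have [->|->|[v ->]] := nonneg_ereal_cases y0.
- by rewrite poweRyr ?gt_eqF// gt0_mulye ?lte_fin ?expR_gt0// leye_eq.
- by rewrite !poweR0r ?gt_eqF// !mul0e mule0.
rewrite !poweR_expR -!EFinM !lee_fin -!expRD !ler_expR => h.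
have vg : (v <= g + k / p)%R.
  rewrite -(ler_pM2l p0) mulrDr mulrCA divff ?gt_eqF// mulr1; lra.
have qp : (0 <= q - p)%R by rewrite subr_ge0 ltW.
have := ler_wpM2l qp vg; lra.
Qed.

(** A number below two others is below their weighted geometric mean. *)
Lemma Lp_fun_geometric_mean (t q k a c : R) (y u : \bar R) : (0 < t)%R -> (t < 1)%R ->
  (0 < q)%R -> 0 <= y -> u <= y `^ q * (expR a)%:E -> u <= (expR (k + c))%:E ->
  u <= (expR ((1 - t) * k))%:E * (y `^ (t * q) * (expR (t * a + (1 - t) * c))%:E).
Proof.
move=> t0 t1 q0 y0; have tq : (0 < t * q)%R by rewrite mulr_gt0.
have [->|->|[v ->]] := nonneg_ereal_cases y0.
- move=> _ _; rewrite poweRyr ?gt_eqF// gt0_mulye ?lte_fin ?expR_gt0//.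
  by rewrite gt0_muley ?lte_fin ?expR_gt0// leey.
- by rewrite !poweR0r ?gt_eqF// !mul0e mule0.
rewrite !poweR_expR -!EFinM -!expRD => h1 h2.
have [h|h] := leP (q * v + a)%R (k + c)%R.
  apply: le_trans h1 _; rewrite lee_fin ler_expR.
  have T0 : (0 <= 1 - t)%R by rewrite subr_ge0 ltW.
  by have := ler_wpM2l T0 h; lra.
apply: le_trans h2 _; rewrite lee_fin ler_expR.
by have := ler_wpM2l (ltW t0) (ltW h); lra.
Qed.

End power_integrand.

(** * Boundedness of the operator in terms of [dint] *)

Section extrapolation.
Variables (R : realType) (n : nat) (b : R).
Local Notation V := 'rV[R]_n.
Local Notation dint := (dint b).
Local Notation choquet := (choquet b).
Local Open Scope ereal_scope.

Hypotheses (b0 : (0 < b)%R) (omega0 : (0 < omega b)%R).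

Lemma bounded_on_LpI (p : R) (w : V -> \bar R) (T : (V -> \bar R) -> (V -> \bar R)) (K : R) :
  (0 < p)%R -> (forall x, 0 <= w x) -> (0 <= K)%R ->
  (forall f, quasi_continuous b f -> dint (Lp_fun p w f) < +oo ->
     dint (Lp_fun p w (T f)) <= K%:E * dint (Lp_fun p w f)) ->
  bounded_on_Lp b p w T.
Proof.
move=> p0 w0 K0 HT; have pV0 : (0 < p^-1)%R by rewrite invr_gt0.
have B0 := ballC_gt0 n omega0; have C0 := choqC_gt0 n omega0.
pose k := (ballC n b * (K * choqC n b))%R.
have k0 : (0 <= k)%R by exact: mulr_ge0 (ltW B0) (mulr_ge0 K0 (ltW C0)).
exists (k `^ p^-1)%R; split=> [|f [qf fin]]; first exact: powR_ge0.
have fin' : choquet (Lp_fun p w f) < +oo by apply: lty_poweRy fin; rewrite gt_eqF.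
have F0 g : forall x, 0 <= Lp_fun p w g x by exact: Lp_fun_ge0.
have d1 := dint_le_choquet b0 omega0 (F0 f).
have dfin : dint (Lp_fun p w f) < +oo.
  apply: le_lt_trans d1 _; have [r r0 ->] := ereal_ltyP (choquet_ge0 (ltW omega0) _) fin'.
  by rewrite -EFinM ltry.
have le : choquet (Lp_fun p w (T f)) <= k%:E * choquet (Lp_fun p w f).
  apply: le_trans (choquet_le_dint b0 (ltW omega0) _) _.
  rewrite (EFinM (ballC n b)) -muleA; apply: lee_wpmul2l; first by rewrite lee_fin ltW.
  apply: le_trans (HT f qf dfin) _; rewrite (EFinM K) -muleA.
  by apply: lee_wpmul2l.
rewrite /Lp_norm -/(Lp_fun p w f) -/(Lp_fun p w (T f)) -poweR_EFin -poweRM ?lee_fin//; last first.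
  by apply: choquet_ge0; exact: ltW.
apply: gt0_ler_poweR le; first exact: ltW.
- by rewrite in_itv/= leey andbT; apply: choquet_ge0; exact: ltW.
- rewrite in_itv/= leey andbT; apply: mule_ge0; rewrite ?lee_fin//.
  by apply: choquet_ge0; exact: ltW.
Qed.

Lemma bounded_on_LpE (p : R) (w : V -> \bar R) (T : (V -> \bar R) -> (V -> \bar R)) :
  (0 < p)%R -> (forall x, 0 <= w x) -> bounded_on_Lp b p w T ->
  exists2 K : R, (0 < K)%R & forall f, quasi_continuous b f ->
    dint (Lp_fun p w f) < +oo -> dint (Lp_fun p w (T f)) <= K%:E * dint (Lp_fun p w f).
Proof.
move=> p0 w0 [K [K0 HT]].
have B0 := ballC_gt0 n omega0; have C0 := choqC_gt0 n omega0.
pose k := (choqC n b * (K `^ p * ballC n b))%R.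
have k0 : (0 <= k)%R by exact: mulr_ge0 (ltW C0) (mulr_ge0 (powR_ge0 _ _) (ltW B0)).
exists (k + 1)%R => [|f qf dfin]; first exact: ltr_wpDl.
have F0 g : forall x, 0 <= Lp_fun p w g x by exact: Lp_fun_ge0.
have ch0 g : 0 <= choquet g by apply: choquet_ge0; exact: ltW.
have cd := choquet_le_dint b0 (ltW omega0) (Lp_fun p w f).
have cfin : choquet (Lp_fun p w f) < +oo.
  apply: le_lt_trans cd _; have [r r0 ->] := ereal_ltyP (dint_ge0 b _) dfin.
  by rewrite -EFinM ltry.
have lpf : Lp b p w f by split=> //; exact: poweR_lty.
have pp (x : \bar R) : 0 <= x -> (x `^ p^-1) `^ p = x.
  by move=> x0; rewrite -poweRrM mulVf ?gt_eqF// poweRe1.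
have : choquet (Lp_fun p w (T f)) <= (K `^ p)%:E * choquet (Lp_fun p w f).
  rewrite -[leLHS]pp// -[X in _ <= _ * X]pp// -poweR_EFin -poweRM ?poweR_ge0//.
  apply: gt0_ler_poweR (HT f lpf); first exact: ltW.
  - by rewrite in_itv/= leey andbT poweR_ge0.
  - by rewrite in_itv/= leey andbT mule_ge0 ?lee_fin// poweR_ge0.
move=> le; apply: le_trans (dint_le_choquet b0 omega0 (F0 (T f))) _.
apply: (@le_trans _ _ (k%:E * dint (Lp_fun p w f))); last first.
  by apply: lee_wpmul2r; rewrite ?dint_ge0// lee_fin lerDl.
rewrite (EFinM (choqC n b)) -muleA; apply: lee_wpmul2l; first by rewrite lee_fin ltW.
apply: le_trans le _; rewrite (EFinM (K `^ p)) -muleA.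
by apply: lee_wpmul2l; rewrite ?lee_fin ?powR_ge0.
Qed.

End extrapolation.

(** * Extrapolation to exponents below [p0] *)

Section extrapolation_cases.
Variables (R : realType) (n : nat) (b : R).
Local Notation V := 'rV[R]_n.
Local Notation cubeT := (cubeT n).
Local Notation dint := (dint b).
Local Notation hcontent := (hcontent b).
Local Open Scope ereal_scope.

Hypotheses (b0 : (0 < b)%R) (n0 : (0 < n)%N) (omega0 : (0 < omega b)%R).
Hypothesis nondeg : 0 < hcontent (cube (ucube n)).

Variable T : (V -> \bar R) -> (V -> \bar R).

Lemma not_bounded_on_Lp (p : R) (w : V -> \bar R) (c : nat -> R) :
  (0 < p)%R -> (forall x, 0 <= w x) -> (forall k, 0 <= c k)%R -> ~ bounded_on_Lp b p w T ->
  exists (f : nat -> V -> \bar R) (I : nat -> R), forall k,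
    [/\ quasi_continuous b (f k), (0 <= I k)%R, dint (Lp_fun p w (f k)) = (I k)%:E &
        (c k * I k)%:E < dint (Lp_fun p w (T (f k)))].
Proof.
move=> p0 w0 c0 NB.
have /choice [fI HfI] : forall k, exists fI : (V -> \bar R) * R,
    [/\ quasi_continuous b fI.1, (0 <= fI.2)%R, dint (Lp_fun p w fI.1) = fI.2%:E &
        (c k * fI.2)%:E < dint (Lp_fun p w (T fI.1))].
  move=> k; apply: contrapT => H; apply: NB.
  apply: (bounded_on_LpI b0 omega0 p0 w0 (c0 k)) => f qf fin.
  have [I I0 IE] := ereal_ltyP (dint_ge0 b _) fin.
  rewrite leNgt; apply/negP => h; apply: H; exists (f, I); split => //=.
  by rewrite EFinM -IE.
by exists (fun k => (fI k).1), (fun k => (fI k).2).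
Qed.

Lemma dint_exp_series (u : nat -> V -> \bar R) : (forall k x, 0 <= u k x) ->
  (forall k, dint (u k) <= (expR (- k%:R))%:E) ->
  dint (fun x => \esum_(k in [set: nat]) u k x) < +oo.
Proof.
move=> u0 uk; apply: le_lt_trans (dint_esum b u0) _.
apply: (@le_lt_trans _ _ (\esum_(k in [set: nat]) ((expR (-1)) ^+ k)%:E)).
  apply: le_esum => k _; apply: le_trans (uk k) _.
  by rewrite -expRM_natl mulrN1.
apply: le_lt_trans (esum_geometric _) (ltry _).
by rewrite expR_ge0 expR_lt1 oppr_lt0 ltr01.
Qed.

Lemma exp_sequence_unbounded (a C : R) : (0 < a)%R -> exists k : nat, (C < expR (a * k%:R))%R.
Proof.
move=> a0; exists (Num.truncn (C / a)).+1.
have h : (C / a < (Num.truncn (C / a)).+1%:R)%R by exact: truncnS_gt.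
apply: (@lt_trans _ _ (a * (Num.truncn (C / a)).+1%:R)%R); first by rewrite mulrC -ltr_pdivrMr.
by apply: lt_le_trans (expR_ge1Dx _); rewrite ltrDr ltr01.
Qed.

(** The majorant gives [|f_k| <= exp (- al k / p) exp g], so [f_k] belongs to [L^p0(W)] for
    [W = w exp (- (p0 - p) g)]. The bound of [T] there returns to [L^p(w)] by Hölder's inequality
    with [exp (p g) w]. It grows like [exp ((1 - th) k)], slower than the [exp k] built into the
    choice of [f_k]. *)
Lemma extrapolate_down (p p0 : R) (w : V -> \bar R) (s : V -> R) (N : set V) :
  (1 < p)%R -> (p < p0)%R -> (forall v, Ap b p0 v -> bounded_on_Lp b p0 v T) ->
  (forall x, 0 <= w x) -> aw b 2 p^-1 s -> null b N ->
  (forall x, ~ N x -> w x = exf (wt p^-1 s) x) -> bounded_on_Lp b p w T.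
Proof.
move=> p1 pp0 hT w0 sA N0 wE; apply: contrapT => NB.
have pp : (0 < p)%R by exact: lt_trans p1.
have p01 : (1 < p0)%R by exact: lt_trans pp0.
have p0p : (0 < p0)%R by exact: lt_trans pp0.
have t0 : (0 < p^-1)%R by rewrite invr_gt0.
have t1 : (p^-1 < 1)%R by rewrite invf_lt1.
have t'0 : (0 < p0^-1)%R by rewrite invr_gt0.
have t't : (p0^-1 < p^-1)%R by rewrite ltf_pV2.
have t'1 : (p0^-1 < 1)%R by rewrite invf_lt1.
pose th := (p / p0)%R.
have th0 : (0 < th)%R by rewrite divr_gt0.
have th1 : (th < 1)%R by rewrite ltr_pdivrMr// mul1r.
have [f [I HfI]] := not_bounded_on_Lp pp w0 (fun k : nat => expR_ge0 k%:R) NB.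
(* Normalises the integral of [u k] to [exp (- k)]; if [I k] is 0, any factor serves. *)
pose al k : R := if I k == 0%R then 0%R else (- k%:R - ln (I k))%R.
have F0 v g : (forall x : V, 0 <= v x) -> forall x, 0 <= Lp_fun p v g x by exact: Lp_fun_ge0.
pose u k x := (expR (al k))%:E * Lp_fun p w (f k) x.
have u0 k x : 0 <= u k x by rewrite mule_ge0 ?lee_fin ?expR_ge0//; exact: F0.
have uI k : dint (u k) <= (expR (- k%:R))%:E.
  have [_ I0 IE _] := HfI k.
  rewrite dintZ ?expR_gt0// IE /al -EFinM lee_fin; case: eqVneq => [->|Iz].
    by rewrite mulr0 expR_ge0.
  by rewrite expRD expRN lnK ?posrE ?lt_def ?Iz// divfK.
have [g [kap [N1 [N10 Ug [B0 gA1]]]]] : exists (g : V -> R) (kap : R) (N1 : set V),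
  [/\ null b N1, forall x, ~ N1 x -> \esum_(k in [set: nat]) u k x <= exf (powt p^-1 s g) x &
  (exists B : R, dint (exf (powt p^-1 s g)) <= (expR B)%:E) /\
  forall (P : cubeT) x, ncube 1 P x -> ~ N1 x ->
    dint (exf g \_ (ncube 1 P)) <= (expR (kap + lrho b P.1 + g x))%:E].
  have [g [kap [N1 [N10 Ug fin gA1]]]] := a1_majorant b0 (lowC_gt0 b0 omega0 nondeg) n0
    (levC_gt0 n omega0) (dint_cube_ge b0 omega0) (levels_dint b0 omega0) t0 t1 sA
    (fun x => esum_ge0 (fun k _ => u0 k x)) (dint_exp_series u0 uI).
  exists g, kap, N1; split => //; split => //.
  have [B B0 ->] := ereal_ltyP (dint_ge0 b _) fin.
  by exists B; rewrite lee_fin; apply: le_trans (expR_ge1Dx _); rewrite lerDr ler01.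
have [B {}B0] := B0.
pose W := exf (fun x => wt p^-1 s x - (p0 - p) * g x)%R.
have W0 x : 0 <= W x by exact: exf_ge0.
have WA : Ap b p0 W.
  rewrite -[p0]invrK; have -> : W = exf (wt p0^-1 (xweight p^-1 p0^-1 s g)).
    apply/funext => x; rewrite /W /exf; congr ((expR _)%:E).
    by rewrite /wt /xweight !invrK [RHS]mulrC divfK// subr_eq0 eq_sym lt_eqF.
  apply: (aw_Ap b0 omega0 nondeg) => //.
  exact (xweight_aw (lowC_gt0 b0 omega0 nondeg) (dint_cube_ge b0 omega0) t'0 t't t1 sA N10 gA1).
have [K K0 HK] := bounded_on_LpE b0 omega0 p0p W0 (hT _ WA).
have NN : null b (N `|` N1) by exact: null_setU.
have fW k : dint (Lp_fun p0 W (f k)) <= (expR ((p0 - p) * (- al k / p)) * I k)%:E.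
  have [_ _ IE _] := HfI k.
  rewrite EFinM -IE -dintZ ?expR_gt0//.
  apply: (dint_ae NN) => [x|x|x Nx]; first exact: Lp_fun_ge0.
    by rewrite mule_ge0 ?lee_fin ?expR_ge0//; exact: F0.
  have wx := wE x (fun h => Nx (or_introl h)).
  have uk : u k x <= exf (powt p^-1 s g) x.
    apply: le_trans (Ug x (fun h => Nx (or_intror h))).
    exact: (esum_le_term (a := fun j => u j x)).
  rewrite /Lp_fun wx; apply: Lp_fun_raise => //.
  rewrite -(lee_pmul2l (x := (expR (al k))%:E)) ?lte_fin ?expR_gt0// -EFinM -expRD.
  move: uk; rewrite /u /Lp_fun wx /exf /powt invrK => uk; apply: le_trans uk _.
  by rewrite lee_fin ler_expR; lra.
have TfW k (A : R) : (K * (expR ((p0 - p) * (- al k / p)) * I k) <= expR A)%R ->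
    dint (Lp_fun p w (T (f k))) <= (2 * expR (th * A + (1 - th) * B))%:E.
  move=> KA; have [qf _ _ _] := HfI k.
  have -> : p = (th * p0)%R by rewrite divfK ?gt_eqF.
  apply: (Lp_fun_interp th0 th1 p0p NN W0 w0
    (a := fun x => (wt p^-1 s x - (p0 - p) * g x)%R) (c := powt p^-1 s g)) => //.
    move=> x Nx; rewrite wE; last by move=> h; apply: Nx; left.
    rewrite /exf; congr ((expR _)%:E); rewrite /powt invrK /th.
    by field; rewrite gt_eqF.
  apply: le_trans (HK _ qf (le_lt_trans (fW k) (ltry _))) _.
  apply: le_trans (lee_wpmul2l _ (fW k)) _; first by rewrite lee_fin ltW.
  by rewrite -EFinM lee_fin.
pose C := (2 * expR (th * ln K + (1 - th) * B))%R.
have [k Ck] := exp_sequence_unbounded C th0.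
have [qf I0 IE Tf] := HfI k.
(* If [I k] is 0, then [A] in [TfW] is arbitrary, and the integral for [T (f k)] is 0 as well. *)
have [Iz|Iz] := eqVneq (I k) 0%R.
  move: Tf; rewrite Iz mulr0 ltNge; apply/negP; rewrite negbK.
  rewrite -[leRHS](mule0 (2 * expR ((1 - th) * B))%:E); apply: le_of_exp => //.
    by rewrite mulr_gt0// expR_gt0.
  move=> x _; apply: le_trans (TfW k (x / th)%R _) _.
    by rewrite Iz !mulr0 expR_ge0.
  by rewrite lee_fin -mulrA -expRD ler_wpM2l// ler_expR mulrC divfK ?gt_eqF//; lra.
have {I0}I0 : (0 < I k)%R by rewrite lt_def Iz.
have alE : al k = (- k%:R - ln (I k))%R by rewrite /al (negPf Iz).
have := lt_le_trans Tf (TfW k (ln K + (p0 - p) * (- al k / p) + ln (I k))%R _).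
move=> /(_ _)/wrap[].
  rewrite !expRD !lnK ?posrE//; last by rewrite -mulrA.
rewrite lte_fin; apply/negP; rewrite -leNgt.
have -> : (th * (ln K + (p0 - p) * (- al k / p) + ln (I k)) + (1 - th) * B =
    (th * ln K + (1 - th) * B) + (1 - th) * k%:R + ln (I k))%R.
  by rewrite alE /th; field; rewrite !gt_eqF.
rewrite expRD lnK ?posrE// mulrA ler_wpM2r ?(ltW I0)// expRD mulrA -/C.
have {2}-> : k%:R = (th * k%:R + (1 - th) * k%:R)%R :> R by ring.
by rewrite [leRHS]expRD ler_wpM2r ?expR_ge0// ltW.
Qed.

End extrapolation_cases.

(** * Extrapolation to exponents above [p0] *)

Section extrapolation_up.
Variables (R : realType) (n : nat) (b : R).
Local Notation V := 'rV[R]_n.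
Local Notation dint := (dint b).
Local Notation hcontent := (hcontent b).
Local Open Scope ereal_scope.

Hypotheses (b0 : (0 < b)%R) (n0 : (0 < n)%N) (omega0 : (0 < omega b)%R).
Hypothesis nondeg : 0 < hcontent (cube (ucube n)).

Variable T : (V -> \bar R) -> (V -> \bar R).

(** The majorant [exp c] is taken with respect to the dual weight and [W = w^th (exp c)^(1-th)].
    Hölder's inequality carries [f_k] from [L^p(w)] to [L^p0(W)]. For the return, the truncation
    lies below [|T f_k|^p w] and below a multiple of [exp c], hence below their geometric mean. Its
    integral [exp (d k)] then occurs on both sides and is absorbed, which requires it to be
    finite. *)
Lemma extrapolate_up (p p0 : R) (w : V -> \bar R) (s : V -> R) (N : set V) :
  (1 < p0)%R -> (p0 < p)%R -> (forall v, Ap b p0 v -> bounded_on_Lp b p0 v T) ->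
  (forall x, 0 <= w x) -> aw b 2 p^-1 s -> null b N ->
  (forall x, ~ N x -> w x = exf (wt p^-1 s) x) -> bounded_on_Lp b p w T.
Proof.
move=> p01 p0p hT w0 sA N0 wE; apply: contrapT => NB.
have p1 : (1 < p)%R by exact: lt_trans p0p.
have pp : (0 < p)%R by exact: lt_trans p1.
have p00 : (0 < p0)%R by exact: lt_trans p01.
pose t := p^-1%R; pose t' := p0^-1%R.
have t0 : (0 < t)%R by rewrite invr_gt0.
have t1 : (t < 1)%R by rewrite invf_lt1.
have t'0 : (0 < t')%R by rewrite invr_gt0.
have tt' : (t < t')%R by rewrite ltf_pV2.
have t'1 : (t' < 1)%R by rewrite invf_lt1.
pose th := (p0 / p)%R.
have th0 : (0 < th)%R by rewrite divr_gt0.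
have th1 : (th < 1)%R by rewrite ltr_pdivrMr// mul1r.
have thE : th = (t / t')%R by rewrite /th /t /t' invrK mulrC.
(* The absorption of [d k] loses [exp (k (1 - th) / th)], so the rate [k / th] leaves a gap of
   [exp k]. *)
have [f [I HfI]] := not_bounded_on_Lp b0 omega0 pp w0 (fun k : nat => expR_ge0 (k%:R / th)%R) NB.
have F0 g : forall x, 0 <= Lp_fun p w g x by exact: Lp_fun_ge0.
pose L := levC n b; have L0 : (0 < L)%R := levC_gt0 n omega0.
have /choice [uD HuD] : forall k, exists uD : (V -> \bar R) * R,
    [/\ forall x, 0 <= uD.1 x, forall x, uD.1 x <= Lp_fun p w (T (f k)) x,
        dint uD.1 = (expR uD.2)%:E & (expR (k%:R / th) * I k < (L + 1) * expR uD.2)%R].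
  move=> k; have [_ I0 _ Tf] := HfI k.
  have l0 : (0 <= expR (k%:R / th) * I k)%R by rewrite mulr_ge0// expR_ge0.
  have [u [u0 uT ufin lu]] := truncation b0 L0 (levels_dint b0 omega0) (F0 _) l0 Tf.
  have [D D0 DE] := ereal_ltyP (dint_ge0 b _) ufin.
  rewrite DE -EFinM lte_fin in lu.
  have Dp : (0 < D)%R.
    by rewrite -(pmulr_rgt0 _ (x := L + 1)); [exact: le_lt_trans lu|rewrite addr_gt0].
  by exists (u, ln D); split=> //=; rewrite lnK ?posrE.
pose d k := (uD k).2.
pose u k x := (expR (- (k%:R + d k)))%:E * (uD k).1 x.
have u0 k x : 0 <= u k x.
  by have [h _ _ _] := HuD k; rewrite mule_ge0 ?lee_fin ?expR_ge0.
have uI k : dint (u k) <= (expR (- k%:R))%:E.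
  have [_ _ DE _] := HuD k.
  by rewrite dintZ ?expR_gt0// DE -/(d k) -EFinM -expRD lee_fin ler_expR; lra.
have T0 : (0 < 1 - t)%R by rewrite subr_gt0.
have T'0 : (0 < 1 - t')%R by rewrite subr_gt0.
have T1 : (1 - t < 1)%R by rewrite gtrBl.
have T't : (1 - t' < 1 - t)%R by rewrite ltrD2l ltrN2.
have [g [kap [N1 [N10 Ug gfin gA1]]]] := a1_majorant b0 (lowC_gt0 b0 omega0 nondeg) n0
    (levC_gt0 n omega0) (dint_cube_ge b0 omega0) (levels_dint b0 omega0) T0 T1 (aw_sym sA)
    (fun x => esum_ge0 (fun k _ => u0 k x)) (dint_exp_series u0 uI).
pose c x := (g x / (1 - t) - t * s x)%R.
have cE : exf (powt (1 - t) (fun x => - s x)%R g) = exf c.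
  by apply/funext => x; rewrite /exf; congr ((expR _)%:E); rewrite /powt /c /wt; ring.
rewrite cE in Ug gfin.
have [B B0] : exists B : R, dint (exf c) <= (expR B)%:E.
  have [B B0 ->] := ereal_ltyP (dint_ge0 b _) gfin.
  by exists B; rewrite lee_fin; apply: le_trans (expR_ge1Dx _); rewrite lerDr ler01.
pose a := wt t s.
pose W := exf (fun x => th * a x + (1 - th) * c x)%R.
have W0 x : 0 <= W x by exact: exf_ge0.
(* The dual of [W] is the extrapolated weight for the dual of [w], whose exponents satisfy
   [1 - t' < 1 - t]; [aw_sym] goes back. *)
have WA : Ap b p0 W.
  have := xweight_aw (lowC_gt0 b0 omega0 nondeg) (dint_cube_ge b0 omega0) T'0 T't T1
    (aw_sym sA) N10 gA1.
  move=> /aw_sym; rewrite opprB addrC subrK => /(aw_Ap b0 omega0 nondeg t'0 t'1).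
  rewrite invrK; congr (Ap b p0 _).
  apply/funext => x; rewrite /W /exf; congr ((expR _)%:E).
  rewrite /wt /xweight thE /a /c /wt.
  by field; rewrite !gt_eqF// opprB addrC subrK.
have [K K0 HK] := bounded_on_LpE b0 omega0 p00 W0 (hT _ WA).
have NN : null b (N `|` N1) by exact: null_setU.
have p0E : p0 = (th * p)%R by rewrite divfK ?gt_eqF.
have fW k A : (I k <= expR A)%R ->
    dint (Lp_fun p0 W (f k)) <= (2 * expR (th * A + (1 - th) * B))%:E.
  move=> IA; have [_ _ IE _] := HfI k; rewrite p0E.
  apply: (Lp_fun_interp th0 th1 pp N0 w0 W0 (a := a) (c := c)) => //.
  by rewrite IE lee_fin.
have uW k : dint (uD k).1 <= (expR ((1 - th) * (k%:R + d k)))%:E * dint (Lp_fun p0 W (T (f k))).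
  have [v0 vT _ _] := HuD k.
  rewrite -dintZ ?expR_gt0//; apply: (dint_ae NN) => [//|x|x Nx].
    by rewrite mule_ge0 ?lee_fin ?expR_ge0//; exact: Lp_fun_ge0.
  have wx := wE x (fun h => Nx (or_introl h)).
  rewrite /Lp_fun p0E /W; apply: (Lp_fun_geometric_mean th0 th1 pp) => //.
    by have := vT x; rewrite /Lp_fun wx.
  have uk : u k x <= exf c x.
    apply: le_trans (Ug x (fun h => Nx (or_intror h))).
    exact: (esum_le_term (a := fun j => u j x)).
  have := lee_wpmul2l (_ : 0 <= (expR (k%:R + d k))%:E) uk.
  rewrite lee_fin expR_ge0 => /(_ isT); rewrite /u muleA -EFinM -expRD subrr expR0 mul1e.
  by rewrite /exf -EFinM -expRD.
(* Moving [(1 - th) d k] to the left leaves [th d k]; hence the division by [th]. *)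
pose C := (((1 - th) * B + ln (2 * K)) / th)%R.
have dI k : (expR (d k))%:E <= (expR (C + k%:R * (1 - th) / th))%:E * (I k)%:E.
  have [qf I0 _ _] := HfI k; have [_ _ DE _] := HuD k.
  apply: le_of_exp => [//||A]; first exact: expR_gt0.
  rewrite lee_fin => IA; rewrite -expRD lee_fin ler_expR.
  have h1 := fW k A IA.
  have h2 : dint (Lp_fun p0 W (T (f k))) <= (K * (2 * expR (th * A + (1 - th) * B)))%:E.
    apply: le_trans (HK _ qf (le_lt_trans h1 (ltry _))) _.
    by rewrite EFinM lee_wpmul2l// lee_fin ltW.
  have := le_trans (uW k) (lee_wpmul2l (_ : 0 <= (expR ((1 - th) * (k%:R + d k)))%:E) h2).
  rewrite lee_fin expR_ge0 => /(_ isT); rewrite DE -/(d k) -EFinM lee_fin.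
  rewrite mulrA (mulrC K) -[(2 * K)%R]lnK ?posrE ?mulr_gt0// -!expRD ler_expR => h3.
  rewrite -(ler_pM2l th0).
  have -> : (th * (C + k%:R * (1 - th) / th + A) = (1 - th) * B + ln (2 * K) + k%:R * (1 - th) + th * A)%R.
    by rewrite /C; field; rewrite gt_eqF.
  lra.
have [k Ck] := exp_sequence_unbounded ((L + 1) * expR C) ltr01.
have [_ I0 _ _] := HfI k; have [_ _ _ lu] := HuD k.
have := dI k; rewrite -EFinM lee_fin -/(d k) => h.
have Lp1 : (0 < L + 1)%R by rewrite addr_gt0.
have [Iz|Iz] := eqVneq (I k) 0%R; first by move: h; rewrite Iz mulr0 leNgt expR_gt0.
have {I0}I0 : (0 < I k)%R by rewrite lt_def Iz.
have := lt_le_trans lu (ler_wpM2l (ltW Lp1) h).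
apply/negP; rewrite -leNgt mulrA ler_wpM2r ?(ltW I0)//.
have -> : (k%:R / th = 1 * k%:R + k%:R * (1 - th) / th)%R by field; rewrite gt_eqF.
by rewrite !expRD mulrA ler_wpM2r ?expR_ge0// ltW.
Qed.

End extrapolation_up.

(** * Conclusion, including the degenerate cases *)

Section boundedness.
Variables (R : realType) (n : nat) (b : R).
Local Notation V := 'rV[R]_n.
Local Notation cubeT := (cubeT n).
Local Notation dint := (dint b).
Local Notation hcontent := (hcontent b).
Local Open Scope ereal_scope.

Variable T : (V -> \bar R) -> (V -> \bar R).

Section nondegenerate.
Hypotheses (b0 : (0 < b)%R) (n0 : (0 < n)%N) (omega0 : (0 < omega b)%R).
Hypothesis nondeg : 0 < hcontent (cube (ucube n)).

Lemma aw0 (t : R) : aw b 1 t (fun _ : V => 0%R).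
Proof.
exists (ln (nbrC R n)) => P.
have e : dint (exf (fun _ : V => 0%R) \_ (ncube 1 P)) <= (expR (ln (nbrC R n) + lrho b P.1))%:E.
  rewrite expRD lnK ?posrE ?nbrC_gt0// -rhoE.
  apply: le_trans (dint1_ncube1 b P); apply: dint_le => x; rewrite !patchE.
  by case: ifP; rewrite // /exf expR0.
exists (ln (nbrC R n) + lrho b P.1)%R, (ln (nbrC R n) + lrho b P.1)%R; split.
- by move: e; rewrite (_ : wt t (fun=> 0%R) = fun=> 0%R)//; apply/funext => x; rewrite /wt mulr0.
- by move: e; rewrite (_ : dl t (fun=> 0%R) = fun=> 0%R)//; apply/funext => x; rewrite /dl mulr0.
- lra.
Qed.

Lemma bounded_on_Ap (p p0 : R) (w : V -> \bar R) : (1 < p0)%R -> (1 < p)%R ->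
  (forall v, Ap b p0 v -> bounded_on_Lp b p0 v T) -> Ap b p w -> bounded_on_Lp b p w T.
Proof.
move=> p01 p1 hT wA; have w0 : weight w by case: wA.
have [s [N [N0 sA wE]]] := Ap_aw b0 omega0 nondeg p1 wA.
have [pp|pp|pp] := ltgtP p p0.
- exact: extrapolate_down pp hT w0 sA N0 wE.
- exact: extrapolate_up pp hT w0 sA N0 wE.
- by rewrite pp; apply: hT; rewrite -pp.
Qed.

Lemma bounded_on_A1 (p p0 : R) (w : V -> \bar R) : (1 < p)%R -> (p < p0)%R ->
  (forall v, Ap b p0 v -> bounded_on_Lp b p0 v T) -> A1 b w -> bounded_on_Lp b p w T.
Proof.
move=> p1 pp0 hT wA; have w0 : weight w by case: wA.
have pp : (0 < p)%R by exact: lt_trans p1.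
have p01 : (1 < p0)%R by exact: lt_trans pp0.
have p00 : (0 < p0)%R by exact: lt_trans p01.
have t0 : (0 < p^-1)%R by rewrite invr_gt0.
have t1 : (p^-1 < 1)%R by rewrite invf_lt1.
have F0 g : forall x, 0 <= Lp_fun p w g x by exact: Lp_fun_ge0.
have vanish g N : null b N -> (forall x, ~ N x -> Lp_fun p w g x = 0) ->
    dint (Lp_fun p w g) = 0.
  move=> N0 gz; apply/(dint0P b (F0 g)); apply: null_sub N0 => x /= /eqP gx.
  by apply: contrapT => Nx; apply: gx; exact: gz.
have [N [N0 [wz|wy|[s sA wE]]]] := A1_cases b0 omega0 nondeg t0 t1 wA.
- apply: (bounded_on_LpI b0 omega0 pp w0 (lexx 0%R)) => f _ _.
  by rewrite mul0e (vanish _ _ N0)// => x Nx; rewrite /Lp_fun wz// mule0.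
(* An infinite weight forces [f = 0] off a null set. Then [f] has norm 0 in the unweighted [L^p0],
   and so has [T f]. *)
- pose W := exf (wt p0^-1 (fun _ : V => 0%R)).
  have W0 x : 0 <= W x by exact: exf_ge0.
  have WE x : W x = 1 by rewrite /W /exf /wt mulr0 expR0.
  have WA : Ap b p0 W.
    rewrite -[p0]invrK; apply: (aw_Ap b0 omega0 nondeg); rewrite ?invr_gt0 ?invf_lt1//.
    exact: aw0.
  have [K K0 HK] := bounded_on_LpE b0 omega0 p00 W0 (hT _ WA).
  apply: (bounded_on_LpI b0 omega0 pp w0 (lexx 0%R)) => f qf fin; rewrite mul0e.
  have f0 : dint (Lp_fun p0 W f) = 0.
    apply/(dint0P b (Lp_fun_ge0 p0 f W0)).
    apply: null_sub (null_setU N0 (null_pinfty (F0 f) fin)) => x /= fx.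
    have [Nx|Nx] := pselect (N x); [by left|right].
    rewrite /Lp_fun wy// gt0_muley// poweR_gt0// lt_def abse_ge0 andbT.
    by apply: contraNneq fx => fx0; rewrite /Lp_fun fx0 poweR0r ?mul0e// gt_eqF.
  have Tf0 : dint (Lp_fun p0 W (T f)) = 0.
    apply/le_anti/andP; split; last exact: dint_ge0.
    by have := HK f qf; rewrite f0 mule0; exact.
  rewrite (vanish _ _ (proj1 (dint0P b (Lp_fun_ge0 p0 (T f) W0)) Tf0))// => x /= fx.
  have [Tx|Tx] := eqVneq (`|T f x|) 0.
    by rewrite /Lp_fun Tx poweR0r ?mul0e// gt_eqF.
  exfalso; apply: fx; rewrite /Lp_fun WE mule1 poweR_eq0 ?abse_ge0//.
  by rewrite (negPf Tx).
- exact: extrapolate_down pp0 hT w0 sA N0 wE.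
Qed.

End nondegenerate.

Lemma bounded_degenerate (p : R) (w : V -> \bar R) : (1 < p)%R ->
  (forall f : V -> \bar R, choquet b f = 0) -> bounded_on_Lp b p w T.
Proof.
move=> p1 ch0; exists 0%R; split=> // f _.
by rewrite /Lp_norm !ch0 poweR0r ?mule0// gt_eqF// invr_gt0 (lt_trans _ p1).
Qed.

Lemma omega_ge0 : (0 <= omega b)%R.
Proof.
rewrite divr_ge0 ?powR_ge0//; apply: Rintegral_ge0 => x _.
by rewrite mulr_ge0 ?powR_ge0 ?expR_ge0.
Qed.

(** All balls cost 0, and concentric balls exhaust the space. *)
Lemma choquet_omega0 (f : V -> \bar R) : (0 < b)%R -> omega b = 0%R -> choquet b f = 0.
Proof.
move=> b0 om; apply: integral0_eq => t _.
apply/le_anti/andP; split; last exact: hcontent_ge0 omega_ge0 _.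
apply: ereal_inf_lbound; exists (fun=> 0%R), (fun j => j.+1%:R)%R; split => //.
- move=> x _; exists (Num.truncn (Num.sqrt (\sum_(i < n) (x ord0 i) ^+ 2))) => //.
  rewrite /eball /=; apply: le_lt_trans (truncnS_gt _).
  by under eq_bigr do rewrite mxE subr0.
- by rewrite eseries0// => j _ _; rewrite om mul0r.
Qed.

(* Every cube is a homothetic image of the unit cube. *)
Lemma choquet_cube0 (f : V -> \bar R) : (0 < b)%R -> (0 < omega b)%R ->
  hcontent (cube (ucube n)) = 0 -> choquet b f = 0.
Proof.
move=> b0 omega0 h0.
have nullc (P : cubeT) : null b (cube P).
  apply/(hcontent_null b0 omega0).
  have s0 : (0 < (2 ^ P.1)^-1 :> R)%R by rewrite invr_gt0 side_gt0.
  have := hcontent_affine omega0 (cube (ucube n)) (- ((2 ^ P.1)^-1 *: corner R P))%R s0.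
  rewrite h0 pmule_rle0 ?lte_fin ?powR_gt0// => h.
  apply/le_anti/andP; split; last exact: hcontent_ge0 (ltW omega0) _.
  apply: le_trans h; apply: le_hcontent => x Px /=.
  rewrite /cube /=; apply/rowP => i; rewrite dyE !mxE expr0z divr1.
  have := Px; rewrite /cube /= => /rowP /(_ i); rewrite dyE => xi.
  rewrite mulrC [X in (_ - X)%R]mulrC mulfK ?gt_eqF ?side_gt0//.
  by rewrite -xi floorDrz ?rpredN ?intr_int// -intrN intrKfloor subrr.
apply/le_anti/andP; split; last by apply: choquet_ge0; exact: ltW.
apply: le_trans (choquet_le_dint b0 (ltW omega0) f) _.
have Vnull : null b [set: V].
  apply: null_sub (null_bigcup (fun m : 'rV[int]_n => nullc (0%R : int, m))) => x _.
  by exists (dy 0 x).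
suff -> : dint f = 0 by rewrite mule0.
rewrite -(nullP f Vnull); congr dint; apply/funext => x.
by rewrite patchE mem_set.
Qed.

End boundedness.

Theorem theorem3p4 (R : realType) (n : nat) (b : R) (p0 : R)
    (T : ('rV[R]_n -> \bar R) -> ('rV[R]_n -> \bar R))
    (hb0 : 0 < b) (hbn : b <= n%:R) (hp0 : 1 < p0)
    (hT : forall w : 'rV[R]_n -> \bar R, Ap b p0 w -> bounded_on_Lp b p0 w T)
    (hTnorm : exists phi : R -> R, forall w : 'rV[R]_n -> \bar R, Ap b p0 w ->
       operator_norm b p0 w T <= phi (Ap_const b p0 w)) :
  (forall p : R, 1 < p -> p < p0 ->
     forall w : 'rV[R]_n -> \bar R, A1 b w -> bounded_on_Lp b p w T)
  /\
  (forall p : R, 1 < p ->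
     forall w : 'rV[R]_n -> \bar R, Ap b p w -> quasi_continuous b w ->
       bounded_on_Lp b p w T).
Proof.
have n0 : (0 < n)%N by rewrite -(ltr_nat R); exact: lt_le_trans hbn.
(* If [omega b] or the content of the unit cube is 0, all Choquet integrals vanish and every
   operator is bounded with constant 0. Otherwise both are positive, as the lower bound on the
   content of cubes requires. *)
have [omz|omz] := eqVneq (omega b) 0.
  by split=> *; apply: bounded_degenerate => // f; exact: choquet_omega0.
have omega0 : 0 < omega b by rewrite lt_def omz omega_ge0.
have [h0|h0] := eqVneq (hcontent b (cube (ucube n))) 0%E.
  by split=> *; apply: bounded_degenerate => // f; exact: choquet_cube0.
have nondeg : (0 < hcontent b (cube (ucube n)))%E.
  by rewrite lt_def h0; exact: hcontent_ge0 (ltW omega0) _.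
split=> [p p1 pp0 w wA|p p1 w wA _].
- exact: bounded_on_A1 p1 pp0 hT wA.
- exact: bounded_on_Ap hp0 p1 hT wA.
Qed.
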